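(* Let $p\in[1,2)$, let $x:[0,T]\to\mathbb{R}^m$ be a c\`adl\`ag (possibly discontinuous) function of finite $p$-variation, let $f:\mathbb{R}^d\to \mathrm{Hom}(\mathbb{R}^m,\mathbb{R}^d)$ be in $\mathrm{Lip}(\alpha)$ for some $\alpha>p$, and let $a\in\mathbb{R}^d$. Then there exists a unique geometric solution to the integral equation $$y_t = y_0 + \int_0^t f(y_s)\,dx_s,\qquad y_0=a .$$ For every $p\in[1,2)$, every c\`adl\`ag (possibly discontinuous) function $x:[0,T]\to\mathbb{R}^m$ of finite $p$-variation, every $f:\mathbb{R}^d\to \mathrm{Hom}(\mathbb{R}^m,\mathbb{R}^d)$ in $\mathrm{Lip}(\alpha)$ for some $\alpha>p$, and every $a\in\mathbb{R}^d$, there also exists a unique forward solution to this equation.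
   Context: $p$-variation: $\|x\|_{p,[0,t]}=\{\sup_{\pi}\sum_{\pi}|x(t_k)-x(t_{k-1})|^p\}^{1/p}$, the supremum over all finite partitions $\pi$ of $[0,t]$. $\mathrm{Lip}(\alpha)$: for $\alpha\in(0,1]$, $f\in\mathrm{Lip}(\alpha)$ iff $\|f\|_\infty+\sup_{x\ne y}|f(x)-f(y)|/|x-y|^\alpha<\infty$ (this quantity is the norm $\|f\|_{\mathrm{Lip}(\alpha)}$). For $\alpha>1$, $f\in\mathrm{Lip}(\alpha)$ iff $\|f\|_\infty<\infty$ and every partial derivative $\partial f/\partial x_j$ is in $\mathrm{Lip}(\alpha-1)$; the norm is $\|f\|_{\infty}+\sum_j\|\partial f/\partial x_j\|_{\mathrm{Lip}(\alpha-1)}$. Parametrisation: let $j(u)=x(u)-x(u-)$ be the jump of $x$ at time $u$ and let $t_n$ be the time of the $n$-th largest jump. For $\delta>0$ put $\tau^\delta(t)=t+\delta\sum_{n\ge1}|j(t_n)|^p\chi_{\{t_n\le t\}}$, $t\in[0,T]$. Define the continuous path $x^\delta:[0,\tau^\delta(T)]\to\mathbb{R}^m$ by $x^\delta(s)=x(t)$ if $s=\tau^\delta(t)$, and $x^\delta(s)=x(t_n-)+(s-\tau^\delta(t_n-))\,j(t_n)\,\delta^{-1}|j(t_n)|^{-p}$ if $s\in[\tau^\delta(t_n-),\tau^\delta(t_n))$. Geometric solution: a path $y$ on $[0,T]$ of the form $y_t=y^\delta_{\tau^\delta(t)}$, where $y^\delta$ is a continuous path of finite $p$-variation on $[0,\tau^\delta(T)]$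 with $y^\delta_s=a+\int_0^s f(y^\delta_r)\,dx^\delta_r$ (Young integral). Geometric solutions started at time $s$ from a point $b$ are defined in the same way on $[s,T]$; denote by $y_{s,t}(b)$ their value at time $t$. Forward solution: a solution whose jumps are $z_t-z_{t-}=f(z_{t-})(x_t-x_{t-})$ at the jump times $t$ of $x$, obtained from the geometric solution by jump correction. Precisely, $z^n$ is the path with $z^n_0=a$ which jumps by $z^n_{t_i}-z^n_{t_i-}=f(z^n_{t_i-})(x_{t_i}-x_{t_i-})$ at the times $t_1,\dots,t_n$ of the $n$ largest jumps of $x$ and which, between consecutive such times, follows the geometric solution of the equation (i.e. $z^n_u=y_{s,u}(z^n_s)$ for $s<u$ with no $t_1,\dots,t_n$ in $(s,u]$); the forward solution is the uniform limit of $z^n$ on $[0,T]$ as $n\to\infty$ (if $x$ has only $N$ jumps, it is $z^N$). *)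

(* Defs.v *)
From HB Require Import structures.
From mathcomp Require Export all_boot all_order all_algebra.
From mathcomp Require Export all_classical all_reals all_analysis.

Set Implicit Arguments.
Unset Strict Implicit.
Unset Printing Implicit Defensive.

Export Order.TTheory GRing.Theory Num.Theory.
Export numFieldNormedType.Exports.

Local Open Scope classical_set_scope.
Local Open Scope ring_scope.

(* R^m is 'cV[R]_m and Hom(R^m, R^d) is 'M[R]_(d, m), acting by *m.  A path on
   [a, b] is a total function on R of which only the values on [a, b] matter. *)

(* The Euclidean norm; MathComp-Analysis's own norm on matrices is the sup
   norm.  The topologies coincide, but jump sizes and hence the
   parametrisation below depend on the norm. *)
Definition enorm (R : realType) (m n : nat) (A : 'M[R]_(m, n)) : R :=
  Num.sqrt (\sum_i \sum_j A i j ^+ 2).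

Definition sup_norm (R : realType) (d k l : nat) (f : 'cV[R]_d -> 'M[R]_(k, l))
    : \bar R :=
  ereal_sup [set (enorm (f u))%:E | u in [set: 'cV[R]_d]].

Definition holder_seminorm (R : realType) (d k l : nat) (alpha : R)
    (f : 'cV[R]_d -> 'M[R]_(k, l)) : \bar R :=
  ereal_sup [set (enorm (f w.1 - f w.2) / enorm (w.1 - w.2) `^ alpha)%:E
            | w in [set w : 'cV[R]_d * 'cV[R]_d | w.1 != w.2]].

Inductive Lip (R : realType) (d k l : nat) :
    R -> ('cV[R]_d -> 'M[R]_(k, l)) -> Prop :=
| Lip_le1 (alpha : R) (f : 'cV[R]_d -> 'M[R]_(k, l)) :
    0 < alpha <= 1 ->
    (sup_norm f + holder_seminorm alpha f < +oo)%E ->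
    Lip alpha f
| Lip_gt1 (alpha : R) (f : 'cV[R]_d -> 'M[R]_(k, l)) :
    1 < alpha ->
    (sup_norm f < +oo)%E ->
    (forall (j : 'I_d) (u : 'cV[R]_d), derivable f u (delta_mx j 0)) ->
    (forall j : 'I_d, Lip (alpha - 1) (fun u => 'D_(delta_mx j 0) f u)) ->
    Lip alpha f.

(* The points of the partition encoded by [s] are those of [a :: s]. *)
Definition pvariation (R : realType) (m : nat) (p a b : R) (x : R -> 'cV[R]_m)
    : \bar R :=
  (ereal_sup [set (\sum_(0 <= i < size s)
                     enorm (x (nth b (a :: s) i.+1) - x (nth b (a :: s) i))
                       `^ p)%:E
             | s in itv_partition a b] `^ p^-1)%E.

Definition cadlag (R : realType) (m : nat) (a b : R) (x : R -> 'cV[R]_m)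
    : Prop :=
  (forall u, a <= u < b -> x w @[w --> u^'+] --> x u) /\
  (forall u, a < u <= b -> cvg (x w @[w --> u^'-])).

Definition left_lim (R : realType) (V : normedModType R) (x : R -> V) (u : R)
    : V :=
  lim (x w @[w --> u^'-]).

Definition jump (R : realType) (m : nat) (x : R -> 'cV[R]_m) (u : R) : 'cV[R]_m :=
  x u - left_lim x u.

(* A path started at time a has no jump at a. *)
Definition jump_times (R : realType) (m : nat) (a t : R) (x : R -> 'cV[R]_m)
    : set R :=
  [set u | a < u <= t /\ jump x u != 0].

(* The terms are nonnegative, so the sum over all the jump times needs no
   enumeration of them. *)
Definition tau (R : realType) (m : nat) (delta p a : R) (x : R -> 'cV[R]_m)
    (t : R) : R :=
  t + delta * fine (\esum_(u in jump_times a t x) (enorm (jump x u) `^ p)%:E).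

(* The two clauses determine xd on [a, tau T]. *)
Definition parametrisation (R : realType) (m : nat) (delta p a T : R)
    (x xd : R -> 'cV[R]_m) : Prop :=
  (forall t, a <= t <= T -> xd (tau delta p a x t) = x t) /\
  (forall u s, jump_times a T x u ->
     left_lim (tau delta p a x : R -> R^o) u <= s < tau delta p a x u ->
     xd s = left_lim x u
            + ((s - left_lim (tau delta p a x : R -> R^o) u)
                 * delta^-1 * enorm (jump x u) `^ (- p)) *: jump x u).

(* The integral of g dx over [a, b] is I, in the sense of Young: I is the limit
   of the Riemann-Stieltjes sums, for every choice of the tags, as the mesh
   of the partition tends to 0. *)
Definition is_young_integral (R : realType) (m d : nat) (g : R -> 'M[R]_(d, m))
    (x : R -> 'cV[R]_m) (a b : R) (I : 'cV[R]_d) : Prop :=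
  forall eps : R, 0 < eps -> exists2 eta : R, 0 < eta &
  forall (s : seq R) (xi : nat -> R),
    itv_partition a b s ->
    (forall i, (i < size s)%N ->
       nth b (a :: s) i.+1 - nth b (a :: s) i < eta) ->
    (forall i, (i < size s)%N ->
       nth b (a :: s) i <= xi i <= nth b (a :: s) i.+1) ->
    enorm (\sum_(0 <= i < size s)
             g (xi i) *m (x (nth b (a :: s) i.+1) - x (nth b (a :: s) i)) - I)
      < eps.

(* y is the geometric solution on [a, T] started at time a from b. *)
Definition geometric_solution (R : realType) (m d : nat) (delta p a T : R)
    (x : R -> 'cV[R]_m) (f : 'cV[R]_d -> 'M[R]_(d, m)) (b : 'cV[R]_d)
    (y : R -> 'cV[R]_d) : Prop :=
  exists (xd : R -> 'cV[R]_m) (yd : R -> 'cV[R]_d),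
  [/\ parametrisation delta p a T x xd,
      {within `[a, tau delta p a x T], continuous yd},
      (pvariation p a (tau delta p a x T) yd < +oo)%E,
      forall s, a <= s <= tau delta p a x T ->
        exists2 I, is_young_integral (f \o yd) xd a s I & yd s = b + I
    & forall t, a <= t <= T -> y t = yd (tau delta p a x t)].

(* t n = Some u when u is the time of the (n+1)-st largest jump of x on [0, T],
   and t n = None when x has at most n jumps.  Ties are ordered arbitrarily. *)
Definition jump_ranking (R : realType) (m : nat) (T : R) (x : R -> 'cV[R]_m)
    (t : nat -> option R) : Prop :=
  [/\ forall u, (exists n, t n = Some u) <-> jump_times 0 T x u,
      forall n k u, t n = Some u -> t k = Some u -> n = k,
      forall n k, (n <= k)%N -> t n = None -> t k = None
    & forall n k u v, (n <= k)%N -> t n = Some u -> t k = Some v ->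
        enorm (jump x v) <= enorm (jump x u)].

(* The path z^n; the solutions y_{s,u}(b) are those of [geometric_solution]. *)
Definition jump_corrected (R : realType) (m d : nat) (delta p T : R)
    (x : R -> 'cV[R]_m) (f : 'cV[R]_d -> 'M[R]_(d, m)) (a : 'cV[R]_d)
    (t : nat -> option R) (n : nat) (z : R -> 'cV[R]_d) : Prop :=
  [/\ z 0 = a,
      forall i u, (i < n)%N -> t i = Some u ->
        cvg (z w @[w --> u^'-]) /\
        z u - left_lim z u = f (left_lim z u) *m (x u - left_lim x u)
    & forall s u, 0 <= s -> s < u -> u <= T ->
        (forall i v, (i < n)%N -> t i = Some v -> ~ (s < v <= u)) ->
        exists2 y, geometric_solution delta p s T x f (z s) y & z u = y u].

(* If x has only N jumps then z^n = z^N on [0, T] for n >= N, and the limit is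
   z^N.  Because of ties there may be several rankings of the jumps; z is
   required to be the limit for each of them. *)
Definition forward_solution (R : realType) (m d : nat) (delta p T : R)
    (x : R -> 'cV[R]_m) (f : 'cV[R]_d -> 'M[R]_(d, m)) (a : 'cV[R]_d)
    (z : R -> 'cV[R]_d) : Prop :=
  (exists t, jump_ranking T x t) /\
  (forall t, jump_ranking T x t ->
     exists zs : nat -> R -> 'cV[R]_d,
       (forall n, jump_corrected delta p T x f a t n (zs n)) /\
       {uniform `[0, T], zs n @[n --> \oo] --> z}).

(* Main.v *)
From mathcomp Require Import lra ring zify.
Require Import Defs.

Set Implicit Arguments.
Unset Strict Implicit.
Unset Printing Implicit Defensive.

Local Open Scope classical_set_scope.
Local Open Scope ring_scope.

(** The equation is solved in a time scale in which the driving path has no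
    jumps.  Let V t be the p-th power of the p-variation of x on [0, t] (for the
    sup norm) and F t = t + V t.  This clock is strictly increasing and cadlag, it
    has a gap (F (t-), F t) exactly where x jumps, and |x t - x s|^p <= F t - F s
    ([variation_clock]).  Reading x against F and filling every gap linearly gives
    a path X, [unfolded], that is Hoelder with exponent g = 1/p > 1/2
    ([interp_holder]).

    In this scale a solution is a path Y with
      |Y r' - Y r - f (Y r) (X r' - X r)| <= M (r' - r)^(2 g)   when r' - r <= h
    ([davie_on]).  Since 2 g > 1, the sewing lemma ([sewing]) proves this estimate
    for Euler schemes with constants that do not depend on the mesh
    ([euler_apriori]); applied to the difference of two schemes it gives stability
    ([stability]).  Stability is where alpha > p is needed: the derivative of f is
    Hoelder with an exponent b > p - 1 ([Lip_field]), that is (1 + b) g > 1.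
    Solutions exist as limits of Euler schemes along an ultrafilter of finite sets
    of times ([davie_exists]), and they are unique ([davie_unique]).

    The set A of times on which Y is required to solve the equation is arbitrary,
    and the two notions of solution differ only in A.

    For A = [F s, F T] one gets the geometric solutions.  Every tau^delta is
    another clock with the same gaps as F, so x^delta is X after a continuous
    increasing change of time ([parametrisation_unique]).  A Davie solution
    satisfies the Young equation ([davie_young]); conversely a Young solution
    satisfies a Davie estimate in the clock obtained by adding its own
    p-variation, and stability identifies it with the Davie solution
    ([young_solution_unique]).  Hence the geometric solution from time s is Y o F,
    for every delta.

    Removing from A the gap of a jump replaces the flow along the segment that
    fills the gap by one Euler step across it ([exact_gaps]), which is the forward
    jump rule.  So z^n is Y_n o F, where Y_n solves the equation outside the gaps
    of the n largest jumps ([corrected_of_davie]), and the forward solution is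
    Y o F, where Y solves it outside all the gaps.  Only finitely many gaps are
    longer than a given eps.  Once n is so large that these are removed, Y_n and Y
    make exact steps across them and short steps elsewhere, and stability bounds
    their distance by a constant times eps^(2 g - 1) ([corrected_converge]).  The
    path z^n is unique because geometric solutions are, by induction on the number
    of jumps met before a given time ([corrected_unique]). *)

(** * Identities in abelian groups and arithmetic closers *)

(** Vectors carry no product, so an identity between sums of vectors is decided
    by comparing the integer coefficients of its atoms; [zmod] reifies both sides. *)
Inductive zexp := ZVar of nat | ZZero | ZAdd of zexp & zexp | ZOpp of zexp.

Fixpoint zden (V : zmodType) (env : seq V) (e : zexp) : V :=
  match e with
  | ZVar n => env`_n
  | ZZero => 0
  | ZAdd a b => zden env a + zden env b
  | ZOpp a => - zden env a
  end.

Fixpoint zcoef (e : zexp) (n : nat) : int :=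
  match e with
  | ZVar k => if k == n then 1 else 0
  | ZZero => 0
  | ZAdd a b => zcoef a n + zcoef b n
  | ZOpp a => - zcoef a n
  end.

Lemma zdenE (V : zmodType) (env : seq V) (e : zexp) :
  zden env e = \sum_(i < size env) env`_i *~ zcoef e i.
Proof.
elim: e => [n||a IHa b IHb|a IHa] /=.
- have [nle|nlt] := leqP (size env) n.
    rewrite nth_default // big1 // => i _.
    by rewrite gtn_eqF ?mulr0z // (leq_trans (ltn_ord i)).
  rewrite (bigD1 (Ordinal nlt)) //= eqxx big1 ?addr0 // => i /eqP/val_eqP/= ni.
  by rewrite eq_sym (negbTE ni) mulr0z.
- by rewrite big1 // => i _; rewrite mulr0z.
- by rewrite IHa IHb -big_split /=; apply: eq_bigr => i _; rewrite mulrzDr.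
- by rewrite IHa -sumrN; apply: eq_bigr => i _; rewrite mulrNz.
Qed.

Lemma zden_eq (V : zmodType) (env : seq V) (a b : zexp) :
  all (fun i => zcoef a i == zcoef b i) (iota 0 (size env)) ->
  zden env a = zden env b.
Proof.
move=> /allP h; rewrite !zdenE; apply: eq_bigr => i _.
by rewrite (eqP (h i _)) // mem_iota /= ltn_ord.
Qed.

Ltac zindex x l :=
  lazymatch l with
  | x :: _ => constr:(O)
  | _ :: ?l' => let n := zindex x l' in constr:(S n)
  end.
Ltac zin x l :=
  lazymatch l with
  | nil => constr:(false)
  | x :: _ => constr:(true)
  | _ :: ?l' => zin x l'
  end.
Ltac zatoms t l :=
  lazymatch t with
  | (?a + ?b)%R => let l' := zatoms a l in zatoms b l'
  | (- ?a)%R => zatoms a l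
  | 0%R => l
  | _ => let b := zin t l in lazymatch b with true => l | false => constr:(t :: l) end
  end.
Ltac zreify t l :=
  lazymatch t with
  | (?a + ?b)%R => let a' := zreify a l in let b' := zreify b l in constr:(ZAdd a' b')
  | (- ?a)%R => let a' := zreify a l in constr:(ZOpp a')
  | 0%R => constr:(ZZero)
  | _ => let n := zindex t l in constr:(ZVar n)
  end.
Ltac zmod :=
  lazymatch goal with
  | |- @eq ?T ?a ?b =>
    let l0 := zatoms a (@nil T) in
    let l := zatoms b l0 in
    let a' := zreify a l in
    let b' := zreify b l in
    refine (@zden_eq _ l a' b' _); vm_compute; reflexivity
  end.

(** Discarding every hypothesis that is not about natural numbers keeps the
    arithmetic problem small. *)
Ltac slia :=
  repeat match goal with
  | H : ?P |- _ =>
    lazymatch P with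
    | is_true (leq _ _) => fail
    | is_true (andb (leq _ _) (leq _ _)) => fail
    | is_true (negb (@eq_op _ _ _)) => fail
    | nat => fail
    | ~ _ => fail
    | @eq nat _ _ => fail
    | _ => clear H
    end
  end; lia.

(** The bounds that matter are first moved to the goal; the others only slow down
    linear arithmetic. *)
Ltac clr := repeat match goal with H : is_true _ |- _ => clear H end.

(** * Powers of nonnegative reals; the sewing lemma *)

Section Powers.
Variable R : realType.
Implicit Types a b c r s w : R.

Lemma powR_le a b r : 0 <= r -> 0 <= a -> a <= b -> a `^ r <= b `^ r.
Proof.
move=> r0 a0 ab; apply: ge0_ler_powR => //; rewrite nnegrE //.
exact: le_trans ab.
Qed.

Lemma powR_add w r s : 0 < r -> 0 < s -> w `^ (r + s) = w `^ r * w `^ s.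
Proof.
move=> r0 s0; apply: powRD; apply/implyP => /eqP rs0.
by have := addr_gt0 r0 s0; rewrite rs0 ltxx.
Qed.

Lemma powR_le1 w r : 0 <= r -> 0 <= w <= 1 -> w `^ r <= 1.
Proof.
move=> r0 /andP[w0 w1]; have : w `^ r <= 1 `^ r by exact: powR_le.
by rewrite powR1.
Qed.

Lemma powR_anti w r s : 0 < r -> r <= s -> 0 <= w <= 1 -> w `^ s <= w `^ r.
Proof.
move=> r0; rewrite le_eqVlt => /orP[/eqP->//|rs] w01.
have sr : 0 < s - r by lra.
have -> : s = r + (s - r) by ring.
rewrite powR_add // -[leRHS]mulr1 ler_wpM2l ?powR_ge0 // powR_le1 //.
exact: ltW.
Qed.

Lemma powR_half w r : 0 <= w -> (w / 2) `^ r = 2^-1 `^ r * w `^ r.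
Proof. by move=> w0; rewrite powRM // mulrC. Qed.

Lemma powR_small A r : 0 <= A -> 0 < r ->
  exists h : R, [/\ 0 < h, h <= 1 & A * h `^ r <= 2^-1].
Proof.
move=> A0 r0; set B := 2 * (A + 1).
have B2 : 2 <= B by rewrite /B; lra.
exists (B^-1 `^ r^-1); split.
- by apply: powR_gt0; rewrite invr_gt0; lra.
- apply: powR_le1; first by rewrite invr_ge0 ltW.
  by rewrite invr_ge0 invf_le1; lra.
- rewrite -powRrM mulVf ?gt_eqF // powRr1; last by rewrite invr_ge0; lra.
  rewrite ler_pdivrMr; [rewrite /B; lra|lra].
Qed.

Lemma powR_double w r : 0 < r -> w `^ (2 * r) = w `^ r * w `^ r.
Proof.
move=> r0; have e : 2 * r = r + r by ring.
by rewrite e powR_add.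
Qed.

(** An error of order r > 1 on a step of length at most e is a small multiple of
    the length of the step; summed over a partition it is a small multiple of the
    total length. *)
Lemma powR_superlinear w e r : 1 < r -> 0 <= w -> w <= e ->
  w `^ r <= e `^ (r - 1) * w.
Proof.
move=> r1 w0 we; have r10 : 0 < r - 1 by rewrite subr_gt0.
have -> : w `^ r = w `^ (r - 1) * w.
  by rewrite -[X in _ * X](powRr1 w0) -powR_add // subrK.
apply: ler_wpM2r => //.
by apply: powR_le => //; exact: ltW.
Qed.

Lemma powR_lt_small h Q r e : 0 < h <= 1 -> 0 <= Q -> 0 < r -> 0 < e ->
  exists2 eps : R, 0 < eps <= h & Q * eps `^ r < e.
Proof.
move=> /andP[h0 h1] Q0 r0 e0.
have [eps [eps0 eps1 hq]] := powR_small (divr_ge0 Q0 (ltW e0)) r0.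
exists (Num.min eps h); first by rewrite lt_min eps0 h0 ge_min lexx orbT.
have : Q / e * Num.min eps h `^ r <= 2^-1.
  apply: le_trans hq; apply: ler_wpM2l; first by rewrite divr_ge0 // ltW.
  apply: powR_le; [exact: ltW| by rewrite le_min !ltW|by rewrite ge_min lexx].
rewrite mulrAC ler_pdivrMr //; lra.
Qed.

End Powers.

Section Sewing.
Variables (R : realType) (V : normedModType R).

(** The bisection point of a discrete interval.  The clock c may jump over the
    level l, so the step from j to j.+1 that crosses the level is isolated. *)
Lemma crossing (c : nat -> R) (i k : nat) (l : R) : (i < k)%N -> c i <= l ->
  exists j, [/\ (i <= j)%N, (j < k)%N, c j <= l & (j.+1 < k)%N -> l < c j.+1].
Proof.
move=> ik cil.
elim: k ik => // k IH; rewrite ltnS leq_eqVlt => /orP[/eqP <-|ik].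
  by exists i; split => //; rewrite ltnn.
have [j [ij jk cj next]] := IH ik.
have [jk1|jk1] := ltnP j.+1 k.
  exists j; split => //; first exact: ltnW.
  by move=> _; exact: next.
have -> : k = j.+1 by apply/eqP; rewrite eqn_leq jk1 jk.
have [cl|lc] := leP (c j.+1) l.
  by exists j.+1; split => //; [exact: (leq_trans ij)|rewrite ltnn].
by exists j; split.
Qed.

Lemma norm_split (a b c : V) : `|a| <= `|a - b - c| + (`|b| + `|c|).
Proof.
have aE : a = (a - b - c) + (b + c) by rewrite -[a - b - c]addrA -opprD subrK.
by rewrite {1}aE (le_trans (ler_normD _ _)) // lerD2l ler_normD.
Qed.

(** Twice the sum of the geometric series of ratio 2 * 2^-th. *)
Definition sew_const (th : R) : R := 2 / (1 - 2 * 2^-1 `^ th).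

Lemma sew_const_den_gt0 (th : R) : 1 < th -> 0 < 1 - 2 * 2^-1 `^ th.
Proof.
move=> th1.
have -> : th = 1 + (th - 1) by ring.
rewrite powR_add ?powRr1; [|lra..].
rewrite mulrA divff // mul1r subr_gt0.
have : 2^-1 `^ (th - 1) < (1 : R) `^ (th - 1).
  by apply: gt0_ltr_powR; rewrite ?nnegrE; lra.
by rewrite powR1.
Qed.

Lemma sew_const_gt0 (th : R) : 1 < th -> 0 < sew_const th.
Proof. by move=> th1; rewrite divr_gt0 // sew_const_den_gt0. Qed.

(** Induction by bisection.  Cut [i, k] at the index j where the clock passes its
    midpoint.  Then S i k differs from S i j + S j j.+1 + S j.+1 k by two second
    differences, and both outer intervals have at most half the length, so the
    bound reproduces itself as soon as C * (2 * 2^-th) + 2 = C, which is solved by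
    [sew_const].  The linear term e * (c k - c i) carries the defects of the single
    steps.  The bound already proved for S i j is available when the second
    difference is estimated: in the applications that estimate depends on the size
    of S i j itself. *)
Lemma sewing (S : nat -> nat -> V) (c : nat -> R) (lo hi : nat) (th K e : R) :
  1 < th -> 0 <= K -> 0 <= e ->
  {homo c : i j / (i <= j)%N >-> i <= j} ->
  (forall i, S i i = 0) ->
  (forall i, (lo <= i < hi)%N -> `|S i i.+1| <= e * (c i.+1 - c i)) ->
  (forall i j k, (lo <= i)%N -> (i <= j)%N -> (j <= k)%N -> (k <= hi)%N ->
     `|S i j| <= sew_const th * K * (c j - c i) `^ th + e * (c j - c i) ->
     `|S i k - S i j - S j k| <= K * (c k - c i) `^ th) ->
  forall i k, (lo <= i)%N -> (i <= k)%N -> (k <= hi)%N ->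
    `|S i k| <= sew_const th * K * (c k - c i) `^ th + e * (c k - c i).
Proof.
move=> th1 K0 e0 cm S0 S1.
(* the constant is a fixed point of the bisection step *)
have CE : sew_const th * (2 * 2^-1 `^ th) + 2 = sew_const th.
  have := sew_const_den_gt0 th1; rewrite /sew_const => d0.
  by field; rewrite gt_eqF.
move: (sew_const th) (ltW (sew_const_gt0 th1)) CE => C C0 CE SK.
move=> i k; move: {2}(k - i)%N (leqnn (k - i)) => n.
elim: n i k => [|n IH] i k kin loi ik khi.
  have -> : i = k by slia.
  rewrite S0 normr0 subrr mulr0 addr0 !mulr_ge0 ?powR_ge0 // subr_ge0 cm.
have [ik2|ik2] := leqP k i.+1.
  have [ki|ki] : k = i \/ k = i.+1 by slia.
    rewrite ki S0 normr0 subrr mulr0 addr0 !mulr_ge0 ?powR_ge0 // subr_ge0 cm.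
  subst k; apply: le_trans (S1 i _) _; first by slia.
  by rewrite lerDr !mulr_ge0 ?powR_ge0 // subr_ge0 cm.
set w := c k - c i.
have w0 : 0 <= w by rewrite subr_ge0 cm.
have [j [ij jk cj next]] : exists j, [/\ (i <= j)%N, (j < k)%N, c j <= c i + w / 2
    & (j.+1 < k)%N -> c i + w / 2 < c j.+1].
  by apply: crossing; [slia|lra].
have B1 : `|S i j| <= C * K * (c j - c i) `^ th + e * (c j - c i).
  by apply: IH; slia.
have B2 : `|S j.+1 k| <= C * K * (c k - c j.+1) `^ th + e * (c k - c j.+1).
  by apply: IH; slia.
have B3 : `|S j j.+1| <= e * (c j.+1 - c j) by apply: S1; slia.
have cij := cm _ _ ij.
have cjj := cm _ _ (leqnSn j).
have cjk := cm _ _ jk.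
have D1 : `|S i k - S i j - S j k| <= K * w `^ th by apply: (SK i j k loi ij (ltnW jk) khi B1).
have D2 : `|S j k - S j j.+1 - S j.+1 k| <= K * w `^ th.
  have : `|S j k - S j j.+1 - S j.+1 k| <= K * (c k - c j) `^ th.
    apply: (SK j j.+1 k (leq_trans loi ij) (leqnSn j) jk khi).
    by apply: le_trans B3 _; rewrite lerDr !mulr_ge0 ?powR_ge0 // subr_ge0 cm.
  move/le_trans; apply; apply: ler_wpM2l => //; apply: powR_le; rewrite ?/w; lra.
have P1 : (c j - c i) `^ th <= 2^-1 `^ th * w `^ th.
  by rewrite -powR_half //; apply: powR_le; lra.
have P2 : (c k - c j.+1) `^ th <= 2^-1 `^ th * w `^ th.
  rewrite -powR_half //; apply: powR_le; [lra|lra|].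
  have [/next|] := ltnP j.+1 k; first by rewrite /w; lra.
  move=> kj; have -> : k = j.+1 by slia.
  by rewrite subrr; lra.
have T1 := norm_split (S i k) (S i j) (S j k).
have T2 := norm_split (S j k) (S j j.+1) (S j.+1 k).
have M1 := ler_wpM2l (mulr_ge0 C0 K0) P1.
have M2 := ler_wpM2l (mulr_ge0 C0 K0) P2.
have E1 : C * K * w `^ th = C * (2 * 2^-1 `^ th) * K * w `^ th + 2 * K * w `^ th.
  by rewrite -{1}CE; ring.
rewrite E1 [in e * w]/w; lra.
Qed.

End Sewing.

(** * Euler schemes: local expansion and stability *)

Section Growth.
Variable R : realType.

(** Local estimates hold on windows of length h.  A stretch of length L is covered
    by at most L / h + 1 windows, separated by single steps that may be longer than
    h; each window and each such step costs one factor Q. *)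
Lemma block_growth (h L Q : R) : 0 < h -> 1 <= Q ->
  exists2 Q' : R, 0 <= Q' & forall c w : nat -> R,
    {homo c : i j / (i <= j)%N >-> i <= j} ->
    (forall k, 0 <= w k) ->
    (forall i k, (i <= k)%N -> c k - c i <= h -> w k <= Q * w i) ->
    (forall k, w k.+1 <= Q * w k) ->
    forall k, c k - c 0%N <= L -> w k <= Q' * w 0%N.
Proof.
move=> h0 Q1; pose N := (Num.truncn (L / h)).+1.
have Q0 : 0 <= Q by lra.
exists (Q ^+ (2 * N).+1); first exact: exprn_ge0.
move=> c w cm w0 win step.
have key n i k : (i <= k)%N -> c k - c i <= n%:R * h -> w k <= Q ^+ (2 * n).+1 * w i.
  elim: n i k => [|n IH] i k ik cik.
    by rewrite muln0 expr1; apply: win => //; rewrite (le_trans cik) // mul0r ltW.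
  have pQ j : 1 <= Q ^+ j by exact: exprn_ege1.
  have sQ : Q ^+ (2 * n.+1).+1 = Q ^+ (2 * n).+1 * Q * Q.
    by rewrite mulnS addnC !exprS addn2 !exprS; ring.
  have [small|big] := leP (c k - c i) h.
    apply: (le_trans (win _ _ ik small)); apply: ler_wpM2r => //.
    by rewrite -[leLHS]expr1 ler_weXn2l.
  have lik : (i < k)%N.
    by rewrite ltn_neqAle ik andbT; apply: contraTneq big => ->; rewrite -leNgt subrr ltW.
  have [j [ij jk cj next]] : exists j, [/\ (i <= j)%N, (j < k)%N, c j <= c i + h
    & (j.+1 < k)%N -> c i + h < c j.+1] by apply: crossing => //; lra.
  have wj : w j <= Q * w i by apply: win => //; lra.
  have wj1 : w j.+1 <= Q * (Q * w i).
    by apply: le_trans (step j) _; apply: ler_wpM2l.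
  have [jk1|jk1] := ltnP j.+1 k; last first.
    have -> : k = j.+1 by slia.
    apply: (le_trans wj1); rewrite sQ -!mulrA; apply: ler_peMl; first exact: mulr_ge0 (mulr_ge0 _ _).
    exact: pQ.
  have : w k <= Q ^+ (2 * n).+1 * w j.+1.
    by apply: IH; [slia|have := next jk1; rewrite -natr1 in cik; lra].
  move/le_trans; apply; rewrite sQ -!mulrA; apply: ler_wpM2l => //.
  exact: exprn_ge0.
move=> k ckL; apply: key => //; apply: (le_trans ckL).
by rewrite -ler_pdivrMr // ltW // truncnS_gt.
Qed.

Lemma window_max (w : nat -> R) (i k : nat) : (i <= k)%N ->
  exists2 m, (i <= m <= k)%N & forall j, (i <= j <= k)%N -> w j <= w m.
Proof.
elim: k => [|k IH].
  by rewrite leqn0 => /eqP ->; exists 0%N => // j; rewrite leqn0 => /eqP ->.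
rewrite leq_eqVlt => /orP[/eqP <-|].
  by exists i; rewrite ?leqnn // => j ij; have -> : j = i by slia.
rewrite ltnS => ik; have [m mik wm] := IH ik.
have [wk|wk] := leP (w k.+1) (w m).
  exists m; first by slia.
  move=> j jik; have [->//|jk] := eqVneq j k.+1; apply: wm; slia.
exists k.+1; first by slia.
move=> j jik; have [->//|jk] := eqVneq j k.+1.
by apply: le_trans (ltW wk); apply: wm; slia.
Qed.

End Growth.

Section Scheme.
Variables (R : realType) (V W : normedModType R).

(** What the estimates use of phi y x = f y x when f is bounded and has a bounded
    b-Hoelder derivative.  The last condition states the Hoelder continuity of the
    derivative through second differences, in the form in which the difference of
    two solutions needs it. *)
Record c1beta (phi : V -> W -> V) (K b : R) : Prop := C1Beta {
  c1_ge0 : 0 <= K;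
  c1_add : forall y x x', phi y (x + x') = phi y x + phi y x';
  c1_bnd : forall y x, `|phi y x| <= K * `|x|;
  c1_lip : forall y y' x, `|phi y' x - phi y x| <= K * `|y' - y| * `|x|;
  c1_four : forall y y' z z' x,
    `|(phi y' x - phi y x) - (phi z' x - phi z x)| <=
    K * (`|(y' - y) - (z' - z)| + (`|y - z| + `|y' - z'|) `^ b * `|z' - z|) * `|x| }.

Variables (phi : V -> W -> V) (K b : R).
Hypothesis Hphi : c1beta phi K b.

Let K0 : 0 <= K := c1_ge0 Hphi.

Lemma c1_sub u v w : phi u (v - w) = phi u v - phi u w.
Proof.
have : phi u (v - w + w) = phi u (v - w) + phi u w by rewrite (c1_add Hphi).
by rewrite subrK => ->; rewrite addrK.
Qed.

Lemma c1_zero u : phi u 0 = 0.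
Proof. by rewrite -(subrr 0) c1_sub subrr. Qed.

Lemma davie_holder (u v : V) (dx : W) (w g H M : R) : 0 < g -> 0 <= w <= 1 ->
  0 <= M ->
  `|dx| <= H * w `^ g -> `|v - u - phi u dx| <= M * w `^ (2 * g) ->
  `|v - u| <= (K * H + M) * w `^ g.
Proof.
move=> g0 w01 M0 hx hr.
have : `|v - u| <= `|v - u - phi u dx| + `|phi u dx|.
  by rewrite -{1}(subrK (phi u dx) (v - u)) ler_normD.
have := c1_bnd Hphi u dx.
have : w `^ (2 * g) <= w `^ g by apply: powR_anti => //; lra.
have := powR_ge0 w g; have := powR_ge0 w (2 * g) => a1 a2 a3 a4.
have := ler_wpM2l K0 hx; have := ler_wpM2l M0 a3; lra.
Qed.

(** The Euler defect S i j = y_j - y_i - phi y_i (x_j - x_i) vanishes on single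
    steps, and its second difference is at most K |y_j - y_i| |x_k - x_j|, where
    |y_j - y_i| is again controlled by S i j.  On windows of length h this feedback
    is absorbed, because C K1 h^g <= 1/2; so M is independent of the mesh. *)
Lemma euler_apriori (g H : R) : 2^-1 < g -> 0 <= H ->
  exists h M : R, [/\ 0 < h, h <= 1, 0 <= M &
    forall (y : nat -> V) (x : nat -> W) (c : nat -> R),
    {homo c : i j / (i <= j)%N >-> i <= j} ->
    (forall i j, (i <= j)%N -> `|x j - x i| <= H * (c j - c i) `^ g) ->
    (forall i, y i.+1 = y i + phi (y i) (x i.+1 - x i)) ->
    forall i k, (i <= k)%N -> c k - c i <= h ->
      `|y k - y i - phi (y i) (x k - x i)| <= M * (c k - c i) `^ (2 * g)].
Proof.
move=> g2 H0.
have th1 : 1 < 2 * g by lra.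
have C0 := ltW (sew_const_gt0 th1).
(* K1 bounds the second differences once |S i j| <= w^g *)
pose K1 := K * H * (K * H + 1).
have KH0 : 0 <= K * H by rewrite mulr_ge0.
have K10 : 0 <= K1 by rewrite /K1; nra.
have [h [h0 h1 hC]] : exists h : R, [/\ 0 < h, h <= 1 &
  sew_const (2 * g) * K1 * h `^ g <= 2^-1].
  by apply: powR_small; [exact: mulr_ge0|lra].
exists h, (sew_const (2 * g) * K1); split => //; first exact: mulr_ge0.
move=> y x c cm hx step i k ik cik.
pose S i j := y j - y i - phi (y i) (x j - x i).
suff : `|S i k| <= sew_const (2 * g) * K1 * (c k - c i) `^ (2 * g)
                   + 0 * (c k - c i) by rewrite mul0r addr0.
apply: (@sewing R V S c i k (2 * g) K1 0 th1 K10 (lexx 0) cm) => //.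
- by move=> j; rewrite /S !subrr c1_zero subr0.
- by move=> j _; rewrite mul0r /S step [y j + _]addrC addrK subrr normr0.
move=> j1 j2 j3 ij1 j12 j23 j3k.
rewrite mul0r addr0 => IH.
have -> : S j1 j3 - S j1 j2 - S j2 j3 = phi (y j2) (x j3 - x j2) - phi (y j1) (x j3 - x j2).
  by rewrite /S !c1_sub; zmod.
have w1 := cm _ _ j12; have w2 := cm _ _ j23.
have w3 := cm _ _ ij1; have w4 := cm _ _ j3k.
set w := c j3 - c j1; have w0 : 0 <= w by rewrite /w; lra.
have H1 : `|y j2 - y j1| <= (K * H + 1) * (c j2 - c j1) `^ g.
  have : `|y j2 - y j1| <= `|S j1 j2| + `|phi (y j1) (x j2 - x j1)|.
    by rewrite -{1}(subrK (phi (y j1) (x j2 - x j1)) (y j2 - y j1)) ler_normD.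
  have := c1_bnd Hphi (y j1) (x j2 - x j1).
  have := ler_wpM2l K0 (hx _ _ j12).
  move: IH; rewrite powR_double; [|lra].
  have : (c j2 - c j1) `^ g <= h `^ g by apply: powR_le; lra.
  have := powR_ge0 (c j2 - c j1) g.
  set p := _ `^ g; set q := h `^ g => p0 pq.
  have cp := ler_wpM2l (mulr_ge0 C0 K10) pq.
  have cp1 : sew_const (2 * g) * K1 * p <= 1 by move: cp hC; rewrite -/q; clr; lra.
  have := ler_wpM2r p0 cp1; clr; lra.
have H2 := hx _ _ j23.
apply: (le_trans (c1_lip Hphi _ _ _)).
rewrite powR_double; [|lra].
have p1 : (c j2 - c j1) `^ g <= w `^ g by apply: powR_le; rewrite ?/w; lra.
have p2 : (c j3 - c j2) `^ g <= w `^ g by apply: powR_le; rewrite ?/w; lra.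
have H1' : `|y j2 - y j1| <= (K * H + 1) * w `^ g.
  by apply: le_trans H1 _; apply: ler_wpM2l => //; lra.
have H2' : `|x j3 - x j2| <= H * w `^ g.
  by apply: le_trans H2 _; apply: ler_wpM2l.
have := ler_pM (normr_ge0 _) (normr_ge0 _) H1' H2'.
move/(ler_wpM2l K0); rewrite /K1; lra.
Qed.

(** The difference D of two schemes satisfies the linearised equation up to
    defects e dc.  By the four-point estimate, the second difference of its Euler
    defect is of order w^((1 + b) g) with (1 + b) g > 1, and linear in the maximum m
    of |D| over the window, so sewing bounds the variation of D there by a small
    multiple of m + e; hence m is at most a constant times |D i| + e.  Windows are
    chained by [block_growth]. *)
Lemma stability (g H M h0 L : R) : 0 < b <= 1 -> 2^-1 < g <= 1 ->
  1 < (1 + b) * g -> 0 < h0 -> 0 <= H -> 0 <= M -> 0 <= L ->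
  exists2 Q : R, 0 <= Q &
    forall (y y' : nat -> V) (x : nat -> W) (c : nat -> R) (e : R), 0 <= e ->
    {homo c : i j / (i <= j)%N >-> i <= j} ->
    (forall i, c i - c 0%N <= L) ->
    (forall i j, (i <= j)%N -> `|x j - x i| <= H * (c j - c i) `^ g) ->
    (forall i j, (i <= j)%N -> c j - c i <= h0 ->
       `|y j - y i| <= M * (c j - c i) `^ g) ->
    (forall i j, (i <= j)%N -> c j - c i <= h0 ->
       `|y' j - y' i| <= M * (c j - c i) `^ g) ->
    (forall i, `|(y' i.+1 - y i.+1) - (y' i - y i)
                 - (phi (y' i) (x i.+1 - x i) - phi (y i) (x i.+1 - x i))|
               <= e * (c i.+1 - c i)) ->
    forall k, `|y' k - y k| <= Q * (`|y' 0%N - y 0%N| + e).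
Proof.
move=> /andP[b0 b1] /andP[g2 g1] th1 h00 H0 M0 L0.
set th := (1 + b) * g in th1 *.
have C0 := ltW (sew_const_gt0 th1); set C := sew_const th in C0.
have KH0 : 0 <= K * H by rewrite mulr_ge0.
pose B := (2 * M) `^ b; have B0 : 0 <= B by exact: powR_ge0.
pose A := K * H * (1 + K * H + B).
have A0 : 0 <= A by rewrite /A mulr_ge0 //; lra.
(* Q0 h^(b g) <= 1/2 is what lets the maximum of |D| over a window be absorbed *)
pose Q0 := C * (2 * A) + 1 + K * H.
have Q00 : 0 <= Q0.
  have : 0 <= C * (2 * A) by rewrite mulr_ge0 //; lra.
  rewrite /Q0; lra.
have g0 : 0 < g by lra.
have bg0 : 0 < b * g by rewrite mulr_gt0.
have bgg : b * g <= g by rewrite ler_piMl // ltW.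
have thE w : w `^ th = w `^ g * w `^ (b * g).
  by rewrite /th mulrDl mul1r powR_add.
have [ha [ha0 ha1 hah]] := powR_small (mulr_ge0 KH0 C0) g0.
have [hb [hb0 hb1 hbh]] := powR_small Q00 bg0.
pose h := Num.min h0 (Num.min ha hb).
have hh0 : h <= h0 by rewrite /h ge_min lexx.
have hha : h <= ha by rewrite /h !ge_min lexx orbT.
have hhb : h <= hb by rewrite /h !ge_min lexx !orbT.
have hgt0 : 0 < h by rewrite /h !lt_min h00 ha0 hb0.
have h1 : h <= 1 by lra.
have hA : K * H * C * h `^ g <= 2^-1.
  apply: le_trans hah; apply: ler_wpM2l; first exact: mulr_ge0.
  by apply: powR_le; lra.
have hB : Q0 * h `^ (b * g) <= 2^-1.
  apply: le_trans hbh; apply: ler_wpM2l => //.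
  by apply: powR_le; lra.
pose Q1 := 2 + K * H * L `^ g + L.
have Q11 : 1 <= Q1.
  have : 0 <= K * H * L `^ g by rewrite mulr_ge0 ?powR_ge0.
  rewrite /Q1; lra.
have [Q Qge0 HQ] := block_growth L hgt0 Q11.
exists Q => // y y' x c e e0 cm cL hx hy hy' step k.
pose D i := y' i - y i.
pose S i j := D j - D i - (phi (y' i) (x j - x i) - phi (y i) (x j - x i)).
suff : `|D k| + e <= Q * (`|D 0%N| + e) by have := e0; rewrite /D; lra.
apply: (HQ c (fun i => `|D i| + e)) => //.
- by move=> i; rewrite addr_ge0.
- move=> i n ii cin.
  have [ms msin mmax] := window_max (fun j => `|D j|) ii.
  pose m := `|D ms|; have m0 : 0 <= m by exact: normr_ge0.
  have Dm j : (i <= j)%N -> (j <= n)%N -> `|D j| <= m by move=> *; apply: mmax; slia.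
  pose K3 := 2 * A * (m + e).
  have K30 : 0 <= K3 by apply: mulr_ge0 (mulr_ge0 _ A0) (addr_ge0 m0 e0).
  (* the estimate that sewing hands over a posteriori turned into one for D *)
  have incr j1 j2 : (i <= j1)%N -> (j1 <= j2)%N -> (j2 <= n)%N ->
    `|S j1 j2| <= C * K3 * (c j2 - c j1) `^ th + e * (c j2 - c j1) ->
    `|D j2 - D j1| <= (C * K3 * h `^ g + e + K * H * m) * (c j2 - c j1) `^ (b * g).
    move=> ij1 j12 j2n hS.
    have a1 := cm _ _ ij1; have a2 := cm _ _ j12; have a3 := cm _ _ j2n.
    set w := c j2 - c j1 in hS *.
    have w01 : 0 <= w <= 1 by rewrite /w; move: a1 a2 a3 cin h1; clr; lra.
    have wh : w <= h by rewrite /w; move: a1 a2 a3 cin; clr; lra.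
    have d1 : `|D j2 - D j1| <= `|S j1 j2| +
       `|phi (y' j1) (x j2 - x j1) - phi (y j1) (x j2 - x j1)|.
      by rewrite -{1}(subrK (phi (y' j1) (x j2 - x j1) - phi (y j1) (x j2 - x j1))
         (D j2 - D j1)) ler_normD.
    have d2 := c1_lip Hphi (y j1) (y' j1) (x j2 - x j1).
    have p0 := powR_ge0 w (b * g).
    have p1 : w `^ th <= h `^ g * w `^ (b * g).
      rewrite thE; apply: ler_wpM2r => //.
      by apply: powR_le => //; [exact: ltW | case/andP: w01].
    have p2 : w <= w `^ (b * g).
      by rewrite -{1}(powRr1 (proj1 (andP w01))); apply: powR_anti => //; exact: le_trans bgg g1.
    have p3 : w `^ g <= w `^ (b * g) by apply: powR_anti.
    have d3 := hx _ _ j12; rewrite -/w in d3.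
    have d4 : `|x j2 - x j1| <= H * w `^ (b * g).
      by apply: le_trans d3 _; apply: ler_wpM2l.
    have d5 : K * `|y' j1 - y j1| * `|x j2 - x j1| <= K * m * (H * w `^ (b * g)).
      apply: ler_pM => //; rewrite ?mulr_ge0 //; apply: ler_wpM2l => //.
      by apply: Dm => //; slia.
    have d6 := ler_wpM2l (mulr_ge0 C0 K30) p1.
    have d7 := ler_wpM2l e0 p2.
    move: d1 d2 d5 d6 d7 hS; set N1 := `|phi _ _ - _|; set N2 := `|S _ _|.
    set N3 := `|D _ - _|; set N4 := K * _ * _; clr; lra.
  have main j : (i <= j)%N -> (j <= n)%N ->
     `|S i j| <= C * K3 * (c j - c i) `^ th + e * (c j - c i).
    move=> ij jn.
    apply: (@sewing R V S c i n th K3 e th1 K30 e0 cm) => //.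
    - by move=> l; rewrite /S !subrr !c1_zero !subr0.
    - by move=> l _; exact: step.
    move=> j1 j2 j3 ij1 j12 j23 j3n IH.
    have -> : S j1 j3 - S j1 j2 - S j2 j3 =
      (phi (y' j2) (x j3 - x j2) - phi (y j2) (x j3 - x j2)) -
      (phi (y' j1) (x j3 - x j2) - phi (y j1) (x j3 - x j2)).
      by rewrite /S !c1_sub; zmod.
    have a1 := cm _ _ ij1; have a2 := cm _ _ j12; have a3 := cm _ _ j23.
    have a4 := cm _ _ j3n.
    have d1 := incr _ _ ij1 j12 (leq_trans j23 j3n) IH.
    have d2 := c1_four Hphi (y j2) (y' j2) (y j1) (y' j1) (x j3 - x j2).
    apply: (le_trans d2).
    have c12 : c j2 - c j1 <= h0 by move: a1 a2 a3 a4 cin hh0; clr; lra.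
    have c120 : 0 <= c j2 - c j1 by rewrite subr_ge0.
    have c230 : 0 <= c j3 - c j2 by rewrite subr_ge0.
    have e1 := hy _ _ j12 c12; have e2 := hy' _ _ j12 c12.
    set w := c j3 - c j1; have w0 : 0 <= w by rewrite /w; move: a2 a3; clr; lra.
    have c12w : c j2 - c j1 <= w by rewrite lerD2r.
    have c23w : c j3 - c j2 <= w by rewrite lerD2l lerN2.
    have p1 : (c j2 - c j1) `^ (b * g) <= w `^ (b * g).
      by apply: powR_le => //; exact: ltW.
    have p2 : (c j3 - c j2) `^ g <= w `^ g by apply: powR_le => //; exact: ltW.
    have p3 : (c j2 - c j1) `^ g <= w `^ g by apply: powR_le => //; exact: ltW.
    have d3 : `|x j3 - x j2| <= H * w `^ g.
      by apply: le_trans (hx _ _ j23) _; apply: ler_wpM2l.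
    have d4 : (`|y j2 - y j1| + `|y' j2 - y' j1|) `^ b <= B * w `^ (b * g).
      rewrite /B [b * g]mulrC powRrM -powRM ?powR_ge0 ?mulr_ge0 //.
      apply: powR_le; [exact: ltW|by rewrite addr_ge0|].
      have := ler_wpM2l M0 p3; move: e1 e2; clr; lra.
    have d5 : (`|y j2 - y j1| + `|y' j2 - y' j1|) `^ b * `|y' j1 - y j1|
       <= B * w `^ (b * g) * m.
      apply: ler_pM => //; rewrite ?powR_ge0 //.
      by apply: Dm => //; slia.
    set X := C * K3 * h `^ g + e + K * H * m in d1.
    have X0 : 0 <= X.
      rewrite /X; have := mulr_ge0 (mulr_ge0 C0 K30) (powR_ge0 h g).
      have := mulr_ge0 KH0 m0; move: e0; clr; lra.
    have d6 : `|(y' j2 - y j2) - (y' j1 - y j1)| <= X * w `^ (b * g).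
      by apply: (le_trans d1); apply: ler_wpM2l.
    have d7 : K * (`|(y' j2 - y j2) - (y' j1 - y j1)| +
       (`|y j2 - y j1| + `|y' j2 - y' j1|) `^ b * `|y' j1 - y j1|)
       <= K * ((X + B * m) * w `^ (b * g)).
      apply: ler_wpM2l => //; move: d5 d6; clr; lra.
    have d8 : K * ((X + B * m) * w `^ (b * g)) * (H * w `^ g) =
       K * H * (X + B * m) * w `^ th.
      by rewrite thE; ring.
    have d9 : K * H * (X + B * m) <= K3.
      have : K * H * C * h `^ g * K3 <= 2^-1 * K3 by apply: ler_wpM2r.
      have : K * H * (e + K * H * m + B * m) <= A * (m + e).
        rewrite /A -[leRHS]mulrA; apply: ler_wpM2l => //.
        have := mulr_ge0 KH0 m0; have := mulr_ge0 B0 m0.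
        have := mulr_ge0 KH0 e0; have := mulr_ge0 B0 e0.
        move: m0 e0; clr; lra.
      rewrite /X /K3; clr; lra.
    apply: le_trans (ler_pM _ _ d7 d3) _ => //.
      by rewrite mulr_ge0 // addr_ge0 // mulr_ge0 // powR_ge0.
    by rewrite d8; apply: ler_wpM2r => //; exact: powR_ge0.
  have dev j : (i <= j)%N -> (j <= n)%N -> `|D j| <= `|D i| + 2^-1 * (m + e).
    move=> ij jn.
    have d1 := incr _ _ (leqnn i) ij jn (main _ ij jn).
    have a1 := cm _ _ ij; have a2 := cm _ _ jn.
    have p1 : (c j - c i) `^ (b * g) <= h `^ (b * g).
      by apply: powR_le; move: a1 a2 cin bg0; clr; lra.
    have hg1 : h `^ g <= 1 by apply: powR_le1; move: g0 hgt0 h1; clr; lra.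
    have X1 : C * K3 * h `^ g + e + K * H * m <= Q0 * (m + e).
      have := ler_wpM2l (mulr_ge0 C0 K30) hg1.
      have := mulr_ge0 KH0 e0; rewrite /Q0 /K3; move: m0; clr; lra.
    have d2 : `|D j - D i| <= Q0 * (m + e) * h `^ (b * g).
      apply: (le_trans d1); apply: ler_pM => //; rewrite ?powR_ge0 //.
      rewrite !addr_ge0 // mulr_ge0 // ?powR_ge0 //; exact: mulr_ge0.
    have me : 0 <= m + e by rewrite addr_ge0.
    have := ler_wpM2r me hB.
    have : `|D j| <= `|D j - D i| + `|D i| by rewrite -{1}(subrK (D i) (D j)) ler_normD.
    move: d2; clr; lra.
  have := dev ms _ _; rewrite -/m => dms.
  have {}dms : m <= `|D i| + 2^-1 * (m + e) by apply: dms; slia.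
  have Dn : `|D n| <= m by apply: Dm.
  have := mulr_ge0 (mulr_ge0 KH0 (powR_ge0 L g)) (normr_ge0 (D i)).
  have := mulr_ge0 (mulr_ge0 KH0 (powR_ge0 L g)) e0.
  have := mulr_ge0 L0 (normr_ge0 (D i)); have := mulr_ge0 L0 e0.
  move: dms Dn m0 e0; rewrite /Q1; clr; lra.
- move=> i.
  have st := step i.
  have a0 := cm _ _ (leq0n i); have a1 := cm _ _ (leqnSn i); have a2 := cL i.+1.
  have w1 : c i.+1 - c i <= L by move: a0 a2; clr; lra.
  have d1 : `|D i.+1| <= `|S i i.+1| + (`|D i| +
     `|phi (y' i) (x i.+1 - x i) - phi (y i) (x i.+1 - x i)|).
    have -> : D i.+1 = S i i.+1 + (D i + (phi (y' i) (x i.+1 - x i) - phi (y i) (x i.+1 - x i))).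
      by rewrite /S; zmod.
    by apply: le_trans (ler_normD _ _) _; rewrite lerD2l ler_normD.
  have d2 := c1_lip Hphi (y i) (y' i) (x i.+1 - x i).
  have d3 : `|x i.+1 - x i| <= H * L `^ g.
    apply: le_trans (hx _ _ (leqnSn i)) _; apply: ler_wpM2l => //.
    by apply: powR_le => //; [exact: ltW|rewrite subr_ge0].
  have d4 : K * `|D i| * `|x i.+1 - x i| <= K * `|D i| * (H * L `^ g).
    by apply: ler_wpM2l => //; rewrite mulr_ge0.
  have d5 := ler_wpM2l e0 w1.
  have d6 := mulr_ge0 (mulr_ge0 KH0 (powR_ge0 L g)) e0.
  have d7 := mulr_ge0 L0 (normr_ge0 (D i)).
  have d8 := normr_ge0 (D i).
  rewrite /Q1; move: d1 d2 d4 d5 d6 d7 d8 st; rewrite -/(D i.+1) -/(D i) -/(S i i.+1).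
  move: e0; clear.
  set n1 := `|phi _ _ - _|; set n2 := `|D i|; set n3 := `|S _ _|; set n4 := `|D _|.
  set n5 := K * n2 * _; lra.
Qed.

End Scheme.

(** * Lip(alpha) vector fields *)

Section Norms.
Variable R : realType.

Lemma mxnorm_le m n (A : 'M[R]_(m, n)) (c : R) : 0 <= c ->
  (forall i j, `|A i j| <= c) -> `|A| <= c.
Proof.
move=> c0 h; rewrite [leLHS]/Num.Def.normr/= mx_normrE.
by apply/bigmax_leP; split => // -[i j] _; exact: h.
Qed.

Lemma entry_le m n (A : 'M[R]_(m, n)) i j : `|A i j| <= `|A|.
Proof.
rewrite [leRHS]/Num.Def.normr/= mx_normrE.
exact: (le_bigmax _ (fun ij : 'I_m * 'I_n => `|A ij.1 ij.2|) (i, j)).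
Qed.

Lemma mulmx_norm k m n (A : 'M[R]_(k, m)) (B : 'M[R]_(m, n)) :
  `|A *m B| <= m%:R * `|A| * `|B|.
Proof.
apply: mxnorm_le => [|i j]; first by rewrite !mulr_ge0.
rewrite mxE; apply: le_trans (ler_norm_sum _ _ _) _.
apply: (@le_trans _ _ (\sum_(l < m) `|A| * `|B|)).
  by apply: ler_sum => l _; rewrite normrM ler_pM // entry_le.
by rewrite sumr_const card_ord -[leLHS]mulr_natl mulrA.
Qed.

Lemma enorm_ge0 m n (A : 'M[R]_(m, n)) : 0 <= enorm A.
Proof. exact: sqrtr_ge0. Qed.

Lemma norm_le_enorm m n (A : 'M[R]_(m, n)) : `|A| <= enorm A.
Proof.
apply: mxnorm_le => [|i j]; first exact: enorm_ge0.
rewrite -sqrtr_sqr ler_wsqrtr // (bigD1 i) //= (bigD1 j) //=.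
rewrite -addrA lerDl addr_ge0 //; apply: sumr_ge0 => *; first exact: sqr_ge0.
by apply: sumr_ge0 => *; exact: sqr_ge0.
Qed.

Lemma enorm_le_norm m n (A : 'M[R]_(m, n)) : enorm A <= (m * n).+1%:R * `|A|.
Proof.
rewrite -[leRHS]ger0_norm ?mulr_ge0 // -sqrtr_sqr ler_wsqrtr //.
apply: (@le_trans _ _ (\sum_(i < m) \sum_(j < n) `|A| ^+ 2)).
  apply: ler_sum => i _; apply: ler_sum => j _.
  by rewrite -real_normK ?num_real // ler_sqr ?nnegrE // entry_le.
under eq_bigr do rewrite sumr_const card_ord.
rewrite sumr_const card_ord -mulrnA exprMn -[leLHS]mulr_natl ler_wpM2r ?sqr_ge0 //.
rewrite -natrX ler_nat mulnC; apply: leq_trans (leqnSn _) _.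
by rewrite -[leqLHS]expn1 leq_pexp2l.
Qed.

Lemma enorm_eq0 m n (A : 'M[R]_(m, n)) : (enorm A == 0) = (A == 0).
Proof.
apply/idP/idP => /eqP h.
  by rewrite -normr_eq0 eq_le normr_ge0 andbT -h norm_le_enorm.
rewrite h /enorm big1 ?sqrtr0 // => i _; rewrite big1 // => j _.
by rewrite mxE expr0n.
Qed.

Lemma enorm_gt0 m n (A : 'M[R]_(m, n)) : (0 < enorm A) = (A != 0).
Proof. by rewrite lt_neqAle enorm_ge0 andbT eq_sym enorm_eq0. Qed.

End Norms.

Section LipBounds.
Variable R : realType.

Lemma sup_norm_ubound d k l (f : 'cV[R]_d -> 'M[R]_(k, l)) :
  (sup_norm f < +oo)%E -> exists2 B : R, 0 <= B & forall u, `|f u| <= B.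
Proof.
move=> fin.
have ub u : ((enorm (f u))%:E <= sup_norm f)%E.
  by apply: ereal_sup_ubound; exists u.
have sr : sup_norm f \is a fin_num.
  rewrite fin_numElt fin andbT; apply: lt_le_trans (ub 0); exact: ltNyr.
exists (fine (sup_norm f)).
  rewrite -lee_fin fineK //; apply: le_trans (ub 0); rewrite lee_fin.
  exact: enorm_ge0.
move=> u; apply: (le_trans (norm_le_enorm _)).
by rewrite -lee_fin fineK.
Qed.

Lemma holder_ubound d k l (a : R) (f : 'cV[R]_d -> 'M[R]_(k, l)) : 0 <= a ->
  (sup_norm f + holder_seminorm a f < +oo)%E ->
  (exists2 B : R, 0 <= B & forall u, `|f u| <= B) /\
  (exists2 H : R, 0 <= H & forall u v, `|f u - f v| <= H * `|u - v| `^ a).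
Proof.
move=> a0 fin.
(* on a one-point space the seminorm is a supremum over the empty set, that is
   -oo, and the sum of the norms carries no information *)
have [ [u [v uv]] | all_eq] := pselect (exists u v : 'cV[R]_d, u != v); last first.
  have e (u : 'cV[R]_d) : u = 0 by apply/eqP; apply: contrapT => /negP u0; apply: all_eq; exists u, 0.
  split; first by exists `|f 0| => // u; rewrite (e u).
  by exists 0 => // u v; rewrite (e u) (e v) subrr normr0 mul0r.
have ubs w : ((enorm (f w))%:E <= sup_norm f)%E.
  by apply: ereal_sup_ubound; exists w.
have ubh w1 w2 : w1 != w2 ->
  ((enorm (f w1 - f w2) / enorm (w1 - w2) `^ a)%:E <= holder_seminorm a f)%E.
  by move=> w12; apply: ereal_sup_ubound; exists (w1, w2).
have sN : (sup_norm f != -oo)%E.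
  by apply/eqP => E; have := ubs 0; rewrite E leeNy_eq.
have hN : (holder_seminorm a f != -oo)%E.
  by apply/eqP => E; have := ubh _ _ uv; rewrite E leeNy_eq.
have sP : (sup_norm f < +oo)%E.
  by rewrite ltey; apply/eqP => E; move: fin; rewrite E addye // ltxx.
have hP : (holder_seminorm a f < +oo)%E.
  by rewrite ltey; apply/eqP => E; move: fin; rewrite E addey // ltxx.
split; first exact: sup_norm_ubound.
have hf : holder_seminorm a f \is a fin_num by rewrite fin_numE hN -ltey.
set H := fine (holder_seminorm a f).
have Hb w1 w2 : w1 != w2 -> enorm (f w1 - f w2) / enorm (w1 - w2) `^ a <= H.
  by move=> /ubh; rewrite -[X in (_ <= X)%E]fineK // lee_fin.
have H0 : 0 <= H.
  by apply: le_trans (Hb _ _ uv); rewrite divr_ge0 ?powR_ge0 ?enorm_ge0.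
exists (H * (d * 1).+1%:R `^ a); first by rewrite mulr_ge0 ?powR_ge0.
move=> w1 w2; have [->|w12] := eqVneq w1 w2.
  by rewrite subrr normr0 !mulr_ge0 ?powR_ge0.
apply: (le_trans (norm_le_enorm _)).
have := Hb _ _ w12; rewrite ler_pdivrMr ?powR_gt0 ?enorm_gt0 ?subr_eq0 //.
move/le_trans; apply; rewrite -mulrA ler_wpM2l // -powRM //.
by apply: powR_le => //; [exact: enorm_ge0|exact: enorm_le_norm].
Qed.

Lemma is_derive_line d (G : 'cV[R]_d -> R) (w e : 'cV[R]_d) (t s : R) :
  (forall u, derivable G u e) ->
  is_derive s (1 : R) (fun s : R => G (w + (s * t) *: e)) (t * 'D_e G (w + (s * t) *: e)).
Proof.
move=> dG.
have h1 (r : R) : is_derive r (1 : R) (fun s : R => G (w + s *: e)) ('D_e G (w + r *: e)).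
  have E : (fun h : R => h^-1 *: (((fun s : R => G (w + s *: e)) \o shift r) (h *: 1)
      - G (w + r *: e))) =
      (fun h => h^-1 *: ((G \o shift (w + r *: e)) (h *: e) - G (w + r *: e))).
    apply/funext => h /=; congr (_ *: (G _ - _)).
    by rewrite -[h *: 1]/(h * 1) mulr1 scalerDl; zmod.
  have := dG (w + r *: e); rewrite /derivable -E => c.
  by apply: DeriveDef => //; rewrite /derive E.
have h2 : is_derive s (1 : R) (fun s : R => s * t) t.
  have -> : (fun s : R => s * t) = t \*: (@id R).
    by apply/funext => z /=; rewrite mulrC.
  by have := is_deriveZ t (is_derive_id s (1 : R)); rewrite -[t *: 1]/(t * 1) mulr1.
rewrite mulrC.
exact: (@is_derive1_comp R (fun s : R => G (w + s *: e)) (fun s : R => s * t) s _ _ (h1 _) h2).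
Qed.

(** Mean value theorem for s |-> G (w + s t e) - G (w' + s t' e) on [0, 1]. *)
Lemma four_point_entry d (G : 'cV[R]_d -> R) (e w w' : 'cV[R]_d) (t t' B mu : R) :
  (forall u, derivable G u e) -> (forall u, `|'D_e G u| <= B) ->
  (forall s, 0 <= s <= 1 ->
     `|'D_e G (w + (s * t) *: e) - 'D_e G (w' + (s * t') *: e)| <= mu) ->
  `|G (w + t *: e) - G w - (G (w' + t' *: e) - G w')| <= B * `|t - t'| + mu * `|t'|.
Proof.
move=> dG DB Dmu.
pose h s := G (w + (s * t) *: e) - G (w' + (s * t') *: e).
pose h' s := t * 'D_e G (w + (s * t) *: e) - t' * 'D_e G (w' + (s * t') *: e).
have dh (s : R) : is_derive s (1 : R) h (h' s).
  exact: (is_deriveB (is_derive_line w t s dG) (is_derive_line w' t' s dG)).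
have [s /andP[s0 s1] hs] : exists2 s, s \in `]0, 1[%R & h 1 - h 0 = h' s * (1 - 0).
  apply: MVT => // s; apply: derivable_within_continuous => z _.
  exact: ex_derive.
have -> : G (w + t *: e) - G w - (G (w' + t' *: e) - G w') = h 1 - h 0.
  by rewrite /h !mul1r !mul0r !scale0r !addr0; zmod.
have s01 : 0 <= s <= 1.
  by move: s0 s1; rewrite !bnd_simp => s0 s1; rewrite !ltW.
rewrite hs subr0 mulr1 /h'; set D1 := 'D_e G _; set D2 := 'D_e G (w' + _).
have -> : t * D1 - t' * D2 = D1 * (t - t') + (D1 - D2) * t' by ring.
apply: le_trans (ler_normD _ _) _; rewrite !normrM.
by apply: lerD; apply: ler_wpM2r => //; [exact: DB|exact: Dmu].
Qed.

(** Turns the vector b into the vector a, coordinate by coordinate, so that only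
    partial derivatives enter. *)
Definition hybrid d (k : nat) (a b : 'cV[R]_d) : 'cV[R]_d :=
  \col_i (if (i < k)%N then a i 0 else b i 0).

Lemma hybridS d (k : 'I_d) (a b : 'cV[R]_d) :
  hybrid k.+1 a b = hybrid k a b + (a k 0 - b k 0) *: delta_mx k 0.
Proof.
apply/colP => i; rewrite !mxE ltnS leq_eqVlt eqxx andbT.
have [->|ik] := eqVneq i k; first by rewrite eqxx ltnn /= mulr1 addrC subrK.
rewrite -val_eqE /= in ik; rewrite (negbTE ik) /= mulr0 addr0 //.
Qed.

(** Telescope over the coordinates.  The hybrids of (a, b) and those of (c, e) stay
    within |b - e| + |a - c| of each other, so one modulus of continuity of the
    partial derivatives serves for all the coordinates. *)
Lemma four_point d k l (g : 'cV[R]_d -> 'M[R]_(k, l)) (a b c e : 'cV[R]_d) (B mu : R) :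
  0 <= mu -> 0 <= B ->
  (forall j u, derivable g u (delta_mx j 0)) ->
  (forall j u, `|'D_(delta_mx j 0) g u| <= B) ->
  (forall j u v, `|u - v| <= `|b - e| + `|a - c| ->
     `|'D_(delta_mx j 0) g u - 'D_(delta_mx j 0) g v| <= mu) ->
  `|(g a - g b) - (g c - g e)| <= d%:R * (B * `|(a - b) - (c - e)| + mu * `|c - e|).
Proof.
move=> mu0 B0 dg DB Dmu.
have hyb0 u v : hybrid 0 u v = v :> 'cV[R]_d by apply/colP => i; rewrite mxE ltn0.
have hybd u v : hybrid d u v = u :> 'cV[R]_d by apply/colP => i; rewrite mxE ltn_ord.
pose D j := (g (hybrid j a b)) - (g (hybrid j c e)).
have -> : (g a - g b) - (g c - g e) = \sum_(0 <= j < d) (D j.+1 - D j).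
  by rewrite telescope_sumr // /D !hyb0 !hybd; zmod.
rewrite big_mkord; apply: le_trans (ler_norm_sum _ _ _) _.
rewrite -[d in d%:R]card_ord mulr_natl -sumr_const; apply: ler_sum => j _.
apply: mxnorm_le => [|i1 i2]; first by rewrite addr_ge0 // mulr_ge0.
set dj : 'cV[R]_d := delta_mx j 0.
pose G (u : 'cV[R]_d) : R := g u i1 i2.
have dG u : derivable G u dj by have /derivable_mxP := dg j u; apply.
have DGE u : 'D_dj G u = ('D_dj g u) i1 i2.
  by rewrite (derive_mx (dg j u)) mxE.
have -> : (D j.+1 - D j) i1 i2 =
  G (hybrid j a b + (a j 0 - b j 0) *: dj) - G (hybrid j a b) -
  (G (hybrid j c e + (c j 0 - e j 0) *: dj) - G (hybrid j c e)).
  have swap (p q r s : R) : (p - q) - (r - s) = (p - r) - (q - s) by zmod.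
  by rewrite /G /D /dj -!hybridS !mxE; exact: swap.
have DBG u : `|'D_dj G u| <= B by rewrite DGE; exact: le_trans (entry_le _ _ _) (DB _ _).
apply: (@le_trans _ _ (B * `|(a j 0 - b j 0) - (c j 0 - e j 0)|
                       + mu * `|c j 0 - e j 0|)).
  apply: four_point_entry => //.
  move=> s /andP[s0 s1]; rewrite !DGE.
  have := Dmu j (hybrid j a b + (s * (a j 0 - b j 0)) *: dj)
                (hybrid j c e + (s * (c j 0 - e j 0)) *: dj).
  move=> H; apply: le_trans (H _).
    by have := entry_le ('D_dj g (hybrid j a b + (s * (a j 0 - b j 0)) *: dj) -
      'D_dj g (hybrid j c e + (s * (c j 0 - e j 0)) *: dj)) i1 i2; rewrite !mxE.
  apply: mxnorm_le => [|i i']; first exact: addr_ge0.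
  rewrite (ord1 i') !mxE eqxx andbT.
  have e1 := entry_le (b - e) i 0; have e2 := entry_le (a - c) i 0.
  rewrite !mxE in e1 e2.
  have := normr_ge0 (b - e); have := normr_ge0 (a - c) => n1 n2.
  have [ij|ij] := eqVneq i j; last first.
    rewrite !mulr0 !addr0; case: ifP => _; lra.
  rewrite ij ltnn !mulr1 in e1 e2 *.
  have -> : b j 0 + s * (a j 0 - b j 0) - (e j 0 + s * (c j 0 - e j 0)) =
    (1 - s) * (b j 0 - e j 0) + s * (a j 0 - c j 0) by ring.
  apply: le_trans (ler_normD _ _) _; rewrite !normrM (ger0_norm s0).
  rewrite ger0_norm ?subr_ge0 // lerD //; nra.
have e1 := entry_le (a - b - (c - e)) j 0; have e2 := entry_le (c - e) j 0.
by rewrite !mxE in e1 e2; rewrite lerD // ler_wpM2l.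
Qed.

End LipBounds.

Section LipField.
Variable R : realType.

Lemma Lip_bounded d k l (al : R) (g : 'cV[R]_d -> 'M[R]_(k, l)) :
  Lip al g -> exists2 B : R, 0 <= B & forall u, `|g u| <= B.
Proof.
case=> [{}al {}g /andP[al0 _] h | {}al {}g _ h _ _].
  by case: (holder_ubound (ltW al0) h).
exact: sup_norm_ubound.
Qed.

Lemma bounds_family (I : finType) (T : Type) (P : I -> R -> Prop) :
  (forall i (B B' : R), B <= B' -> P i B -> P i B') ->
  (forall i, exists2 B : R, 0 <= B & P i B) ->
  exists2 B : R, 0 <= B & forall i, P i B.
Proof.
move=> mono h.
have /choice [B HB] : forall i, exists B : R, 0 <= B /\ P i B.
  by move=> i; have [B B0 PB] := h i; exists B.
exists (\sum_i B i); first by apply: sumr_ge0 => i _; case: (HB i).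
move=> i; case: (HB i) => B0 PB; apply: mono PB.
by rewrite (bigD1 i) //= lerDl; apply: sumr_ge0 => j _; case: (HB j).
Qed.

Lemma Lip_holder d k l (al : R) (g : 'cV[R]_d -> 'M[R]_(k, l)) : Lip al g ->
  exists2 H : R, 0 <= H & forall u v, `|g u - g v| <= H * `|u - v| `^ Num.min al 1.
Proof.
case=> [{}al {}g /andP[al0 al1] h | {}al {}g al1 h dg Lg].
  rewrite min_l //; by case: (holder_ubound (ltW al0) h).
rewrite min_r ?ltW //.
have [B B0 DB] : exists2 B : R, 0 <= B & forall j, forall u : 'cV[R]_d,
    `|'D_(delta_mx j 0) g u| <= B.
  apply: (@bounds_family _ R (fun j B => forall u : 'cV[R]_d,
    `|'D_(delta_mx j 0) g u| <= B)).
    by move=> j B B' BB' hB u; exact: le_trans (hB u) BB'.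
  by move=> j; exact: (Lip_bounded (Lg j)).
exists (d%:R * B); first exact: mulr_ge0.
move=> u v; rewrite powRr1 //.
have := @four_point R d k l g u v 0 0 B (B + B) (addr_ge0 B0 B0) B0 dg DB.
rewrite !subr0 subrr normr0 subr0 mulr0 addr0 mulrA; apply.
move=> j u' v' _; apply: le_trans (ler_normB _ _) _; exact: lerD.
Qed.

(** As alpha > p >= 1, the partial derivatives of f are Lip(alpha - 1), hence
    Hoelder with exponent b = min (alpha - 1) 1; b > p - 1 as alpha > p and p < 2. *)
Lemma Lip_field d m (p al : R) (f : 'cV[R]_d -> 'M[R]_(d, m)) :
  1 <= p < 2 -> p < al -> Lip al f ->
  exists K b : R, [/\ 0 < b, b <= 1, p - 1 < b &
    c1beta (fun y x => f y *m x : 'cV[R]_d) K b].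
Proof.
move=> /andP[p1 p2] pal Lf.
have [Bf Bf0 fB] := Lip_bounded Lf.
have [H1 H10 fH] := Lip_holder Lf.
have {}fH u v : `|f u - f v| <= H1 * `|u - v|.
  by have := fH u v; rewrite min_r ?powRr1 //; lra.
case: Lf pal fB fH => [{}al {}f /andP[_ al1] _ pal|{}al {}f al1 _ df Lf pal fB fH].
  by exfalso; lra.
have [B B0 DB] : exists2 B : R, 0 <= B & forall j, forall u : 'cV[R]_d,
    `|'D_(delta_mx j 0) f u| <= B.
  apply: (@bounds_family _ R (fun j B => forall u : 'cV[R]_d,
    `|'D_(delta_mx j 0) f u| <= B)).
    by move=> j B B' BB' hB u; exact: le_trans (hB u) BB'.
  by move=> j; exact: (Lip_bounded (Lf j)).
pose b := Num.min (al - 1) 1.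
have [H H0 DH] : exists2 H : R, 0 <= H & forall j, forall u v : 'cV[R]_d,
    `|'D_(delta_mx j 0) f u - 'D_(delta_mx j 0) f v| <= H * `|u - v| `^ b.
  apply: (@bounds_family _ R (fun j H => forall u v : 'cV[R]_d,
    `|'D_(delta_mx j 0) f u - 'D_(delta_mx j 0) f v| <= H * `|u - v| `^ b)).
    by move=> j B1 B1' BB' hB u v; apply: le_trans (hB u v) _; rewrite ler_wpM2r ?powR_ge0.
  by move=> j; exact: (Lip_holder (Lf j)).
have b0 : 0 < b by rewrite lt_min; lra.
pose K := m%:R * (Bf + H1 + d%:R * (B + H)).
have K0 : 0 <= K by rewrite !mulr_ge0 // !addr_ge0 // mulr_ge0 // addr_ge0.
have dB0 : 0 <= d%:R * B by exact: mulr_ge0.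
have dH0 : 0 <= d%:R * H by exact: mulr_ge0.
exists K, b; split => //.
- by rewrite ge_min lexx orbT.
- by rewrite lt_min; lra.
have Kb c : 0 <= c -> c <= Bf + H1 + d%:R * (B + H) ->
    forall n r, 0 <= n -> 0 <= r -> forall (A : 'M[R]_(d, m)) (x : 'cV[R]_m),
    `|A| <= c * n -> `|x| = r -> `|A *m x| <= K * n * r.
  move=> c0 cK n r n0 r0 A x An <-; apply: le_trans (mulmx_norm _ _) _.
  rewrite ler_wpM2r // /K -!mulrA ler_wpM2l //; apply: le_trans An _.
  by rewrite ler_wpM2r.
split => //.
- by move=> y x x'; rewrite mulmxDr.
- move=> y x; have := Kb Bf Bf0 _ 1 `|x| ler01 (normr_ge0 _) (f y) x.
  by rewrite !mulr1; apply => //; lra.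
- move=> y y' x; rewrite -mulmxBl.
  apply: (Kb H1 H10 _ _ _ _ _ _ _ (fH _ _)) => //; lra.
- move=> y y' z z' x; rewrite -!mulmxBl.
  have c0 : 0 <= d%:R * (B + H) by rewrite mulr_ge0 // addr_ge0.
  have cK : d%:R * (B + H) <= Bf + H1 + d%:R * (B + H) by lra.
  set n := (X in K * X * _).
  have n0 : 0 <= n by rewrite /n addr_ge0 // mulr_ge0 // powR_ge0.
  apply: (Kb _ c0 cK n `|x| n0 (normr_ge0 _)) => //; rewrite /n.
  set rho := (`|y - z| + `|y' - z'|).
  have mu0 : 0 <= H * rho `^ b by rewrite mulr_ge0 // powR_ge0.
  have := four_point (a := y') (b := y) (c := z') (e := z) mu0 B0 df DB.
  have Dmu j (u v : 'cV[R]_d) : `|u - v| <= `|y - z| + `|y' - z'| ->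
    `|'D_(delta_mx j 0) f u - 'D_(delta_mx j 0) f v| <= H * rho `^ b.
    move=> uv; apply: le_trans (DH _ _ _) _; rewrite ler_wpM2l //.
    by apply: powR_le => //; exact: ltW.
  move/(_ Dmu)/le_trans; apply.
  rewrite -[leRHS]mulrA ler_wpM2l //.
  set n1 := `| _ - (z' - z) |; set n2 := rho `^ b; set n3 := `|z' - z|.
  have n10 : 0 <= n1 by exact: normr_ge0.
  have n23 : 0 <= n2 * n3 by rewrite mulr_ge0 // ?powR_ge0 // normr_ge0.
  have := mulr_ge0 H0 n10; have := mulr_ge0 B0 n23; lra.
Qed.

End LipField.

(** * Partitions and Riemann sums *)

Section PartitionSums.
Variables (R : realType) (V : zmodType).
Implicit Types (G : R -> R -> V) (a b : R) (l : seq R).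

(** Partition sums by recursion on the list of points, for inductions on the
    partition. *)
Fixpoint psum G a l : V := if l is u :: l' then G a u + psum G u l' else 0.

Lemma psumE G b a l :
  \sum_(0 <= i < size l) G (nth b (a :: l) i) (nth b (a :: l) i.+1) = psum G a l.
Proof.
elim: l a => [|u l IH] a; first by rewrite big_nil.
by rewrite [size _]/= big_nat_recl //= -IH.
Qed.

Lemma psum_cat G a l l' : psum G a (l ++ l') = psum G a l + psum G (last a l) l'.
Proof. by elim: l a => [|u l IH] a /=; rewrite ?add0r // IH addrA. Qed.

End PartitionSums.

Section Partitions.
Variable R : realType.
Implicit Types (a b : R) (l : seq R).

Lemma fine_partition (eta a b : R) : 0 < eta -> a <= b ->
  exists l, itv_partition a b l /\ path (fun u v => v - u < eta) a l.
Proof.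
move=> e0; have e20 : 0 < eta / 2 by lra.
have [n hn] : exists n : nat, b - a <= n%:R * (eta / 2).
  exists (Num.truncn ((b - a) / (eta / 2))).+1; rewrite -ler_pdivrMr //.
  exact: ltW (truncnS_gt _).
elim: n a hn => [|n IH] a hn ab.
  exists [::]; split => //; split => //=.
  by rewrite eq_le ab -subr_le0 (le_trans hn) // mul0r.
have [small|big] := ltP (b - a) eta.
  move: ab; rewrite le_eqVlt => /orP[/eqP ->|ab]; first by exists [::].
  by exists [:: b]; split; [exact: itv_partition1|rewrite /= small].
have [||l [[pl lb] ml]] := IH (a + eta / 2).
- by move: hn; rewrite -natr1 mulrDl mul1r; lra.
- lra.
exists (a + eta / 2 :: l); split; last by rewrite /= ml andbT; lra.
by split => //=; rewrite pl andbT; lra.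
Qed.

Lemma path_ge_start (t : R) l : path <%R t l -> t <= last t l.
Proof.
elim: l t => //= u l IH t /andP[tu pl].
exact: le_trans (ltW tu) (IH _ pl).
Qed.

Lemma nth_last_nd a l i j : path <=%R a l -> (i <= j)%N ->
  nth (last a l) (a :: l) i <= nth (last a l) (a :: l) j.
Proof.
move=> srt ij; have key i' j' : (i' <= j')%N -> (j' < size (a :: l))%N ->
    nth (last a l) (a :: l) i' <= nth (last a l) (a :: l) j'.
  move=> ij' jl; apply: (sorted_leq_nth le_trans le_refl _ (srt : sorted _ (a :: l))) => //.
  by rewrite inE (leq_ltn_trans ij').
have [jl|lj] := ltnP j (size (a :: l)); first exact: key.
rewrite [leRHS]nth_default //.
have [il|li] := ltnP i (size (a :: l)); last by rewrite nth_default.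
have e : nth (last a l) (a :: l) (size l) = last a l by exact: (nth_last _ (a :: l)).
by rewrite -[leRHS]e; exact: key.
Qed.

Lemma partition_nd a b l i j : itv_partition a b l -> (i <= j)%N ->
  nth b (a :: l) i <= nth b (a :: l) j.
Proof.
move=> [pl /eqP <-]; apply: nth_last_nd; by apply: sub_path pl => u v /ltW.
Qed.

Lemma partition_in a b l i : itv_partition a b l -> a <= nth b (a :: l) i <= b.
Proof.
move=> hl; apply/andP; split; first exact: (partition_nd hl (leq0n i)).
have [il|li] := ltnP i (size (a :: l)); first exact: itv_partition_nth_le.
by rewrite nth_default.
Qed.

End Partitions.

Section YoungLocal.
Variables (R : realType) (V W : normedModType R).
Variables (phi : V -> W -> V) (K b g H H' : R).
Hypotheses (Hphi : c1beta phi K b) (g12 : 2^-1 < g) (H0 : 0 <= H) (H'0 : 0 <= H').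

(** Young's estimate: sewing for the Riemann sums with tags at the left end points,
    whose second differences are phi (y u_j) dx - phi (y u_i) dx. *)
Lemma young_local (y : R -> V) (X : R -> W) (c : R -> R) (s t : R) l :
  (forall r r', s <= r -> r <= r' -> r' <= t -> c r <= c r') ->
  (forall r r', s <= r -> r <= r' -> r' <= t -> `|X r' - X r| <= H * (c r' - c r) `^ g) ->
  (forall r r', s <= r -> r <= r' -> r' <= t -> `|y r' - y r| <= H' * (c r' - c r) `^ g) ->
  itv_partition s t l ->
  `|psum (fun u v => phi (y u) (X v - X u)) s l - phi (y s) (X t - X s)| <=
    sew_const (2 * g) * (K * H' * H) * (c t - c s) `^ (2 * g).
Proof.
move=> cm hX hy hl; have K0 := c1_ge0 Hphi.
have g0 : 0 < g by apply: lt_trans g12; rewrite invr_gt0.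
have th1 : 1 < 2 * g by have := g12; lra.
set u := nth t (s :: l).
have uin i : s <= u i <= t by exact: partition_in.
have und i j : (i <= j)%N -> u i <= u j by move=> ij; exact: partition_nd.
pose A i j := \sum_(i <= k < j) phi (y (u k)) (X (u k.+1) - X (u k)).
pose S i j := A i j - phi (y (u i)) (X (u j) - X (u i)).
have uN : u (size l) = t by exact: itv_partition_nth_size hl.
have -> : psum (fun u v => phi (y u) (X v - X u)) s l - phi (y s) (X t - X s) = S 0%N (size l).
  by rewrite /S uN -(psumE _ t).
have C : {homo (c \o u) : i j / (i <= j)%N >-> i <= j}.
  move=> i j ij /=; have /andP[a1 _] := uin i; have /andP[_ a2] := uin j.
  by apply: cm => //; exact: und.
have KHH : 0 <= K * H' * H by rewrite !mulr_ge0.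
have -> : c t = (c \o u) (size l) by rewrite /= uN.
have -> : c s = (c \o u) 0%N by [].
rewrite -[leRHS]addr0 -(mul0r ((c \o u) (size l) - (c \o u) 0%N)).
apply: (@sewing R V S (c \o u) 0 (size l) (2 * g) (K * H' * H) 0 th1 KHH (lexx 0) C) => //.
- by move=> i; rewrite /S /A big_geq // (c1_sub Hphi) !subrr.
- by move=> i _; rewrite /S /A big_nat1 subrr normr0 mul0r.
move=> i j k _ ij jk _ _.
have -> : S i k - S i j - S j k =
   phi (y (u j)) (X (u k) - X (u j)) - phi (y (u i)) (X (u k) - X (u j)).
  have AE : A i k = A i j + A j k by rewrite /A; apply: big_cat_nat.
  rewrite /S AE !(c1_sub Hphi); zmod.
have /andP[a1 _] := uin i; have /andP[b1 b2] := uin j; have /andP[_ a2] := uin k.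
apply: le_trans (c1_lip Hphi _ _ _) _.
have e1 := hy _ _ a1 (und _ _ ij) b2; have e2 := hX _ _ b1 (und _ _ jk) a2.
have m1 : (c (u j) - c (u i)) `^ g <= (c (u k) - c (u i)) `^ g.
  apply: powR_le; [exact: ltW|rewrite subr_ge0; exact: C|rewrite lerD2r; exact: C].
have m2 : (c (u k) - c (u j)) `^ g <= (c (u k) - c (u i)) `^ g.
  apply: powR_le; [exact: ltW|rewrite subr_ge0; exact: C|].
  by rewrite lerD2l lerN2; exact: C.
have f1 := le_trans e1 (ler_wpM2l H'0 m1).
have f2 := le_trans e2 (ler_wpM2l H0 m2).
rewrite powR_double //; have := ler_pM (normr_ge0 _) (normr_ge0 _) f1 f2.
move/(ler_wpM2l K0); rewrite /=; set z := _ `^ g; lra.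
Qed.

End YoungLocal.

(** * Davie solutions: existence *)

Lemma ultra_lim (R : realType) (T : Type) (U : set_system T) (f : T -> R) (B : R) :
  UltraFilter U -> U [set l | `|f l| <= B] ->
  exists q : R, forall e : R, 0 < e -> U [set l | `|f l - q| < e].
Proof.
move=> UU fB; have PU : ProperFilter U by exact: ultra_proper.
have [q [_ clq]] : `[- B, B]%classic `&` cluster (f @ U) !=set0.
  apply: (@segment_compact R (- B) B (f @ U) _).
  apply: filterS fB => l h; rewrite /= in_itv /= -ler_norml; exact: h.
exists q => e e0.
have [//|nU] := in_ultra_setVsetC [set l | `|f l - q| < e] UU.
have [|z [/= hz qz]] := clq [set z | e <= `|z - q|] (ball q e) _ (nbhsx_ballx q e e0).
  by apply: filterS nU => l h; rewrite /= leNgt; apply/negP; exact: h.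
by move: qz; rewrite /ball /= distrC ltNge hz.
Qed.

Definition is_gap (R : realType) (A : set R) (r r' : R) := forall q, A q -> ~~ (r < q < r').

Section EulerScheme.
Variables (R : realType) (d : nat) (W : normedModType R).
Variables (phi : 'cV[R]_d -> W -> 'cV[R]_d) (K b g H : R).
Hypotheses (Hphi : c1beta phi K b) (g12 : 2^-1 < g <= 1) (H0 : 0 <= H).

(** Davie's notion of a solution of dY = phi(Y) dX, for the times in A only. *)
Definition davie_on (h M : R) (X : R -> W) (A : set R) (Y : R -> 'cV[R]_d) :=
  forall r r', A r -> A r' -> r <= r' -> r' - r <= h ->
  `|Y r' - Y r - phi (Y r) (X r' - X r)| <= M * (r' - r) `^ (2 * g).

(** Across a gap of A longer than h the estimate of [davie_on] is void, and across a
    shorter one it gives the Euler step only approximately; here the step is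
    imposed, as the forward jump rule requires. *)
Definition exact_gaps (X : R -> W) (A : set R) (Y : R -> 'cV[R]_d) :=
  forall r r', A r -> A r' -> r < r' -> is_gap A r r' ->
  Y r' = Y r + phi (Y r) (X r' - X r).

Fixpoint euler_seq (X : R -> W) (u : nat -> R) (y0 : 'cV[R]_d) (k : nat) : 'cV[R]_d :=
  if k is k'.+1 then let y := euler_seq X u y0 k' in y + phi y (X (u k) - X (u k'))
  else y0.

Let points (r0 : R) (l : seq R) := sort <=%R (undup (r0 :: l)).
(* The default value is the last point, so that the knots are nondecreasing on the
   whole of nat. *)
Let knot (r0 : R) l k := nth (last r0 (points r0 l)) (points r0 l) k.
Let euler X r0 y0 l r := euler_seq X (knot r0 l) y0 (index r (points r0 l)).

Let K0 : 0 <= K := c1_ge0 Hphi.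
Let g0 : 0 < g. Proof. by case/andP: g12 => h _; apply: lt_trans h; rewrite invr_gt0. Qed.

Let mem_points r0 l r : (r \in points r0 l) = (r \in r0 :: l).
Proof. by rewrite /points mem_sort mem_undup. Qed.

Let points_neq0 r0 l : points r0 l != [::].
Proof. by apply/eqP => e; have := mem_points r0 l r0; rewrite e mem_head. Qed.

Let knot_mem r0 l k : knot r0 l k \in r0 :: l.
Proof.
rewrite -mem_points /knot; have [lt|ge] := ltnP k (size (points r0 l)).
  exact: mem_nth.
rewrite nth_default //; move: (points_neq0 r0 l); case: (points r0 l) => //= z s _.
exact: mem_last.
Qed.

Let knot_nd r0 l : {homo knot r0 l : i j / (i <= j)%N >-> i <= j}.
Proof.
move=> i j; rewrite /knot; have : sorted <=%R (points r0 l) by exact: sort_le_sorted.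
by case: (points r0 l) (points_neq0 r0 l) => // z s _; exact: nth_last_nd.
Qed.

Let knot_index r0 l r : r \in r0 :: l -> knot r0 l (index r (points r0 l)) = r.
Proof. by rewrite -mem_points => h; rewrite /knot nth_index. Qed.

Let index_le r0 l r r' : r \in r0 :: l -> r' \in r0 :: l -> r <= r' ->
  (index r (points r0 l) <= index r' (points r0 l))%N.
Proof.
move=> hr hr' rr'; rewrite leqNgt; apply/negP => lt.
have := knot_nd r0 l (ltnW lt); rewrite !knot_index // => r'r.
have e : r = r' by apply/eqP; rewrite eq_le rr'.
by move: lt; rewrite e ltnn.
Qed.

(** The Euler scheme along a finite subset l of A satisfies Davie's estimate with
    constants that do not depend on l ([euler_apriori]) and is bounded uniformly in l.
    An ultrafilter finer than the direction of the finite subsets gives limits at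
    all the points of A simultaneously, and Davie's estimate passes to the limit.
    Two end points of a gap of A are neighbours in every l that contains them, so
    the step between them is exact before the limit and after it. *)
Lemma davie_exists : exists h M : R, [/\ 0 < h, h <= 1, 0 <= M &
  forall (X : R -> W) (A : set R) (r0 L : R) (y0 : 'cV[R]_d),
    A r0 -> (forall r, A r -> r0 <= r <= L) ->
    (forall r r', A r -> A r' -> r <= r' -> `|X r' - X r| <= H * (r' - r) `^ g) ->
    exists Y : R -> 'cV[R]_d, [/\ Y r0 = y0, davie_on h M X A Y & exact_gaps X A Y]].
Proof.
have [h [M [h0 h1 M0 apr]]] := euler_apriori Hphi (proj1 (andP g12)) H0.
exists h, M; split => // X A r0 L y0 Ar0 AL hX.
have r0L : r0 <= L by case/andP: (AL _ Ar0).
have inA l : {in l, forall r, A r} -> forall k, A (knot r0 l k).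
  by move=> lA k; have := knot_mem r0 l k; rewrite inE => /orP[/eqP ->//|/lA].
have Xknot l : {in l, forall r, A r} -> forall i j, (i <= j)%N ->
    `|X (knot r0 l j) - X (knot r0 l i)| <= H * (knot r0 l j - knot r0 l i) `^ g.
  by move=> lA i j ij; apply: hX; [exact: inA|exact: inA|exact: knot_nd].
pose y l := euler_seq X (knot r0 l) y0.
have est l : {in l, forall r, A r} -> forall i k, (i <= k)%N ->
    knot r0 l k - knot r0 l i <= h ->
    `|y l k - y l i - phi (y l i) (X (knot r0 l k) - X (knot r0 l i))| <=
     M * (knot r0 l k - knot r0 l i) `^ (2 * g).
  move=> lA; exact: (apr (y l) (X \o knot r0 l) (knot r0 l) (@knot_nd r0 l)
    (Xknot l lA) (fun i => erefl)).
(* A window of length h moves the scheme by at most K H + M; a single step may be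
   long, but the Hoelder bound on X limits it too. *)
have KH0 : 0 <= K * H by rewrite mulr_ge0.
pose Q := 1 + K * H + M + K * H * (L - r0) `^ g.
have KHL0 : 0 <= K * H * (L - r0) `^ g by rewrite mulr_ge0 // powR_ge0.
have Q1 : 1 <= Q by rewrite /Q; lra.
have [Q' Q'0 grow] := block_growth (L - r0) h0 Q1.
have ybnd l : {in l, forall r, A r} -> forall k, `|y l k| <= Q' * (`|y0| + 1).
  move=> lA k.
  suff : `|y l k| + 1 <= Q' * (`|y l 0%N| + 1) by rewrite /=; lra.
  apply: (grow (knot r0 l) (fun k => `|y l k| + 1)) => //.
  - move=> i n ii kin; have nd := knot_nd r0 l ii.
    have w01 : 0 <= knot r0 l n - knot r0 l i <= 1 by lra.
    have dh := davie_holder Hphi g0 w01 M0 (Xknot l lA _ _ ii) (est l lA _ _ ii kin).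
    have p1 := powR_le1 (ltW g0) w01.
    have c1 : 0 <= K * H + M by rewrite addr_ge0.
    have := ler_wpM2l c1 p1.
    have : `|y l n| <= `|y l n - y l i| + `|y l i|.
      by rewrite -{1}(subrK (y l i) (y l n)) ler_normD.
    have := mulr_ge0 KH0 (normr_ge0 (y l i)); have := mulr_ge0 M0 (normr_ge0 (y l i)).
    have := mulr_ge0 KHL0 (normr_ge0 (y l i)); rewrite /Q; lra.
  - move=> i; have nd := knot_nd r0 l (leqnSn i).
    have /andP[a1 a2] := AL _ (inA l lA i); have /andP[a3 a4] := AL _ (inA l lA i.+1).
    have s1 : `|y l i.+1| <= `|y l i| + `|phi (y l i) (X (knot r0 l i.+1) - X (knot r0 l i))|.
      exact: ler_normD.
    have s2 := c1_bnd Hphi (y l i) (X (knot r0 l i.+1) - X (knot r0 l i)).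
    have s3 : `|X (knot r0 l i.+1) - X (knot r0 l i)| <= H * (L - r0) `^ g.
      apply: le_trans (Xknot l lA _ _ (leqnSn i)) _; apply: ler_wpM2l => //.
      by apply: powR_le; [exact: ltW|rewrite subr_ge0|move: a1 a4; clr; lra].
    have := ler_wpM2l K0 s3.
    have := mulr_ge0 KH0 (normr_ge0 (y l i)); have := mulr_ge0 M0 (normr_ge0 (y l i)).
    have := mulr_ge0 KHL0 (normr_ge0 (y l i)); rewrite /Q; lra.
  - have /andP[a1 a2] := AL _ (inA l lA k); have /andP[a3 a4] := AL _ (inA l lA 0%N); lra.
(* the sections of the directed set of the finite subsets of A *)
pose refine (l0 : seq R) := [set l : seq R | {in l, forall r, A r} /\ {subset l0 <= l}].
pose G : set_system (seq R) := [set P | exists2 l0, {in l0, forall r, A r} & refine l0 `<=` P].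
have GP : ProperFilter G.
  apply: Build_ProperFilter_ex => [P [l0 l0A h']|].
    by exists l0; apply: h'; split.
  split => [|P P' [l lA hl] [l' lA' hl']|P P' PP' [l lA hl]].
  - by exists [::].
  - exists (l ++ l'); first by move=> r; rewrite mem_cat => /orP[/lA|/lA'].
    move=> s [sA sub]; split; [apply: hl|apply: hl']; split => // r hr;
      by apply: sub; rewrite mem_cat hr ?orbT.
  - by exists l => //; exact: subset_trans PP'.
have [U [UU GU]] := ultraFilterLemma GP.
have PU : ProperFilter U by exact: ultra_proper.
have Uref l0 : {in l0, forall r, A r} -> U (refine l0) by move=> hl0; apply: GU; exists l0.
have limE r i : exists q : R, forall e, 0 < e -> U [set l | `|euler X r0 y0 l r i 0 - q| < e].
  apply: (@ultra_lim _ _ _ _ (Q' * (`|y0| + 1)) UU).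
  apply: filterS (Uref [::] _) => // l [lA _] /=.
  apply: le_trans (ybnd l lA (index r (points r0 l))).
  exact: entry_le.
have /choice [Y HY] : forall r, exists q : 'cV[R]_d, forall e, 0 < e ->
    U [set l | `|euler X r0 y0 l r - q| < e].
  move=> r; have /choice [q hq] := limE r.
  exists (\col_i q i) => e e0; have e20 : 0 < e / 2 by lra.
  have : U [set l | forall i, `|euler X r0 y0 l r i 0 - q i| < e / 2].
    by apply: filter_forall => i; exact: hq.
  apply: filterS => l /= hl; apply: (@le_lt_trans _ _ (e / 2)); last lra.
  apply: mxnorm_le => [|i j]; first exact: ltW.
  by rewrite (ord1 j) !mxE; exact: ltW.
have passage r r' c : A r -> A r' ->
   U [set l | `|euler X r0 y0 l r' - euler X r0 y0 l r
                - phi (euler X r0 y0 l r) (X r' - X r)| <= c] ->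
   `|Y r' - Y r - phi (Y r) (X r' - X r)| <= c.
  move=> Ar Ar' Uc; apply/ler_addgt0Pr => e e0.
  set N := `|X r' - X r|; have N0 : 0 <= N by exact: normr_ge0.
  have KN : 0 <= K * N by rewrite mulr_ge0.
  pose e1 := e / (2 + K * N); have e10 : 0 < e1 by rewrite divr_gt0 //; lra.
  have e1E : e1 * (2 + K * N) = e by rewrite /e1 divfK // gt_eqF //; lra.
  have [l [[lc lr] lr']] := filter_ex (filterI (filterI Uc (HY r e1 e10)) (HY r' e1 e10)).
  move: lc lr lr' => /=; set a := euler _ _ _ _ r; set a' := euler _ _ _ _ r' => lc lr lr'.
  have := c1_lip Hphi a (Y r) (X r' - X r); rewrite -/N => lip.
  have -> : Y r' - Y r - phi (Y r) (X r' - X r) =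
     (a' - a - phi a (X r' - X r)) - (a' - Y r') + (a - Y r)
     - (phi (Y r) (X r' - X r) - phi a (X r' - X r)) by zmod.
  rewrite [`|Y r - a|]distrC in lip.
  set t1 := a' - a - _ in lc *; set t2 := a' - Y r' in lr' *; set t3 := a - Y r in lr lip *.
  set t4 := phi (Y r) _ - _ in lip *.
  have tri : `|t1 - t2 + t3 - t4| <= `|t1| + `|t2| + `|t3| + `|t4|.
    apply: le_trans (ler_normB _ _) _; rewrite lerD2r.
    by apply: le_trans (ler_normD _ _) _; rewrite lerD2r ler_normB.
  apply: (le_trans tri).
  have := ler_wpM2l KN (ltW lr).
  by move: lc lr lr' lip e1E; clr; lra.
have refine2 r r' : A r -> A r' -> U (refine [:: r; r']).
  by move=> Ar Ar'; apply: Uref => z; rewrite !inE => /orP[]/eqP ->.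
exists Y; split.
- apply/eqP; rewrite -subr_eq0 -normr_le0; apply/ler_addgt0Pr => e e0.
  have nilA : {in [::], forall r : R, A r} by move=> r; rewrite in_nil.
  have [l [[lA _] /= hl]] := filter_ex (filterI (Uref [::] nilA) (HY r0 e e0)).
  rewrite add0r distrC; apply: le_trans (ltW hl).
  have -> : euler X r0 y0 l r0 = y0 => //.
  suff e0' : index r0 (points r0 l) = 0%N by rewrite /euler e0'.
  have z0 : knot r0 l 0 = r0.
    have /andP[ge _] := AL _ (inA l lA 0%N).
    apply/eqP; rewrite eq_le ge andbT.
    by rewrite -{2}(@knot_index r0 l r0 (mem_head _ _)) knot_nd.
  move: z0 (points_neq0 r0 l); rewrite /knot; case: (points r0 l) => //= z s -> _.
  by rewrite eqxx.
- move=> r r' Ar Ar' rr' rh; apply: passage => //.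
  apply: filterS (refine2 r r' Ar Ar') => l [lA sub] /=.
  have mr : r \in r0 :: l by rewrite inE sub ?orbT // mem_head.
  have mr' : r' \in r0 :: l by rewrite inE sub ?orbT // !inE eqxx orbT.
  have := est l lA _ _ (index_le mr mr' rr').
  by rewrite !knot_index //; apply.
- move=> r r' Ar Ar' rr' gap; apply/eqP; rewrite -subr_eq0 opprD addrA -normr_le0.
  apply: passage => //.
  apply: filterS (refine2 r r' Ar Ar') => l [lA sub] /=.
  have mr : r \in r0 :: l by rewrite inE sub ?orbT // mem_head.
  have mr' : r' \in r0 :: l by rewrite inE sub ?orbT // !inE eqxx orbT.
  have srt : sorted <%R (points r0 l) by rewrite sort_lt_sorted undup_uniq.
  have si' : (index r' (points r0 l) < size (points r0 l))%N by rewrite index_mem mem_points.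
  have ii' := index_le mr mr' (ltW rr').
  set i := index r (points r0 l) in ii' *; set i' := index r' _ in ii' si' *.
  have ki : knot r0 l i = r by exact: knot_index.
  have ki' : knot r0 l i' = r' by exact: knot_index.
  have lt : (i < i')%N.
    rewrite ltn_neqAle ii' andbT; apply: contraTneq rr' => e.
    by rewrite -ki -ki' e ltxx.
  have inc j j' : (j < j')%N -> (j' < size (points r0 l))%N -> knot r0 l j < knot r0 l j'.
    move=> jj' j's; apply: (sorted_ltn_nth lt_trans _ srt) => //; rewrite inE //.
    exact: ltn_trans j's.
  have iE : i' = i.+1.
    apply/eqP; rewrite eqn_leq lt andbT leqNgt; apply/negP => lt'.
    have := gap _ (inA l lA i.+1); rewrite -ki -ki' inc ?inc //.
    exact: ltn_trans si'.
  rewrite /euler -/i -/i' iE -ki -ki' iE /=.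
  rewrite -/(knot r0 l i) -/(knot r0 l i.+1).
  set z := euler_seq _ _ _ i.
  by rewrite [z + _]addrC addrK subrr normr0.
Qed.

End EulerScheme.

(** * Davie solutions: uniqueness *)

Section Chains.
Variable R : realType.

(** A closed set A may have gaps, so it does not contain arbitrarily fine
    partitions of [r, r']; a chain is the next best thing.  It is constant from some
    index on. *)
Definition chain (A : set R) (eps r r' : R) (u : nat -> R) :=
  [/\ u 0%N = r, exists N, u N = r', {homo u : i j / (i <= j)%N >-> i <= j},
      forall k, A (u k) /\ u k <= r' &
      forall k, u k.+1 - u k <= eps \/ (u k < u k.+1 /\ is_gap A (u k) (u k.+1))].

Lemma chain_cons A eps r v r' u : A r -> r <= v -> chain A eps v r' u ->
  v - r <= eps \/ (r < v /\ is_gap A r v) ->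
  chain A eps r r' (fun k => if k is k'.+1 then u k' else r).
Proof.
move=> Ar rv [u0 [N uN] nd uA st] s0; split => //.
- by exists N.+1.
- move=> [|i] [|j] //= ij; last exact: nd.
  by apply: (le_trans rv); rewrite -u0; apply: nd.
- move=> [|k]; last exact: uA.
  by split => //; apply: le_trans rv _; rewrite -u0; case: (uA 0%N).
- by move=> [|k]; [rewrite u0|exact: st].
Qed.

Lemma closed_sup_mem (B : set R) : closed B -> has_sup B -> B (sup B).
Proof.
move=> cB [B0 ubB]; have := closure_sup B0 ubB.
by rewrite -((closure_id B).1 cB).
Qed.

Lemma closed_inf_mem (B : set R) : closed B -> has_inf B -> B (inf B).
Proof.
move=> cB hB; have cN : closed (-%R @^-1` B).
  by apply: preimage_closed => // z _; exact: opp_continuous.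
have -> : inf B = - sup (-%R @` B) by [].
have e : -%R @` B = -%R @^-1` B.
  apply/seteqP; split => z /=; first by move=> [q Bq <-]; rewrite opprK.
  by move=> h; exists (- z); rewrite ?opprK.
rewrite e; apply: (closed_sup_mem cN); rewrite -e.
by apply/has_inf_supN.
Qed.

(** From r proceed to the last point a of A before r + eps, and from there to the
    first point b of A after r + eps.  The first step is short, the second jumps
    over a gap, and b >= r + eps, so finitely many rounds lead to r1. *)
Lemma chain_exists (A : set R) (eps r0 r1 : R) : closed A -> 0 < eps ->
  A r0 -> A r1 -> r0 <= r1 -> exists u, chain A eps r0 r1 u.
Proof.
move=> cA e0 A0 A1 r01.
have [n hn] : exists n : nat, r1 - r0 <= n%:R * eps.
  exists (Num.truncn ((r1 - r0) / eps)).+1; rewrite -ler_pdivrMr //.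
  exact: ltW (truncnS_gt _).
elim: n r0 A0 r01 hn => [|n IH] r A0 r01 hn.
  have -> : r = r1 by apply/eqP; rewrite eq_le r01 -subr_le0 (le_trans hn) // mul0r.
  exists (fun=> r1); split => //; first by exists 0%N.
  by move=> k; left; rewrite subrr ltW.
have [small|big] := leP (r1 - r) eps.
  have c1 : chain A eps r1 r1 (fun=> r1).
    split; [by []|by exists 0%N|by []|by []|].
    by move=> k; left; rewrite subrr ltW.
  by eexists; apply: (chain_cons A0 r01 c1); left.
pose c := r + eps.
have cr1 : c <= r1 by rewrite /c; lra.
pose B1 := A `&` `[r, c]; pose B2 := A `&` `[c, r1].
have cB1 : closed B1 by apply: closedI => //; exact: interval_closed.
have cB2 : closed B2 by apply: closedI => //; exact: interval_closed.
have B1r : B1 r by split => //; rewrite /= in_itv /= lexx /c; lra.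
have B2r : B2 r1 by split => //; rewrite /= in_itv /= lexx cr1.
have h1 : has_sup B1.
  by split; [exists r|exists c => z [_]; rewrite /= in_itv /= => /andP[]].
have h2 : has_inf B2.
  by split; [exists r1|exists c => z [_]; rewrite /= in_itv /= => /andP[]].
have [Aa] := closed_sup_mem cB1 h1; rewrite /= in_itv /= => /andP[ra ac].
have [Ab] := closed_inf_mem cB2 h2; rewrite /= in_itv /= => /andP[cb br].
set a := sup B1 in Aa ra ac; set b := inf B2 in Ab cb br.
have [u cu] : exists u, chain A eps b r1 u.
  by apply: IH => //; move: hn; rewrite -natr1 mulrDl mul1r /c in cb *; lra.
have gap : is_gap A a b.
  move=> q Aq; apply/negP => /andP[aq qb].
  have [qc|cq] := leP q c.
    have : q <= a; last by rewrite leNgt aq.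
    apply: ub_le_sup; first by case: h1.
    by split => //=; rewrite in_itv /= qc (le_trans ra (ltW aq)).
  have : b <= q; last by rewrite leNgt qb.
  apply: ge_inf; first by case: h2.
  by split => //=; rewrite in_itv /= (ltW cq) (le_trans (ltW qb) br).
have ab : a <= b by exact: le_trans ac cb.
have c1 : exists u, chain A eps a r1 u.
  eexists; apply: (chain_cons Aa ab cu).
  by move: ab; rewrite le_eqVlt => /orP[/eqP ->|ab]; [left; rewrite subrr ltW|right].
case: c1 => u' cu'; eexists; apply: (chain_cons A0 ra cu').
by left; move: ac; rewrite /c; lra.
Qed.

End Chains.

Section Compare.
Variables (R : realType) (d : nat) (W : normedModType R).
Variables (phi : 'cV[R]_d -> W -> 'cV[R]_d) (K b g H h M : R).
Hypotheses (Hphi : c1beta phi K b) (g12 : 2^-1 < g <= 1) (H0 : 0 <= H)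
  (b01 : 0 < b <= 1) (bg : 1 < (1 + b) * g) (h01 : 0 < h <= 1) (M0 : 0 <= M).

Let g0 : 0 < g. Proof. by case/andP: g12 => h' _; apply: lt_trans h'; rewrite invr_gt0. Qed.
Let K0 : 0 <= K := c1_ge0 Hphi.

Lemma davie_incr (X : R -> W) (A : set R) (Y : R -> 'cV[R]_d) r r' :
  davie_on phi g h M X A Y -> A r -> A r' -> r <= r' -> r' - r <= h ->
  `|X r' - X r| <= H * (r' - r) `^ g ->
  `|Y r' - Y r| <= (K * H + M) * (r' - r) `^ g.
Proof.
move=> hY Ar Ar' rr' rh hX; apply: (davie_holder Hphi g0 _ M0 hX (hY _ _ Ar Ar' rr' rh)).
by case/andP: h01 => _ h1; rewrite subr_ge0 rr' (le_trans rh).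
Qed.

(** On a short step the two solutions are Euler steps up to 2 M w^(2 g), which is
    at most 2 M eps^(2 g - 1) w; on a long step they are Euler steps.  So
    [stability] applies with e = 2 M eps^(2 g - 1). *)
Lemma davie_compare (L : R) : 0 <= L -> exists2 Q : R, 0 <= Q &
  forall (X : R -> W) (A : set R) (Y Y' : R -> 'cV[R]_d) (u : nat -> R) (eps : R),
  (forall r r', A r -> A r' -> r <= r' -> `|X r' - X r| <= H * (r' - r) `^ g) ->
  davie_on phi g h M X A Y -> davie_on phi g h M X A Y' -> 0 < eps -> eps <= h ->
  {homo u : i j / (i <= j)%N >-> i <= j} -> (forall k, A (u k)) ->
  (forall k, u k - u 0%N <= L) ->
  (forall k, u k.+1 - u k <= eps \/
    (Y (u k.+1) = Y (u k) + phi (Y (u k)) (X (u k.+1) - X (u k)) /\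
     Y' (u k.+1) = Y' (u k) + phi (Y' (u k)) (X (u k.+1) - X (u k)))) ->
  Y (u 0%N) = Y' (u 0%N) ->
  forall k, `|Y' (u k) - Y (u k)| <= Q * eps `^ (2 * g - 1).
Proof.
move=> L0; case/andP: (h01) => h0 h1.
have KHM : 0 <= K * H + M by rewrite addr_ge0 // mulr_ge0.
have g20 : 0 < 2 * g - 1 by case/andP: g12 => ? _; lra.
have [Q Q0 stab] := stability Hphi b01 g12 bg h0 H0 KHM L0.
exists (Q * (2 * M)); first by rewrite !mulr_ge0.
move=> X A Y Y' u eps hX hY hY' e0 eh nd uA uL st eq0 k.
have E0 : 0 <= 2 * M * eps `^ (2 * g - 1) by rewrite !mulr_ge0 // powR_ge0.
have := stab (Y \o u) (Y' \o u) (X \o u) u (2 * M * eps `^ (2 * g - 1)) E0 nd uL.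
rewrite /= eq0 subrr normr0 add0r mulrA; apply => //.
- by move=> i j ij; apply: hX => //; exact: nd.
- move=> i j ij hij; apply: (davie_incr hY) => //; first exact: nd.
  by apply: hX => //; exact: nd.
- move=> i j ij hij; apply: (davie_incr hY') => //; first exact: nd.
  by apply: hX => //; exact: nd.
move=> i; have ndi := nd _ _ (leqnSn i).
have -> : Y' (u i.+1) - Y (u i.+1) - (Y' (u i) - Y (u i)) -
    (phi (Y' (u i)) (X (u i.+1) - X (u i)) - phi (Y (u i)) (X (u i.+1) - X (u i))) =
   (Y' (u i.+1) - Y' (u i) - phi (Y' (u i)) (X (u i.+1) - X (u i))) -
   (Y (u i.+1) - Y (u i) - phi (Y (u i)) (X (u i.+1) - X (u i))) by zmod.
have w0 : 0 <= u i.+1 - u i by rewrite subr_ge0.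
case: (st i) => [short|[-> ->]]; last first.
  have z (v w : 'cV[R]_d) : v + w - v - w = 0 by zmod.
  by rewrite !z subr0 normr0 mulr_ge0.
have s1 := hY _ _ (uA i) (uA i.+1) ndi (le_trans short eh).
have s2 := hY' _ _ (uA i) (uA i.+1) ndi (le_trans short eh).
apply: le_trans (ler_normB _ _) _.
have g21 : 1 < 2 * g by rewrite -subr_gt0.
have e2 := powR_superlinear g21 w0 short.
have := ler_wpM2l M0 e2; lra.
Qed.

Lemma davie_unique (X : R -> W) (A : set R) (Y Y' : R -> 'cV[R]_d) (r0 r1 : R) :
  closed A -> A r0 -> A r1 -> r0 <= r1 ->
  (forall r r', A r -> A r' -> r <= r' -> `|X r' - X r| <= H * (r' - r) `^ g) ->
  davie_on phi g h M X A Y -> davie_on phi g h M X A Y' ->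
  exact_gaps phi X A Y -> exact_gaps phi X A Y' -> Y r0 = Y' r0 -> Y r1 = Y' r1.
Proof.
move=> cA A0 A1 r01 hX hY hY' gY gY' e0.
have g20 : 0 < 2 * g - 1 by case/andP: g12 => ? _; lra.
have L0 : 0 <= r1 - r0 by rewrite subr_ge0.
have [Q Q0 cmp] := davie_compare L0.
apply/eqP; rewrite -subr_eq0 -normr_le0; apply/ler_addgt0Pr => e epos.
rewrite add0r distrC; have [eps /andP[eps0 epsh] small] := powR_lt_small h01 Q0 g20 epos.
have [u [u0 [N uN] nd uA st]] := chain_exists cA eps0 A0 A1 r01.
apply: le_trans (ltW small); rewrite -uN.
apply: (cmp X A Y Y' u eps hX hY hY' eps0 epsh nd) => //.
- by move=> k; case: (uA k).
- by move=> k; rewrite u0 lerD2r; case: (uA k).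
- move=> k; case: (st k) => [?|[lt gap]]; first by left.
  by right; split; [apply: gY|apply: gY'] => //; case: (uA k); case: (uA k.+1).
- by rewrite u0.
Qed.

End Compare.

(** * The p-variation as a control *)

Section PowContinuity.
Variables (R : realType) (p : R).
Hypothesis p12 : 1 <= p <= 2.

(** Instead of the mean value theorem: for p <= 2 one has
    y x^(p-1) <= x y^(p-1), hence x^p - y^p <= (x^(p-1) + y^(p-1)) (x - y). *)
Lemma powR_lip (x y M : R) : 0 <= y -> y <= x -> x <= M ->
  x `^ p - y `^ p <= 2 * M `^ (p - 1) * (x - y).
Proof.
case/andP: p12 => p1 p2 y0 yx xM.
have x0 : 0 <= x by exact: le_trans yx.
have pp : 0 < p by lra.
have q0 : 0 <= p - 1 by lra.
have xq := powR_le q0 x0 xM.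
have yq := le_trans (powR_le q0 y0 yx) xq.
have main : y * x `^ (p - 1) <= y `^ (p - 1) * x.
  move: y0; rewrite le_eqVlt => /orP[/eqP <-|ygt0].
    by rewrite mul0r mulr_ge0 ?powR_ge0.
  have xgt0 : 0 < x by exact: lt_le_trans yx.
  have yE : y = y `^ (p - 1) * y `^ (2 - p).
    rewrite -powRD; last by apply/implyP => _; rewrite gt_eqF.
    have e1 : p - 1 + (2 - p) = 1 by ring.
    by rewrite e1 powRr1 // ltW.
  have xE : x = x `^ (2 - p) * x `^ (p - 1).
    rewrite -powRD; last by apply/implyP => _; rewrite gt_eqF.
    have e1 : 2 - p + (p - 1) = 1 by ring.
    by rewrite e1 powRr1 // ltW.
  rewrite {1}yE {2}xE -mulrA; apply: ler_wpM2l; first exact: powR_ge0.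
  apply: ler_wpM2r; first exact: powR_ge0.
  by apply: powR_le => //; [lra|exact: ltW].
have xy : 0 <= x - y by lra.
have h1 := ler_wpM2r xy xq; have h2 := ler_wpM2r xy yq.
rewrite -(mulr_powRB1 x0 pp) -(mulr_powRB1 y0 pp).
move: main h1 h2; set a := x `^ _; set b := y `^ _; set c := M `^ _.
by move=> ? ? ?; nra.
Qed.

Lemma pow_lsc (x e : R) : 0 <= x -> 0 < e -> exists2 dl : R, 0 < dl &
  forall y, 0 <= y -> x - dl <= y -> x `^ p - e <= y `^ p.
Proof.
move=> x0 e0; set c := 2 * x `^ (p - 1).
have c0 : 0 <= c by rewrite mulr_ge0 ?powR_ge0.
have c1 : 0 < c + 1 by lra.
exists (e / (c + 1)); first exact: divr_gt0.
move=> y y0 xy; have [yx|/ltW yx] := leP y x.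
  have := powR_lip y0 yx (lexx x); rewrite -/c => h.
  have h2 : c * (x - y) <= c * (e / (c + 1)) by apply: ler_wpM2l => //; lra.
  have h3 : c * (e / (c + 1)) <= e.
    rewrite mulrA ler_pdivrMr // mulrC; apply: ler_wpM2l; lra.
  lra.
have := powR_le (le_trans ler01 (proj1 (andP p12))) x0 yx; lra.
Qed.

Lemma pow_usc (M e : R) : 0 <= M -> 0 < e -> exists2 dl : R, 0 < dl &
  forall x y, 0 <= x <= M -> 0 <= y -> y <= x + dl -> y `^ p <= x `^ p + e.
Proof.
move=> M0 e0; set c := 2 * (M + 1) `^ (p - 1).
have c0 : 0 <= c by rewrite mulr_ge0 ?powR_ge0.
have c1 : 0 < c + 1 by lra.
exists (Num.min 1 (e / (c + 1))); first by rewrite lt_min ltr01 divr_gt0.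
move=> x y /andP[x0 xM] y0; rewrite -lerBlDl le_min => /andP[yx1 yxe].
have [xy|/ltW yx] := leP x y.
  have yM : y <= M + 1 by lra.
  have := powR_lip x0 xy yM; rewrite -/c => h.
  have h2 : c * (y - x) <= c * (e / (c + 1)) by apply: ler_wpM2l.
  have h3 : c * (e / (c + 1)) <= e.
    rewrite mulrA ler_pdivrMr // mulrC; apply: ler_wpM2l; lra.
  lra.
have := powR_le (le_trans ler01 (proj1 (andP p12))) y0 yx; lra.
Qed.

End PowContinuity.

Section Limits.
Variables (R : realType) (V : normedModType R).

(** Limits relative to an interval: a path on [a, b] may take any value outside it,
    and at the end points only one side is available. *)
Definition right_cont_at (g : R -> V) (t b : R) := forall e : R, 0 < e ->
  exists2 eta : R, 0 < eta & forall r, t < r < t + eta -> r <= b -> `|g r - g t| < e.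

Definition left_limit_at (g : R -> V) (a t : R) (l : V) := forall e : R, 0 < e ->
  exists2 eta : R, 0 < eta & forall r, t - eta < r < t -> a <= r -> `|g r - l| < e.

End Limits.

Section PVar.
Variables (R : realType) (V : normedModType R) (p : R).
Hypothesis p12 : 1 <= p <= 2.
Implicit Types (g : R -> V) (s t u a b : R) (l : seq R).

Local Notation pvs g := (psum (fun u v => `|g v - g u| `^ p)).

Lemma psum_powR_ge0 g a l : 0 <= pvs g a l.
Proof. by elim: l a => //= u l IH a; rewrite addr_ge0 ?powR_ge0. Qed.

(** The p-th power of the p-variation of g on [s, t]. *)
Definition ctrl g s t : R := sup [set pvs g s l | l in itv_partition s t].

Variables (g : R -> V) (a b B : R).
Hypothesis gB : forall l, itv_partition a b l -> pvs g a l <= B.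

Lemma trivial_partition s t : s <= t -> itv_partition s t (if s < t then [:: t] else [::]).
Proof.
move=> st; case: ifPn => st'; first exact: itv_partition1.
by split => //=; rewrite eq_le st leNgt st'.
Qed.

Lemma psum_sub_partition s t l : a <= s -> t <= b -> itv_partition s t l -> pvs g s l <= B.
Proof.
move=> as_ tb hl.
have hs := itv_partition_le hl.
have p1 := trivial_partition as_; have p2 := trivial_partition tb.
have := gB (itv_partition_cat p1 (itv_partition_cat hl p2)).
rewrite !psum_cat; have [_ /eqP ->] := p1.
have := psum_powR_ge0 g a (if a < s then [:: s] else [::]).
have := psum_powR_ge0 g (last s l) (if t < b then [:: b] else [::]).
lra.
Qed.

Lemma bound_ge0 : a <= b -> 0 <= B.
Proof. by move=> ab; apply: le_trans (gB (trivial_partition ab)); exact: psum_powR_ge0. Qed.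

Lemma ctrl_ub s t l : a <= s -> t <= b -> itv_partition s t l -> pvs g s l <= ctrl g s t.
Proof.
move=> as_ tb hl; apply: ub_le_sup; last by exists l.
by exists B => _ [l' hl' <-]; exact: psum_sub_partition hl'.
Qed.

Lemma ctrl_le s t c : s <= t -> (forall l, itv_partition s t l -> pvs g s l <= c) ->
  ctrl g s t <= c.
Proof.
move=> st h; apply: ge_sup.
  exists (pvs g s (if s < t then [:: t] else [::])); eexists; last reflexivity.
  exact: trivial_partition.
by move=> _ [l hl <-]; exact: h.
Qed.

Lemma ctrl_adh s t e : a <= s -> s <= t -> t <= b -> 0 < e ->
  exists2 l, itv_partition s t l & ctrl g s t - e < pvs g s l.
Proof.
move=> as_ st tb e0.
have [|_ [l hl <-] h] := @sup_adherent _ [set pvs g s l | l in itv_partition s t] e e0.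
  split; first by eexists; eexists; [exact: trivial_partition st|reflexivity].
  by exists B => _ [l' hl' <-]; exact: psum_sub_partition hl'.
by exists l.
Qed.

Lemma ctrl_ge0 s t : a <= s -> s <= t -> t <= b -> 0 <= ctrl g s t.
Proof.
move=> as_ st tb; apply: le_trans (ctrl_ub as_ tb (trivial_partition st)).
exact: psum_powR_ge0.
Qed.

Lemma ctrl_leB s t : a <= s -> s <= t -> t <= b -> ctrl g s t <= B.
Proof. by move=> as_ st tb; apply: ctrl_le => // l; exact: psum_sub_partition. Qed.

Lemma ctrl_inc s t : a <= s -> s <= t -> t <= b -> `|g t - g s| `^ p <= ctrl g s t.
Proof.
move=> as_ st tb; apply: le_trans (ctrl_ub as_ tb (trivial_partition st)).
case: ifPn => st'; rewrite /= ?addr0 //.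
have -> : t = s by apply/eqP; rewrite eq_le st leNgt st'.
rewrite subrr normr0 powR0 // gt_eqF //; case/andP: p12 => ? ?; lra.
Qed.

Lemma ctrl_super r s t : a <= r -> r <= s -> s <= t -> t <= b ->
  ctrl g r s + ctrl g s t <= ctrl g r t.
Proof.
move=> ar rs st tb; rewrite -lerBrDr; apply: ctrl_le => // l hl.
rewrite lerBrDr -lerBrDl; apply: ctrl_le => // l' hl'.
rewrite lerBrDl; have := ctrl_ub ar tb (itv_partition_cat hl hl').
by rewrite psum_cat; have [_ /eqP ->] := hl.
Qed.

(** In a nearly optimal partition of [a, t], moving the last point from t to a
    nearby r loses little. *)
Lemma ctrl_left t : a < t -> t <= b -> left_limit_at g a t (g t) ->
  left_limit_at (fun r => ctrl g a r : R^o) a t (ctrl g a t).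
Proof.
move=> lat tb gl e e0; have e20 : 0 < e / 2 by lra.
have e40 : 0 < e / 4 by lra.
have [l hl lB] := ctrl_adh (lexx a) (ltW lat) tb e40.
have [l' lE] : exists l', l = rcons l' t.
  case: (lastP l) hl => [/itv_partition_nil lat'|l' t' [_]].
    by rewrite lat' ltxx in lat.
  by rewrite last_rcons => /eqP ->; exists l'.
subst l; set z := last a l'.
have [pl' zt] : path <%R a l' /\ z < t.
  by case: hl; rewrite rcons_path => /andP[].
have [dl dl0 hdl] := pow_lsc p12 (normr_ge0 (g t - g z)) e40.
have [eta eta0 heta] := gl _ dl0.
exists (Num.min eta (t - z)); first by rewrite lt_min eta0 subr_gt0.
move=> r /andP[]; rewrite ltrBlDl -ltrBlDr lt_min => /andP[r1 r2] rt ar.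
have zr : z < r by lra.
have hr : `|g r - g t| < dl by apply: heta => //; apply/andP; split; lra.
have hp : itv_partition a r (rcons l' r).
  by split; rewrite ?last_rcons // rcons_path pl'.
have lb := ctrl_ub (lexx a) (ltW (lt_le_trans rt tb)) hp.
have sup := ctrl_super (lexx a) ar (ltW rt) tb.
have c0 := ctrl_ge0 ar (ltW rt) tb.
rewrite -cats1 psum_cat /= addr0 -/z in lb.
rewrite -cats1 psum_cat /= addr0 -/z in lB.
have tri : `|g t - g z| <= `|g t - g r| + `|g r - g z| by exact: ler_distD.
rewrite distrC in hr.
have := hdl _ (normr_ge0 (g r - g z)) _ => h.
have {}h : `|g t - g z| `^ p - e / 4 <= `|g r - g z| `^ p by apply: h; lra.
rewrite distrC ger0_norm; lra.
Qed.

(** A nearly optimal partition of [t, b] begins with some [t, t1].  Replacing t by r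
    gives a partition of [r, b] with nearly the same sum; by superadditivity little
    is left for [t, r]. *)
Lemma ctrl_right_small t : a <= t -> t < b -> right_cont_at g t b ->
  forall e : R, 0 < e -> exists2 eta : R, 0 < eta &
    forall r, t < r < t + eta -> r <= b -> ctrl g t r < e.
Proof.
move=> lat tb gr e e0; have e40 : 0 < e / 4 by lra.
have [l hl lB] := ctrl_adh lat (ltW tb) (lexx b) e40.
case: l hl lB => [/itv_partition_nil tb'|t1 l' hl lB].
  by rewrite tb' ltxx in tb.
have tt1 : t < t1 by case: hl => /= /andP[].
have [dl dl0 hdl] := pow_lsc p12 (normr_ge0 (g t1 - g t)) e40.
have [eta eta0 heta] := gr _ dl0.
exists (Num.min eta (t1 - t)); first by rewrite lt_min eta0 subr_gt0.
move=> r /andP[tr]; rewrite -ltrBlDl lt_min => /andP[r1 r2] rb.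
have hr : `|g r - g t| < dl by apply: heta => //; rewrite tr /=; lra.
have rt1 : r < t1 by lra.
have hp : itv_partition r b (t1 :: l').
  by case: hl => /= /andP[_ pl] lb; split; rewrite //= rt1.
have lb := ctrl_ub (le_trans lat (ltW tr)) (lexx b) hp.
have sup := ctrl_super lat (ltW tr) rb (lexx b).
have tri : `|g t1 - g t| <= `|g t1 - g r| + `|g r - g t| by exact: ler_distD.
have h := hdl _ (normr_ge0 (g t1 - g r)) _.
have {}h : `|g t1 - g t| `^ p - e / 4 <= `|g t1 - g r| `^ p by apply: h; lra.
move: lb lB; rewrite /=; lra.
Qed.

(** A partition of [z, r] has one interval that contains t in its interior or at
    its left end; cutting it at t costs at most e. *)
Lemma psum_straddle t r e l z : (forall u, t < u <= r -> forall z, a <= z <= t ->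
     `|g u - g z| `^ p <= `|g t - g z| `^ p + e) ->
  a <= z -> z <= t -> t < r -> r <= b -> itv_partition z r l ->
  pvs g z l <= ctrl g z t + e + ctrl g t r.
Proof.
move=> he; elim: l z => [|u l IH] z az zt tr rb hl.
  by move: (itv_partition_nil hl) => zr; move: zt; rewrite zr leNgt tr.
have zu : z < u by case: hl => /= /andP[].
have hl' := itv_partition_cons hl.
have ur := itv_partition_le hl'.
have [ut|tu] := leP u t.
  have := IH u (le_trans az (ltW zu)) ut tr rb hl'.
  have := ctrl_super az (ltW zu) ut (le_trans (ltW tr) rb).
  have := ctrl_inc az (ltW zu) (le_trans ut (le_trans (ltW tr) rb)).
  rewrite /=; lra.
have at_ := le_trans az zt.
have h1 : `|g u - g z| `^ p <= `|g t - g z| `^ p + e.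
  by apply: he; rewrite ?tu ?az.
have := ctrl_inc az zt (le_trans (ltW tr) rb).
have := ctrl_ub (le_trans at_ (ltW tu)) rb hl'.
have := ctrl_super at_ (ltW tu) ur rb.
have := ctrl_ge0 at_ (ltW tu) (le_trans ur rb).
rewrite /=; lra.
Qed.

Lemma ctrl_right t : a <= t -> t < b -> right_cont_at g t b ->
  right_cont_at (fun r => ctrl g a r : R^o) t b.
Proof.
move=> lat tb gr e e0; have e40 : 0 < e / 4 by lra.
have B0 : 0 <= B by apply: bound_ge0; exact: le_trans (ltW tb).
have [e1 e10 he1] := ctrl_right_small lat tb gr e40.
have M0 : 0 <= B + 1 by lra.
have [dl dl0 hdl] := pow_usc p12 M0 e40.
have [e2 e20 he2] := gr _ dl0.
exists (Num.min e1 e2); first by rewrite lt_min e10.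
move=> r /andP[tr]; rewrite -ltrBlDl lt_min => /andP[r1 r2] rb.
have small : ctrl g t r < e / 4 by apply: he1 => //; rewrite tr /=; lra.
have st : ctrl g a r <= ctrl g a t + e / 4 + ctrl g t r.
  apply: ctrl_le; first exact: le_trans (ltW tr).
  move=> l; apply: psum_straddle => // u /andP[tu ur] z /andP[az zt].
  apply: hdl => //.
  - rewrite normr_ge0 /=; have [|x1] := leP `|g t - g z| 1; first lra.
    have := le1r_powR (ltW x1) (proj1 (andP p12)).
    have := le_trans (ctrl_inc az zt (ltW tb)) (ctrl_leB az zt (ltW tb)); lra.
  - have hu : `|g u - g t| < dl.
      by apply: he2; [apply/andP; split; lra|exact: le_trans rb].
    have : `|g u - g z| <= `|g u - g t| + `|g t - g z| by exact: ler_distD.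
    lra.
have := ctrl_super (lexx a) lat (ltW tr) rb.
have := ctrl_ge0 lat (ltW tr) rb => c0 sup.
rewrite ger0_norm; lra.
Qed.

End PVar.

(** * Clocks with gaps *)

Section Clock.
Variable R : realType.

(** A strictly increasing cadlag change of time c with left limits cl.  With the
    convention cl s = c s, every value in [c s, c T] lies in the closed interval
    [cl u, c u] of exactly one time u ([clock_locate], [clock_locate_uniq]). *)
Record clock (s T : R) (c cl : R -> R) : Prop := Clock {
  clock_inc : forall t t', s <= t -> t < t' -> t' <= T -> c t < c t';
  clock_rc : forall t, s <= t -> t < T -> right_cont_at (c : R -> R^o) t T;
  clock_start : cl s = c s;
  clock_ll : forall t, s < t -> t <= T -> left_limit_at (c : R -> R^o) s t (cl t) }.

Variables (s T : R) (c cl : R -> R).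
Hypothesis C : clock s T c cl.

Lemma clock_nd t t' : s <= t -> t <= t' -> t' <= T -> c t <= c t'.
Proof.
move=> st; rewrite le_eqVlt => /orP[/eqP -> //|tt'] tT.
exact: ltW (clock_inc C st tt' tT).
Qed.

Lemma between_near (u e : R) : s < u -> u <= T -> 0 < e ->
  exists r, [/\ s <= r, r < u & u - e < r].
Proof.
move=> su uT e0; exists (Num.max s (u - e / 2)).
rewrite le_max lexx gt_max lt_max; split => //.
  by rewrite su /=; lra.
by apply/orP; right; lra.
Qed.

Lemma clock_le_left w u : s <= w -> w < u -> u <= T -> c w <= cl u.
Proof.
move=> sw wu uT; rewrite leNgt; apply/negP => lt.
have e0 : 0 < c w - cl u by lra.
have su : s < u by exact: le_lt_trans wu.
have [eta eta0 h] := clock_ll C su uT e0.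
have [r [sr ru ur]] : exists r, [/\ s <= r, r < u & u - Num.min eta (u - w) < r].
  by apply: between_near => //; rewrite lt_min eta0 subr_gt0.
have [r1 r2] : u - eta < r /\ w < r.
  by move: ur; rewrite ltrBlDl -ltrBlDr lt_min => /andP[]; lra.
have := h r; rewrite r1 ru => /(_ isT sr).
have := clock_inc C sw r2 (ltW (lt_le_trans ru uT)).
by rewrite ltr_norml => ? /andP[]; lra.
Qed.

Lemma clock_lt_left w u : s <= w -> w < u -> u <= T -> c w < cl u.
Proof.
move=> sw wu uT; pose v := (w + u) / 2.
have [wv vu] : w < v /\ v < u by rewrite /v; split; lra.
apply: lt_le_trans (clock_inc C sw wv (ltW (lt_le_trans vu uT))) _.
by apply: clock_le_left => //; exact: ltW (le_lt_trans sw wv).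
Qed.

Lemma clock_left_le u : s <= u -> u <= T -> cl u <= c u.
Proof.
rewrite le_eqVlt => /orP[/eqP <- _|su uT]; first by rewrite (clock_start C).
rewrite leNgt; apply/negP => lt; have e0 : 0 < cl u - c u by lra.
have [eta eta0 h] := clock_ll C su uT e0.
have [r [sr ru ur]] := between_near su uT eta0.
have := h r; rewrite ru ur => /(_ isT sr).
have := clock_inc C sr ru uT.
by rewrite ltr_norml => ? /andP[]; lra.
Qed.

Lemma clock_start_le u : s <= u -> u <= T -> c s <= cl u.
Proof.
rewrite le_eqVlt => /orP[/eqP <-|su] uT; first by rewrite (clock_start C).
exact: clock_le_left.
Qed.

(** Take u to be the supremum of the times t with c t <= r. *)
Lemma clock_locate r : s <= T -> c s <= r -> r <= c T ->
  exists u, [/\ s <= u, u <= T, cl u <= r & r <= c u].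
Proof.
move=> sT sr rT; pose A := [set t | s <= t <= T /\ c t <= r].
have As : A s by split; rewrite ?lexx.
have hA : has_sup A by split; [exists s|exists T => t [/andP[]]].
pose u := sup A.
have su : s <= u by apply: ub_le_sup As; case: hA.
have uT : u <= T by apply: ge_sup; [exists s|move=> t [/andP[]]].
exists u; split => //.
- move: su; rewrite le_eqVlt => /orP[/eqP <-|su]; first by rewrite (clock_start C).
  rewrite leNgt; apply/negP => lt; have e0 : 0 < cl u - r by lra.
  have [eta eta0 h] := clock_ll C su uT e0.
  have [t [/andP[st tT] ct] ut] := sup_adherent eta0 hA.
  have tu : t <= u by apply: ub_le_sup => //; [case: hA|split=> //; rewrite st].
  have [tlt|] := ltP t u.
    by have := h t; rewrite ut tlt => /(_ isT st); rewrite ltr_norml => /andP[]; lra.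
  move=> ut'; have tE : t = u by apply/eqP; rewrite eq_le tu ut'.
  rewrite tE in ct; have := clock_left_le (ltW su) uT; lra.
- move: uT; rewrite le_eqVlt => /orP[/eqP -> //|uT].
  rewrite leNgt; apply/negP => lt; have e0 : 0 < r - c u by lra.
  have [eta eta0 h] := clock_rc C su uT e0.
  pose t := u + Num.min (eta / 2) (T - u).
  have m0 : 0 < Num.min (eta / 2) (T - u) by rewrite lt_min subr_gt0 uT andbT; lra.
  have m1 : Num.min (eta / 2) (T - u) <= eta / 2 by rewrite ge_min lexx.
  have m2 : Num.min (eta / 2) (T - u) <= T - u by rewrite ge_min lexx orbT.
  have ut : u < t by rewrite /t; lra.
  have tT : t <= T by rewrite /t; lra.
  have : `|c t - c u| < r - c u by apply: h => //; rewrite ut /= /t; lra.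
  rewrite ltr_norml => /andP[_ ctr].
  have : t <= u; last by rewrite leNgt ut.
  apply: ub_le_sup; first by case: hA.
  by split; [rewrite tT andbT (le_trans su (ltW ut))|lra].
Qed.

Lemma clock_locate_uniq u v r : s <= u -> u <= T -> s <= v -> v <= T ->
  cl u <= r <= c u -> cl v <= r <= c v -> u = v.
Proof.
move=> su uT sv vT /andP[u1 u2] /andP[v1 v2].
have [uv|vu|//] := ltgtP u v.
  by have := clock_lt_left su uv vT; lra.
by have := clock_lt_left sv vu uT; lra.
Qed.

Section Interp.
Variables (V : normedModType R).
Implicit Types (g gl : R -> V).

(** The path u |-> g u read in the clock c, linear across the gaps; gl holds the left
    limits of g.  At a time u without gap the quotient is 0 / 0 = 0 and the value is
    gl u, whence the hypotheses c u = cl u -> g u = gl u below. *)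
Definition interp_with (s T : R) (c cl : R -> R) (g gl : R -> V) (r : R) : V :=
  let u := xget s [set u | (s <= u <= T) /\ (cl u <= r <= c u)] in
  gl u + ((r - cl u) / (c u - cl u)) *: (g u - gl u).

Lemma interpE g gl u r : s <= u -> u <= T -> cl u <= r -> r <= c u ->
  interp_with s T c cl g gl r = gl u + ((r - cl u) / (c u - cl u)) *: (g u - gl u).
Proof.
move=> su uT ur ru; rewrite /interp_with.
case: xgetP => [v _ [/andP[sv vT] hv]|/(_ u) []]; last first.
  by split; apply/andP.
by rewrite (@clock_locate_uniq v u r) ?ur ?ru.
Qed.

Lemma interp_at g gl u : s <= u -> u <= T -> (c u = cl u -> g u = gl u) ->
  interp_with s T c cl g gl (c u) = g u.
Proof.
move=> su uT h; rewrite (interpE _ _ su uT) ?clock_left_le //.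
have [e|ne] := eqVneq (c u) (cl u).
  by rewrite (h e) subrr scaler0 addr0.
by rewrite divff ?subr_eq0 // scale1r addrC subrK.
Qed.

Lemma interp_left g gl u : s <= u -> u <= T ->
  interp_with s T c cl g gl (cl u) = gl u.
Proof.
move=> su uT; rewrite (interpE _ _ su uT) ?clock_left_le //.
by rewrite subrr mul0r scale0r addr0.
Qed.

End Interp.
End Clock.

Section TwoClocks.
Variables (R : realType) (s T : R) (c cl F Fl : R -> R).
Hypotheses (sT : s <= T) (C : clock s T c cl) (CF : clock s T F Fl).
Hypothesis same_gaps : forall u, s <= u -> u <= T -> (c u == cl u) = (F u == Fl u).

(** The change of time from the clock c to the clock F is F itself, read in the
    clock c. *)
Definition retime : R -> R^o := interp_with s T c cl (F : R -> R^o) Fl.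

Lemma retime_at u : s <= u -> u <= T -> retime (c u) = F u.
Proof.
move=> su uT; apply: (interp_at C) => // /eqP; rewrite same_gaps //.
by move/eqP.
Qed.

Lemma ratio_in01 (a b r : R) : a <= r -> r <= b -> 0 <= (r - a) / (b - a) <= 1.
Proof.
move=> ar rb; have [e|ab] := eqVneq a b.
  by rewrite e subrr invr0 mulr0 lexx ler01.
have lt : a < b by rewrite lt_neqAle ab (le_trans ar).
by rewrite divr_ge0 ?ler_pdivrMr ?subr_gt0 //= ?mul1r; lra.
Qed.

Lemma retime_range u r : s <= u -> u <= T -> cl u <= r -> r <= c u ->
  Fl u <= retime r <= F u.
Proof.
move=> su uT ur ru; rewrite /retime (interpE C _ _ su uT ur ru).
have /andP[q0 q1] := ratio_in01 ur ru.
have := clock_left_le CF su uT; rewrite -subr_ge0 => d0.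
rewrite -[_ *: _]/(_ * _); have := mulr_ge0 q0 d0.
have := ler_wpM2r d0 q1; set q := _ / _; set d := F u - Fl u => ? ?.
rewrite -/d; have : F u = Fl u + d by rewrite /d; ring.
by move=> ->; apply/andP; split; lra.
Qed.

Lemma retime_lt r r' : c s <= r -> r < r' -> r' <= c T -> retime r < retime r'.
Proof.
move=> sr rr' rT.
have [u [su uT ur ru]] := clock_locate C sT sr (le_trans (ltW rr') rT).
have [u' [su' uT' ur' ru']] := clock_locate C sT (le_trans sr (ltW rr')) rT.
have /andP[a1 a2] := retime_range su uT ur ru.
have /andP[b1 b2] := retime_range su' uT' ur' ru'.
have [uu|uu|uu] := ltgtP u u'.
- have := clock_lt_left CF su uu uT'; lra.
- have := clock_lt_left C su' uu uT; lra.
- subst u'; rewrite /retime (interpE C _ _ su uT ur ru) (interpE C _ _ su uT ur' ru').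
  have gap : cl u < c u by lra.
  have Fgap : Fl u < F u.
    rewrite lt_neqAle (clock_left_le CF su uT) andbT eq_sym -same_gaps //.
    by rewrite gt_eqF.
  rewrite ltrD2l -[X in X < _]/(_ * _) -[X in _ < X]/(_ * _).
  rewrite ltr_pM2r ?subr_gt0 // ltr_pM2r ?invr_gt0 ?subr_gt0 //; lra.
Qed.

Lemma retime_le r r' : c s <= r -> r <= r' -> r' <= c T -> retime r <= retime r'.
Proof.
move=> sr; rewrite le_eqVlt => /orP[/eqP -> //|rr'] rT.
exact: ltW (retime_lt sr rr' rT).
Qed.

Lemma retime_surj h : F s <= h -> h <= F T ->
  exists2 r, c s <= r <= c T & retime r = h.
Proof.
move=> sh hT; have [u [su uT uh hu]] := clock_locate CF sT sh hT.
have /andP[q0 q1] := ratio_in01 uh hu.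
set q := _ / _ in q0 q1.
have d0 : 0 <= c u - cl u by rewrite subr_ge0 (clock_left_le C).
have e0 := ler_wpM2r d0 q1; have e1 := mulr_ge0 q0 d0.
have ur : cl u <= cl u + q * (c u - cl u) by lra.
have ru : cl u + q * (c u - cl u) <= c u by lra.
exists (cl u + q * (c u - cl u)).
  have := clock_start_le C su uT; have := clock_nd C su uT (lexx T).
  by move=> ? ?; apply/andP; split; lra.
rewrite /retime (interpE C _ _ su uT ur ru).
have [gap|gap] := eqVneq (c u) (cl u).
  have : F u == Fl u by rewrite -same_gaps // gap.
  by move=> /eqP e; rewrite e subrr scaler0 addr0; move: uh hu; rewrite e; lra.
have Fgap : F u - Fl u != 0 by rewrite subr_eq0 -same_gaps.
rewrite addrAC subrr add0r mulfK ?subr_eq0 //.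
by rewrite -[_ *: _]/(_ * _) /q divfK // addrC subrK.
Qed.

(** An increasing map of an interval onto an interval is continuous. *)
Lemma retime_continuous : {within `[c s, c T], continuous retime}.
Proof.
apply: segment_inc_surj_continuous.
  move=> r r'; rewrite !in_itv /= => /andP[sr rT] /andP[sr' rT'].
  apply/idP/idP; last by move=> h; exact: (retime_le sr h rT').
  by rewrite leNgt => h; rewrite leNgt; apply: contra h => h; exact: retime_lt.
move=> h /=; rewrite in_itv /= !retime_at ?lexx // => /andP[sh hT].
by have [r hr <-] := retime_surj sh hT; exists r => //=; rewrite in_itv.
Qed.

(** Both clocks have their gaps at the same times, and the change of time is affine
    on each of them. *)
Lemma interp_retime (V : normedModType R) (g gl : R -> V) r :
  c s <= r -> r <= c T ->
  (forall u, s <= u -> u <= T -> c u = cl u -> g u = gl u) ->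
  interp_with s T F Fl g gl (retime r) = interp_with s T c cl g gl r.
Proof.
move=> sr rT h; have [u [su uT ur ru]] := clock_locate C sT sr rT.
have /andP[a1 a2] := retime_range su uT ur ru.
rewrite (interpE CF _ _ su uT a1 a2) (interpE C _ _ su uT ur ru).
have [gap|gap] := eqVneq (c u) (cl u).
  by rewrite (h _ su uT gap) subrr !scaler0.
have Fgap : F u - Fl u != 0 by rewrite subr_eq0 -same_gaps.
congr (_ + _ *: _); rewrite /retime (interpE C _ _ su uT ur ru).
by rewrite addrAC subrr add0r -[_ *: _]/(_ * _) mulfK.
Qed.

End TwoClocks.

(** * One-sided limits, uniform continuity, finite p-variation *)

Section Bridges.
Variables (R : realType) (V : normedModType R).
Implicit Types (g : R -> V) (a b t : R).

Lemma cvg_right_cont g t b : g w @[w --> t^'+] --> g t -> right_cont_at g t b.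
Proof.
move=> /cvgrPdist_lt h e e0; have := h e e0.
rewrite near_withinE => /nbhs_ballP[eta /= eta0 hb]; exists eta => // r /andP[tr rt] _.
rewrite distrC; apply: hb => //=; rewrite /ball/= distrC gtr0_norm ?subr_gt0 //; lra.
Qed.

Lemma cvg_left_limit g a t : cvg (g w @[w --> t^'-]) -> left_limit_at g a t (left_lim g t).
Proof.
move=> /cvgrPdist_lt h e e0; have := h e e0.
rewrite near_withinE => /nbhs_ballP[eta /= eta0 hb]; exists eta => // r /andP[tr rt] _.
rewrite distrC; apply: hb => //=; rewrite /ball/= gtr0_norm ?subr_gt0 //; lra.
Qed.

Lemma left_limit_cvg g a t l : a < t -> left_limit_at g a t l ->
  g w @[w --> t^'-] --> l.
Proof.
move=> at_ h; apply/cvgrPdist_lt => e e0; have [eta eta0 he] := h e e0.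
near=> w; rewrite distrC; apply: he.
  apply/andP; split; near: w; last exact: nbhs_left_lt.
  by apply: nbhs_left_gt; rewrite ltrBlDr ltrDl.
by apply: ltW; near: w; exact: nbhs_left_gt.
Unshelve. all: by end_near. Qed.

Lemma left_limit_lim g a t l : a < t -> left_limit_at g a t l ->
  cvg (g w @[w --> t^'-]) /\ left_lim g t = l.
Proof.
move=> at_ /(left_limit_cvg at_) h; split; first by apply/cvg_ex; exists l.
exact: cvg_lim h.
Qed.

Lemma left_limit_uniq g a t l l' : a < t -> left_limit_at g a t l ->
  left_limit_at g a t l' -> l = l'.
Proof.
by move=> at_ /(left_limit_lim at_)[_ <-] /(left_limit_lim at_)[_ <-].
Qed.

Definition unif_cont_on g a b := forall e : R, 0 < e -> exists2 eta : R, 0 < eta &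
  forall r r', a <= r <= b -> a <= r' <= b -> `|r - r'| < eta -> `|g r - g r'| < e.

(** Heine's theorem, for continuity in the subspace topology. *)
Lemma within_unif g a b : {within `[a, b], continuous g} -> unif_cont_on g a b.
Proof.
move=> /subspace_continuousP gc e e0; have e20 : 0 < e / 2 by lra.
have /compact_near_coveringP cov := @segment_compact R a b.
pose P (eta r : R) := a <= r <= b -> forall r', a <= r' <= b -> `|r - r'| < eta ->
  `|g r - g r'| < e.
have near_P r0 : `[a, b]%classic r0 -> \forall r \near r0 & eta \near 0^'+, P eta r.
  rewrite /= in_itv /= => hr0.
  have hr0' : `[a, b]%classic r0 by rewrite /= in_itv.
  have /cvgrPdist_lt /(_ _ e20) := gc r0 hr0'.
  rewrite near_withinE => /nbhs_ballP[rho /= rho0 hb].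
  exists (ball r0 (rho / 2), [set eta | 0 < eta < rho / 2]) => /=.
    split; first by apply: nbhsx_ballx; lra.
    near=> eta; apply/andP; split; near: eta; first exact: nbhs_right_gt.
    by apply: nbhs_right_lt; lra.
  move=> [r eta] /= [rr /andP[eta0 etar]] hr r' hr' rr'.
  have inner z : a <= z <= b -> `|r0 - z| < rho -> `|g r0 - g z| < e / 2.
    by move=> hz rz; apply: hb => //=; rewrite in_itv.
  have h1 : `|r0 - r| < rho / 2 by [].
  have i1 : `|g r0 - g r| < e / 2 by apply: inner => //; lra.
  have i2 : `|g r0 - g r'| < e / 2.
    apply: inner => //; have : `|r0 - r'| <= `|r0 - r| + `|r - r'| by exact: ler_distD.
    lra.
  have : `|g r - g r'| <= `|g r - g r0| + `|g r0 - g r'| by exact: ler_distD.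
  rewrite [`|g r - g r0|]distrC; lra.
have FF : Filter (0^'+ : set_system R) by typeclasses eauto.
have := cov R (0^'+) P FF near_P.
rewrite near_withinE => /nbhs_ballP[eta /= eta0 h].
pose d := eta / 2.
have d0 : 0 < d by rewrite /d; lra.
exists d => // r r' hr hr' rr'.
apply: (h d _ d0 r _ hr r' hr' rr') => /=; last by rewrite in_itv.
by rewrite /ball /= sub0r normrN gtr0_norm // /d; lra.
Unshelve. all: by end_near. Qed.

Lemma unif_within g a b : unif_cont_on g a b -> {within `[a, b], continuous g}.
Proof.
move=> h; apply/subspace_continuousP => r; rewrite /= in_itv /= => hr.
apply/cvgrPdist_lt => e e0; have [eta eta0 he] := h e e0.
rewrite near_withinE; apply/nbhs_ballP; exists eta => //= z rz.
by rewrite in_itv /= => hz; apply: he.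
Qed.

Lemma unif_right_cont g a b t : unif_cont_on g a b -> a <= t -> t <= b ->
  right_cont_at g t b.
Proof.
move=> h lat tb e e0; have [eta eta0 he] := h e e0; exists eta => // r /andP[tr rt] rb.
apply: he; rewrite ?lat ?tb ?rb ?andbT //; first exact: le_trans (ltW tr).
by rewrite gtr0_norm ?subr_gt0 //; lra.
Qed.

Lemma unif_left_limit g a b t : unif_cont_on g a b -> a <= t -> t <= b ->
  left_limit_at g a t (g t).
Proof.
move=> h lat tb e e0; have [eta eta0 he] := h e e0; exists eta => // r /andP[tr rt] ar.
apply: he; rewrite ?lat ?tb ?ar //; first exact: le_trans (ltW rt) tb.
by rewrite ltr0_norm ?subr_lt0 //; lra.
Qed.

Lemma onesided_within g a b :
  (forall r, a <= r -> r < b -> right_cont_at g r b) ->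
  (forall r, a < r -> r <= b -> left_limit_at g a r (g r)) ->
  {within `[a, b], continuous g}.
Proof.
move=> rc ll; apply/subspace_continuousP => r; rewrite /= in_itv /= => /andP[ar rb].
apply/cvgrPdist_lt => e e0.
have [e1 e10 h1] : exists2 e1 : R, 0 < e1 & forall z, r < z < r + e1 -> z <= b ->
    `|g z - g r| < e.
  move: rb; rewrite le_eqVlt => /orP[/eqP <-|rb]; last exact: rc.
  by exists 1 => // z /andP[rz _]; rewrite leNgt rz.
have [e2 e20 h2] : exists2 e2 : R, 0 < e2 & forall z, r - e2 < z < r -> a <= z ->
    `|g z - g r| < e.
  move: ar; rewrite le_eqVlt => /orP[/eqP <-|ar]; last exact: ll.
  by exists 1 => // z /andP[_ rz]; rewrite leNgt rz.
rewrite near_withinE; apply/nbhs_ballP; exists (Num.min e1 e2).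
  by rewrite /= lt_min e10.
move=> z /= rz; rewrite in_itv /= => /andP[az zb]; rewrite distrC.
move: rz; rewrite /ball /= lt_min => /andP[]; rewrite !ltr_norml => /andP[a1 a2] /andP[b1 b2].
have [zr|rz|->] := ltgtP z r; last by rewrite subrr normr0.
- by apply: h2 => //; rewrite zr andbT; lra.
- by apply: h1 => //; rewrite rz /=; lra.
Qed.

End Bridges.

Section Variation.
Variables (R : realType) (m : nat) (p : R).
Hypothesis p1 : 1 <= p.
Implicit Types (g : R -> 'cV[R]_m) (a b : R).

Local Notation pvs g := (psum (fun u v => `|g v - g u| `^ p)).

(** Whether the p-variation is finite does not depend on the norm. *)
Lemma pvariation_bound g a b : (pvariation p a b g < +oo)%E ->
  exists B : R, forall l, itv_partition a b l -> pvs g a l <= B.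
Proof.
rewrite /pvariation; set S := ereal_sup _ => fin.
have pp : 0 < p by exact: lt_le_trans p1.
have p0 : p^-1 != 0 by rewrite invr_eq0 gt_eqF.
have Sfin : (S < +oo)%E.
  by rewrite ltey; apply/eqP => E; move: fin; rewrite E poweRyr // ltxx.
have ub l : itv_partition a b l -> ((\sum_(0 <= i < size l)
   enorm (g (nth b (a :: l) i.+1) - g (nth b (a :: l) i)) `^ p)%:E <= S)%E.
  by move=> hl; apply: ereal_sup_ubound; exists l.
exists (fine S) => l hl; rewrite -lee_fin fineK; last first.
  by rewrite fin_numElt Sfin andbT; apply: lt_le_trans (ub l hl); exact: ltNyr.
apply: le_trans (ub l hl); rewrite lee_fin -(psumE (fun u v => `|g v - g u| `^ p) b); apply: ler_sum => i _.
by apply: powR_le => //; [exact: ltW|exact: norm_le_enorm].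
Qed.

Lemma bound_pvariation g a b B :
  (forall l, itv_partition a b l -> pvs g a l <= B) -> (pvariation p a b g < +oo)%E.
Proof.
move=> hB; have pp : 0 < p by exact: lt_le_trans p1.
apply: poweR_lty; set c : R := (m * 1).+1%:R.
apply: (@le_lt_trans _ _ (c `^ p * B)%:E); last exact: ltry.
apply: ge_ereal_sup => _ [l hl <-]; rewrite lee_fin.
apply: (@le_trans _ _ (c `^ p * pvs g a l)); last first.
  by apply: ler_wpM2l; [exact: powR_ge0|exact: hB].
rewrite -(psumE (fun u v => `|g v - g u| `^ p) b) mulr_sumr; apply: ler_sum => i _.
rewrite -powRM //; apply: powR_le; [exact: ltW|exact: enorm_ge0|exact: enorm_le_norm].
Qed.

End Variation.

(** * The variation clock of a path *)

Section Restart.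
Variables (R : realType).

(** A path started afresh at time s has no jump there. *)
Definition restart (V : Type) (s : R) (g gl : R -> V) (u : R) : V :=
  if u == s then g s else gl u.

Lemma left_limit_sub (V : normedModType R) (g : R -> V) a b t l : a <= b ->
  left_limit_at g a t l -> left_limit_at g b t l.
Proof.
move=> ab h e e0; have [eta eta0 he] := h e e0; exists eta => // r rt br.
by apply: he => //; exact: le_trans br.
Qed.

Lemma clock_restart (s T : R) (F Fl : R -> R) : clock 0 T F Fl -> 0 <= s ->
  clock s T F (restart s F Fl).
Proof.
move=> [inc rc st ll] s0; split.
- by move=> t t' h; apply: inc; exact: le_trans h.
- by move=> t h; apply: rc; exact: le_trans h.
- by rewrite /restart eqxx.
- move=> t ht tT; rewrite /restart gt_eqF //.
  apply: (@left_limit_sub R^o F 0 s t _ s0); apply: ll => //.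
  exact: le_lt_trans ht.
Qed.

Lemma monotone_left_limit (f : R -> R) (s u M : R) : s < u ->
  (forall t t', s <= t -> t <= t' -> t' < u -> f t <= f t') ->
  (forall t, s <= t -> t < u -> f t <= M) ->
  left_limit_at (f : R -> R^o) s u (sup [set f w | w in [set w | s <= w < u]]).
Proof.
move=> su nd fM e e0; set S := [set f w | w in _].
have hS : has_sup S.
  split; first by exists (f s); exists s => //=; rewrite lexx.
  by exists M => _ [w /andP[sw wu] <-]; exact: fM.
have [_ [w /andP[sw wu] <-] hw] := sup_adherent e0 hS.
exists (u - w); first by rewrite subr_gt0.
move=> r /andP[ur ru] sr; have wr : w < r by lra.
have h1 : f r <= sup S by apply: ub_le_sup; [case: hS|exists r => //=; rewrite sr].
have h2 := nd _ _ sw (ltW wr) ru.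
by rewrite ltr_norml; apply/andP; split; lra.
Qed.

End Restart.

Section VarClock.
Variables (R : realType) (m : nat) (p T : R) (x : R -> 'cV[R]_m).
Hypotheses (p12 : 1 <= p < 2) (T0 : 0 <= T) (hx : cadlag 0 T x)
  (hxp : (pvariation p 0 T x < +oo)%E).

(** The summand t of F t = t + V t makes the clock strictly increasing.  If x has no
    jump at u then neither has V, by [ctrl_left]; if x jumps at u then
    F u - F r >= |x u - x r|^p keeps F u - Fl u away from 0. *)
Lemma variation_clock : exists F Fl : R -> R, [/\ clock 0 T F Fl,
  forall s t, 0 <= s -> s <= t -> t <= T -> `|x t - x s| `^ p <= F t - F s &
  forall u, 0 < u -> u <= T -> (F u == Fl u) = (jump x u == 0)].
Proof.
case/andP: (p12) => p1 p2.
have p12' : 1 <= p <= 2 by lra.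
have [B hB] := pvariation_bound p1 hxp.
pose W t := ctrl p x 0 t; pose F t := t + W t.
pose Fl u := if u == 0 then F 0 else sup [set F w | w in [set w | 0 <= w < u]].
have W_nd t t' : 0 <= t -> t <= t' -> t' <= T -> W t + ctrl p x t t' <= W t'.
  by move=> t0 tt' tT; apply: (ctrl_super hB).
have W_ge t t' : 0 <= t -> t <= t' -> t' <= T -> 0 <= ctrl p x t t'.
  by move=> t0 tt' tT; apply: (ctrl_ge0 hB).
have F_nd t t' : 0 <= t -> t <= t' -> t' <= T -> F t <= F t'.
  by move=> a b c; have := W_nd _ _ a b c; have := W_ge _ _ a b c; rewrite /F; lra.
have [rc lc] := hx.
have ll u : 0 < u -> u <= T -> left_limit_at (F : R -> R^o) 0 u (Fl u).
  move=> u0 uT; rewrite /Fl gt_eqF //; apply: (@monotone_left_limit _ _ _ _ (F u)) => //.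
    by move=> t t' t0 tt' t'u; apply: F_nd => //; exact: ltW (lt_le_trans t'u uT).
  by move=> t t0 tu; apply: F_nd => //; exact: ltW.
have C : clock 0 T F Fl.
  split => //.
  - move=> t t' t0 tt' tT; have := W_nd _ _ t0 (ltW tt') tT.
    by have := W_ge _ _ t0 (ltW tt') tT; rewrite /F; lra.
  - move=> t t0 tT e e0; have e20 : 0 < e / 2 by lra.
    have rct : right_cont_at x t T by apply: cvg_right_cont; apply: rc; rewrite t0.
    have [eta eta0 he] := ctrl_right p12' hB t0 tT rct e20.
    exists (Num.min eta (e / 2)); first by rewrite lt_min eta0.
    move=> r /andP[tr]; rewrite -ltrBlDl lt_min => /andP[r1 r2] rT.
    have := he r; rewrite tr -ltrBlDl r1 => /(_ isT rT); rewrite ltr_norml => /andP[h1 h2].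
    by rewrite ltr_norml /F /W; apply/andP; split; lra.
  - by rewrite /Fl eqxx.
have hinc s t : 0 <= s -> s <= t -> t <= T -> `|x t - x s| `^ p <= F t - F s.
  move=> s0 st tT; have := W_nd _ _ s0 st tT.
  by have := ctrl_inc p12' hB s0 st tT; rewrite /F; lra.
exists F, Fl; split => // u u0 uT.
have xl : left_limit_at x 0 u (left_lim x u).
  by apply: cvg_left_limit; apply: lc; rewrite u0.
apply/idP/idP => /eqP h; apply/eqP.
  apply: contrapT => /eqP j0.
  have jp : 0 < `|jump x u| `^ p by rewrite powR_gt0 // normr_gt0.
  have [dl dl0 hdl] := pow_lsc p12' (normr_ge0 (jump x u)) jp.
  have := divr_gt0 jp (ltr0Sn R 1) => jp2.
  have [dl' dl0' hdl'] := pow_lsc p12' (normr_ge0 (jump x u)) jp2.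
  have [eta eta0 he] := xl _ dl0'.
  have [eta' eta0' he'] := ll u u0 uT _ jp2.
  have m0 : 0 < Num.min eta eta' by rewrite lt_min eta0.
  have [r [r0 ru ur]] := between_near u0 uT m0.
  move: ur; rewrite ltrBlDr -ltrBlDl lt_min => /andP[r1 r2].
  have h1 : `|x r - left_lim x u| < dl' by apply: he => //; rewrite ru andbT; lra.
  have : `|F r - Fl u| < `|jump x u| `^ p / 2 by apply: he' => //; rewrite ru andbT; lra.
  rewrite ltr_norml => /andP[h2 h3].
  have tri : `|jump x u| <= `|x u - x r| + `|x r - left_lim x u| by exact: ler_distD.
  have h4 : `|jump x u| `^ p - `|jump x u| `^ p / 2 <= `|x u - x r| `^ p.
    by apply: hdl' => //; lra.
  have := hinc _ _ r0 (ltW ru) uT; rewrite h; lra.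
have xu : left_lim x u = x u by apply/esym/eqP; rewrite -subr_eq0; apply/eqP.
rewrite xu in xl; have lW := ctrl_left p12' hB u0 uT xl.
apply: (left_limit_uniq u0 _ (ll u u0 uT)) => e e0; have e20 : 0 < e / 2 by lra.
have [eta eta0 he] := lW _ e20.
exists (Num.min eta (e / 2)); first by rewrite lt_min eta0.
move=> r /andP[]; rewrite ltrBlDr -ltrBlDl lt_min => /andP[r1 r2] ru r0.
have := he r; rewrite ru andbT ltrBlDr -ltrBlDl r1 => /(_ isT r0).
rewrite ltr_norml => /andP[h1 h2].
by rewrite ltr_norml /F /W; apply/andP; split; lra.
Qed.

End VarClock.

Section ClockPath.
Variables (R : realType) (V : normedModType R) (p s T : R) (x xl : R -> V) (F Fl : R -> R).
Hypotheses (p12 : 1 <= p < 2) (C : clock s T F Fl)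
  (hinc : forall s' t, s <= s' -> s' <= t -> t <= T -> `|x t - x s'| `^ p <= F t - F s')
  (xs : xl s = x s)
  (xll : forall u, s < u -> u <= T -> left_limit_at x s u (xl u)).

Let p12' : 1 <= p <= 2. Proof. case/andP: p12 => ? ?; lra. Qed.

(** Let r increase to u in the bound for x r - x w. *)
Lemma path_to_left w u : s <= w -> w < u -> u <= T -> `|xl u - x w| `^ p <= Fl u - F w.
Proof.
move=> sw wu uT; apply/ler_addgt0Pr => e e0; rewrite -lerBlDr.
have su := le_lt_trans sw wu.
have [dl dl0 hdl] := pow_lsc p12' (normr_ge0 (xl u - x w)) e0.
have [eta eta0 he] := xll su uT dl0.
have m0 : 0 < Num.min eta (u - w) by rewrite lt_min eta0 subr_gt0.
have [r [sr ru ur]] := between_near su uT m0.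
move: ur; rewrite ltrBlDr -ltrBlDl lt_min => /andP[r1 r2].
have wr : w < r by lra.
have h1 : `|x r - xl u| < dl by apply: he => //; rewrite ru andbT; lra.
have tri : `|xl u - x w| <= `|xl u - x r| + `|x r - x w| by exact: ler_distD.
rewrite distrC in h1.
apply: le_trans (hdl (`|x r - x w|) _ _) _ => //; first by lra.
apply: le_trans (hinc sw (ltW wr) (ltW (lt_le_trans ru uT))) _.
by rewrite lerD2r; exact: (clock_le_left C).
Qed.

Lemma path_jump u : s <= u -> u <= T -> `|x u - xl u| `^ p <= F u - Fl u.
Proof.
rewrite le_eqVlt => /orP[/eqP <- _|su uT].
  rewrite xs (clock_start C) !subrr normr0 powR0 // gt_eqF //.
  by case/andP: p12 => ? ?; lra.
apply/ler_addgt0Pr => e e0; rewrite -lerBlDr; have e20 : 0 < e / 2 by lra.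
have [dl dl0 hdl] := pow_lsc p12' (normr_ge0 (x u - xl u)) e20.
have [eta eta0 he] := xll su uT dl0.
have [eta' eta0' he'] := clock_ll C su uT e20.
have m0 : 0 < Num.min eta eta' by rewrite lt_min eta0.
have [r [sr ru ur]] := between_near su uT m0.
move: ur; rewrite ltrBlDr -ltrBlDl lt_min => /andP[r1 r2].
have h1 : `|x r - xl u| < dl by apply: he => //; rewrite ru andbT; lra.
have : `|F r - Fl u| < e / 2 by apply: he' => //; rewrite ru andbT; lra.
rewrite ltr_norml => /andP[h2 h3].
have tri : `|x u - xl u| <= `|x u - x r| + `|x r - xl u| by exact: ler_distD.
have := hdl (`|x u - x r|) (normr_ge0 _) _ => h4.
have {}h4 : `|x u - xl u| `^ p - e / 2 <= `|x u - x r| `^ p by apply: h4; lra.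
have := hinc sr (ltW ru) uT; lra.
Qed.

Lemma root_le (a w : R) : 0 <= a -> a `^ p <= w -> a <= w `^ p^-1.
Proof.
move=> a0 aw; have p0 : 0 < p by case/andP: p12 => ? ?; lra.
have -> : a = (a `^ p) `^ p^-1 by rewrite -powRrM divff ?gt_eqF // powRr1.
by apply: powR_le => //; [rewrite invr_ge0 ltW | exact: powR_ge0].
Qed.

(** Go from r to the upper end of its gap, then to the lower end of the gap of r',
    then to r'; each of the three moves is at most (r' - r)^(1/p).  Inside a gap of
    length d the segment has length at most d^(1/p), and a ratio q <= 1 of it is at
    most q^(1/p) d^(1/p). *)
Lemma interp_holder r r' : s <= T -> F s <= r -> r <= r' -> r' <= F T ->
  `|interp_with s T F Fl x xl r' - interp_with s T F Fl x xl r| <= 3 * (r' - r) `^ p^-1.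
Proof.
move=> sT sr rr' rT; set X := interp_with s T F Fl x xl.
have p0 : 0 < p by case/andP: p12 => ? ?; lra.
have ip0 : 0 < p^-1 by rewrite invr_gt0.
have ip1 : p^-1 <= 1 by rewrite invf_le1 //; case/andP: p12.
set g := p^-1 in ip0 ip1 *.
have mono a b : 0 <= a -> a <= b -> a `^ g <= b `^ g by apply: powR_le; exact: ltW.
have same u q q' : s <= u -> u <= T -> Fl u <= q -> q <= q' -> q' <= F u ->
   `|X q' - X q| <= (q' - q) `^ g.
  move=> su uT uq qq' qu.
  rewrite /X (interpE C _ _ su uT (le_trans uq qq') qu) (interpE C _ _ su uT uq (le_trans qq' qu)).
  rewrite opprD addrACA subrr add0r -scalerBl -mulrBl normrZ.
  have -> : q' - Fl u - (q - Fl u) = q' - q by ring.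
  have [gap|gap] := eqVneq (F u) (Fl u).
    by rewrite gap subrr invr0 mulr0 normr0 mul0r powR_ge0.
  have d0 : 0 < F u - Fl u by rewrite subr_gt0 lt_neqAle eq_sym gap (clock_left_le C).
  set d := F u - Fl u in d0 *.
  have w01 : 0 <= (q' - q) / d <= 1.
    rewrite divr_ge0 ?ler_pdivrMr ?mul1r ?subr_ge0 // ?(ltW d0) //= /d; lra.
  have /andP[w0 w1] := w01.
  have hj : `|x u - xl u| <= d `^ g by apply: root_le => //; exact: path_jump.
  rewrite ger0_norm //.
  apply: (@le_trans _ _ (((q' - q) / d) `^ g * d `^ g)).
    apply: ler_pM => //; rewrite -{1}(powRr1 w0); exact: powR_anti.
  by rewrite -powRM ?(ltW d0) // divfK // gt_eqF.
have [u [su uT ur ru]] := clock_locate C sT sr (le_trans rr' rT).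
have [u' [su' uT' ur' ru']] := clock_locate C sT (le_trans sr rr') rT.
have n0 : 0 <= (r' - r) `^ g by exact: powR_ge0.
have [uu|uu|uu] := ltgtP u u'.
- have lt := clock_lt_left C su uu uT'.
  have t1 := same _ _ _ su uT ur ru (lexx _).
  have t3 := same _ _ _ su' uT' (lexx _) ur' ru'.
  have t2 : `|X (Fl u') - X (F u)| <= (Fl u' - F u) `^ g.
    rewrite /X (interp_left C) // (interp_at C) //; last first.
      move=> e; have := path_jump su uT; rewrite e subrr => h.
      apply/eqP; rewrite -subr_eq0 -normr_eq0.
      have := powR_ge0 `|x u - xl u| p => h'.
      have /eqP : `|x u - xl u| `^ p = 0 by apply/eqP; rewrite eq_le h h'.
      by rewrite powR_eq0 => /andP[].
    by apply: root_le => //; exact: path_to_left.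
  have tri : `|X r' - X r| <= `|X r' - X (Fl u')| + (`|X (Fl u') - X (F u)| + `|X (F u) - X r|).
    rewrite -{1}(subrK (X (Fl u')) (X r')) -addrA.
    by apply: le_trans (ler_normD _ _) _; rewrite lerD2l; exact: ler_distD.
  have m1 : (F u - r) `^ g <= (r' - r) `^ g by apply: mono; lra.
  have m2 : (Fl u' - F u) `^ g <= (r' - r) `^ g by apply: mono; lra.
  have m3 : (r' - Fl u') `^ g <= (r' - r) `^ g by apply: mono; lra.
  lra.
- have := clock_lt_left C su' uu uT; lra.
- subst u'; have := same _ _ _ su uT ur rr' ru'; lra.
Qed.

End ClockPath.

(** * The parametrisation tau as a clock *)

(** Finite subfamilies may be listed in increasing order, which makes bounds by
    telescoping available. *)
Lemma esum_le_lists (R : realType) (S : set R) (w : R -> R) (t t' B : R) :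
  (forall u, S u -> t < u <= t') ->
  (forall l, path <%R t l -> {in l, forall u, S u} -> \sum_(u <- l) w u <= B) ->
  (\esum_(u in S) (w u)%:E <= B%:E)%E.
Proof.
move=> St h; apply: ge_ereal_sup => _ [A [finA AS] <-].
rewrite fsbig_finite // sumEFin lee_fin.
set L := finmap.enum_fset (fset_set A).
have memL u : u \in L -> S u.
  by move=> uL; apply: AS; move: uL; rewrite /L in_fset_set // inE.
rewrite (perm_big (sort <=%R L)); last by rewrite perm_sym perm_sort.
apply: h; last by move=> u; rewrite mem_sort; exact: memL.
have : sorted <%R (sort <=%R L).
  by rewrite sort_lt_sorted; exact: finmap.fset_uniq.
have : {in sort <=%R L, forall u, t < u}.
  by move=> u; rewrite mem_sort => /memL/St/andP[].
case: (sort _ _) => //= u l tl -> ; rewrite andbT.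
by apply: tl; rewrite mem_head.
Qed.

Section TauClock.
Variables (R : realType) (m : nat) (p T : R) (x : R -> 'cV[R]_m) (F Fl : R -> R).
Hypotheses (p12 : 1 <= p < 2) (hx : cadlag 0 T x) (CF : clock 0 T F Fl)
  (hinc : forall s t, 0 <= s -> s <= t -> t <= T -> `|x t - x s| `^ p <= F t - F s).

Let w u := enorm (jump x u) `^ p.
Let C1 : R := (m * 1).+1%:R `^ p.

Let p0 : 0 < p. Proof. by case/andP: p12 => p1 _; exact: lt_le_trans p1. Qed.
Let C10 : 0 <= C1. Proof. exact: powR_ge0. Qed.
Let w0 u : 0 <= w u. Proof. exact: powR_ge0. Qed.

(** The p-th power of the jump at u is at most the gap of the clock there, up to the
    factor C1, which compares the Euclidean norm with the sup norm. *)
Lemma jump_weight u : 0 < u -> u <= T -> w u <= C1 * (F u - Fl u).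
Proof.
move=> u0 uT.
have xll v : 0 < v -> v <= T -> left_limit_at x 0 v (restart 0 x (left_lim x) v).
  move=> v0 vT; rewrite /restart gt_eqF //; apply: cvg_left_limit.
  by case: hx => _ h; apply: h; rewrite v0.
have e0 : restart 0 x (left_lim x) 0 = x 0 by rewrite /restart eqxx.
have := path_jump p12 CF hinc e0 xll (ltW u0) uT.
rewrite /restart gt_eqF // => h.
apply: (@le_trans _ _ (C1 * `|x u - left_lim x u| `^ p)); last exact: ler_wpM2l.
rewrite /w /C1 -powRM //; apply: powR_le; [exact: ltW|exact: enorm_ge0|exact: enorm_le_norm].
Qed.

Lemma sum_jumps l t : 0 <= t -> path <%R t l -> last t l <= T ->
  \sum_(u <- l) w u <= C1 * (F (last t l) - F t).
Proof.
elim: l t => [|u l IH] t t0 /=; first by rewrite big_nil subrr mulr0.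
move=> /andP[tu pl] lT; have u0 : 0 < u by exact: le_lt_trans tu.
have uT : u <= T by exact: le_trans (path_ge_start pl) lT.
rewrite big_cons; have := IH u (ltW u0) pl lT.
have := jump_weight u0 uT; have := clock_le_left CF t0 tu uT.
have : 0 <= Fl u - F t by rewrite subr_ge0 (clock_le_left CF).
by move/(mulr_ge0 C10); lra.
Qed.

Definition jsum (t t' : R) : \bar R := \esum_(u in jump_times t t' x) (w u)%:E.

Lemma jsum_ge0 t t' : (0 <= jsum t t')%E.
Proof. by apply: esum_ge0 => u _; rewrite lee_fin. Qed.

Lemma path_last_mem (t : R) l : l != [::] -> last t l \in l.
Proof. by case: l => // u l _ /=; rewrite mem_last. Qed.

Lemma jsum_le t t' : 0 <= t -> t <= t' -> t' <= T ->
  (jsum t t' <= (C1 * (F t' - F t))%:E)%E.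
Proof.
move=> t0 tt' tT; apply: (@esum_le_lists _ _ _ t t'); first by move=> u [].
move=> l pl lS; have lt : last t l <= t'.
  have [->//|/path_last_mem ln] := eqVneq l [::].
  by case: (lS _ (ln t)) => /andP[].
apply: le_trans (sum_jumps t0 pl (le_trans lt tT)) _.
apply: ler_wpM2l => //; rewrite lerD2r; apply: (clock_nd CF) => //.
exact: le_trans (path_ge_start pl).
Qed.

(** All the jumps in (t, u] except the one at u have their gaps inside
    [F t, Fl u]. *)
Lemma jsum_jump_le t u : 0 <= t -> t < u -> u <= T ->
  (jsum t u <= (w u + C1 * (Fl u - F t))%:E)%E.
Proof.
move=> t0 tu uT; apply: (@esum_le_lists _ _ _ t u); first by move=> v [].
have below l : path <%R t l -> last t l < u -> \sum_(v <- l) w v <= C1 * (Fl u - F t).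
  move=> pl lu; apply: le_trans (sum_jumps t0 pl (ltW (lt_le_trans lu uT))) _.
  apply: ler_wpM2l => //; rewrite lerD2r; apply: (clock_le_left CF) => //.
  exact: le_trans t0 (path_ge_start pl).
move=> l; case/lastP: l => [_ _|l v].
  rewrite big_nil addr_ge0 // mulr_ge0 // subr_ge0; exact: (clock_le_left CF).
move=> pl lS; have /andP[tv vu] : t < v <= u.
  by case: (lS v) => //; rewrite mem_rcons mem_head.
move: vu; rewrite le_eqVlt => /orP[/eqP vE|vu].
  move: pl; rewrite rcons_path vE => /andP[pl lu].
  by rewrite -cats1 big_cat big_seq1 /= addrC lerD2l below.
have := below _ pl; rewrite last_rcons => /(_ vu); have := w0 u; lra.
Qed.

Lemma jsum_jump_ge t u : t < u -> ((w u)%:E <= jsum t u)%E.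
Proof.
move=> tu; have [j0|j0] := eqVneq (jump x u) 0.
  have /eqP e0 : enorm (jump x u) == 0 by rewrite enorm_eq0 j0.
  by rewrite /w e0 powR0 ?gt_eqF // jsum_ge0.
apply: esum_ge; exists [set u]; last by rewrite fsbig_set1.
by split; [exact: finite_set1|move=> _ ->; split => //=; rewrite tu lexx].
Qed.

Lemma jsum_fin t t' : 0 <= t -> t <= t' -> t' <= T -> jsum t t' \is a fin_num.
Proof.
move=> t0 tt' tT; rewrite fin_numElt; apply/andP; split.
  by apply: lt_le_trans (jsum_ge0 _ _); exact: ltNyr.
by apply: le_lt_trans (jsum_le t0 tt' tT) _; exact: ltry.
Qed.

Lemma jsum_add s t t' : s <= t -> t <= t' -> (jsum s t' = jsum s t + jsum t t')%E.
Proof.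
move=> st tt'; rewrite /jsum (esumID (jump_times s t x)); last first.
  by move=> u _; rewrite lee_fin.
congr (_ + _)%E; congr (esum _ _); apply/seteqP; split => u /=.
- by case.
- by move=> [/andP[su ut] j]; do !split => //; rewrite su //=; exact: le_trans tt'.
- move=> [[/andP[su ut] j] h]; split => //; rewrite ut andbT ltNge; apply/negP => ut'.
  by apply: h; split => //; rewrite su.
- move=> [/andP[su ut] j]; split; first by split => //; rewrite ut (le_lt_trans st).
  by move=> [/andP[_]]; rewrite leNgt su.
Qed.

Variables (delta s : R).
Hypotheses (d0 : 0 < delta) (s0 : 0 <= s).
Let tau_ := tau delta p s x.

Let shrink (e : R) : 0 < e -> exists2 e1, 0 < e1 & e1 + delta * (C1 * e1) < e.
Proof.
move=> e0; have c0 : 0 < 1 + delta * C1 by have := mulr_ge0 (ltW d0) C10; lra.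
exists (e / (1 + delta * C1) / 2); first by rewrite !divr_gt0.
rewrite mulrA -[X in X + _]mul1r -mulrDl mulrC mulrAC divfK ?gt_eqF //; lra.
Qed.

Lemma tau_diff t t' : s <= t -> t <= t' -> t' <= T ->
  tau_ t' = tau_ t + ((t' - t) + delta * fine (jsum t t')).
Proof.
move=> st tt' tT.
have -> : tau_ t' = t' + delta * fine (jsum s t') by [].
have -> : tau_ t = t + delta * fine (jsum s t) by [].
rewrite (jsum_add st tt') fineD; [ring| |]; apply: jsum_fin => //.
- exact: le_trans tT.
- exact: le_trans st.
Qed.

(** As r increases to u, the jumps in (r, u] other than the one at u contribute at
    most C1 (Fl u - F r), which tends to 0. *)
Lemma tau_left u : s < u -> u <= T ->
  left_limit_at (tau_ : R -> R^o) s u (tau_ u - delta * w u).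
Proof.
move=> su uT e e0.
have u0 := le_lt_trans s0 su.
have [e1 e10 eE] := shrink e0.
have [eta eta0 he] := clock_ll CF u0 uT e10.
exists (Num.min eta e1); first by rewrite lt_min eta0.
move=> r /andP[]; rewrite ltrBlDr -ltrBlDl lt_min => /andP[r1 r2] ru sr.
have r0 := le_trans s0 sr.
have : `|F r - Fl u| < e1 by apply: he => //; rewrite ru andbT; lra.
rewrite ltr_norml => /andP[h1 h2].
have fin := jsum_fin r0 (ltW ru) uT.
have := jsum_jump_ge ru; rewrite -(fineK fin) lee_fin => g1.
have := jsum_jump_le r0 ru uT; rewrite -(fineK fin) lee_fin => g2.
rewrite (tau_diff sr (ltW ru) uT); set j := fine _ in g1 g2 *.
have h3 : delta * (j - w u) <= delta * (C1 * e1).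
  rewrite ler_pM2l //; apply: (@le_trans _ _ (C1 * (Fl u - F r))); first lra.
  apply: ler_wpM2l => //; lra.
have h4 : 0 <= delta * (j - w u) by rewrite mulr_ge0 // ?subr_ge0 // ltW.
move: eE h3 h4 r2 ru; rewrite mulrBr => *.
by rewrite ltr_norml; apply/andP; split; lra.
Qed.

Lemma tau_left_lim u : s < u -> u <= T ->
  left_lim (tau_ : R -> R^o) u = tau_ u - delta * w u.
Proof. by move=> su uT; have [_ ->] := left_limit_lim su (tau_left su uT). Qed.

Lemma tau_clock : clock s T tau_ (restart s tau_ (left_lim (tau_ : R -> R^o))).
Proof.
split.
- move=> t t' st tt' tT; rewrite (tau_diff st (ltW tt') tT).
  have := mulr_ge0 (ltW d0) (fine_ge0 (jsum_ge0 t t')); lra.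
- move=> t st tT e e0.
  have [e1 e10 eE] := shrink e0.
  have t0 := le_trans s0 st.
  have [eta eta0 he] := clock_rc CF t0 tT e10.
  exists (Num.min eta e1); first by rewrite lt_min eta0.
  move=> r /andP[tr]; rewrite -ltrBlDl lt_min => /andP[r1 r2] rT.
  have : `|F r - F t| < e1 by apply: he => //; rewrite tr /=; lra.
  rewrite ltr_norml => /andP[h1 h2].
  have fin := jsum_fin t0 (ltW tr) rT.
  have := jsum_le t0 (ltW tr) rT; rewrite -(fineK fin) lee_fin => g2.
  rewrite (tau_diff st (ltW tr) rT).
  have j0 := fine_ge0 (jsum_ge0 t r); set j := fine _ in g2 j0 *.
  have h3 : delta * j <= delta * (C1 * e1).
    rewrite ler_pM2l //; apply: (le_trans g2); apply: ler_wpM2l => //; lra.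
  have h4 : 0 <= delta * j by rewrite mulr_ge0 // ltW.
  by rewrite ltr_norml; apply/andP; split; lra.
- by rewrite /restart eqxx.
- move=> u su uT; rewrite /restart gt_eqF // tau_left_lim //; exact: tau_left.
Qed.

End TauClock.

(** * The unfolded path and its parametrisations *)

(** A path with a clock that dominates its increments and has gaps exactly at its
    jumps; [variation_clock] provides one. *)
Record driver (R : realType) (m : nat) (p T : R) (x : R -> 'cV[R]_m) (F Fl : R -> R) :=
  Driver {
  drv_p : 1 <= p < 2;
  drv_T : 0 <= T;
  drv_cadlag : cadlag 0 T x;
  drv_clock : clock 0 T F Fl;
  drv_incr : forall s t, 0 <= s -> s <= t -> t <= T -> `|x t - x s| `^ p <= F t - F s;
  drv_gap : forall u, 0 < u -> u <= T -> (F u == Fl u) = (jump x u == 0) }.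

Definition unfolded (R : realType) (m : nat) (T : R) (x : R -> 'cV[R]_m) (F Fl : R -> R) :
    R -> 'cV[R]_m :=
  interp_with 0 T F Fl x (restart 0 x (left_lim x)).

Section Unfolded.
Variables (R : realType) (m : nat) (p T : R) (x : R -> 'cV[R]_m) (F Fl : R -> R).
Hypothesis D : driver p T x F Fl.
Let X := unfolded T x F Fl.
Let p12 := drv_p D.
Let CF := drv_clock D.
Let p0 : 0 < p. Proof. by case/andP: p12 => p1 _; exact: lt_le_trans p1. Qed.

Lemma driver_left_limit u s : 0 <= s -> s < u -> u <= T ->
  left_limit_at x s u (restart s x (left_lim x) u).
Proof.
move=> s0 su uT; rewrite /restart gt_eqF //; apply: cvg_left_limit.
by case: (drv_cadlag D) => _ h; apply: h; rewrite (le_lt_trans s0).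
Qed.

Lemma unfolded_holder r r' : F 0 <= r -> r <= r' -> r' <= F T ->
  `|X r' - X r| <= 3 * (r' - r) `^ p^-1.
Proof.
apply: (interp_holder p12 CF (drv_incr D) _ _ (drv_T D)).
- by rewrite /restart eqxx.
- by move=> u u0 uT; apply: driver_left_limit.
Qed.

Lemma no_gap_no_jump s u : 0 <= s -> s <= u -> u <= T ->
  F u = restart s F Fl u -> x u = restart s x (left_lim x) u.
Proof.
move=> s0 su uT; rewrite /restart; case: eqVneq => [-> //|us] e.
have su' : s < u by rewrite lt_neqAle eq_sym us.
have := drv_gap D (le_lt_trans s0 su') uT; rewrite {1}e eqxx => /esym/eqP.
by move/eqP; rewrite /jump subr_eq0 => /eqP.
Qed.

Lemma clock_left_restart u : 0 <= u -> Fl u = restart 0 F Fl u.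
Proof. by move=> _; rewrite /restart; case: eqVneq => // ->; rewrite (clock_start CF). Qed.

Lemma unfolded_at t : 0 <= t -> t <= T -> X (F t) = x t.
Proof.
move=> t0 tT; apply: (interp_at CF) => //.
by rewrite clock_left_restart //; exact: no_gap_no_jump.
Qed.

Lemma unfolded_left u : 0 < u -> u <= T -> X (Fl u) = left_lim x u.
Proof.
move=> u0 uT; rewrite /X /unfolded (interp_left CF) //; last exact: ltW.
by rewrite /restart gt_eqF.
Qed.

(** Starting at time s closes the gap at s, which lies below F s. *)
Lemma unfolded_restart s r : 0 <= s -> s <= T -> F s <= r -> r <= F T ->
  interp_with s T F (restart s F Fl) x (restart s x (left_lim x)) r = X r.
Proof.
move=> s0 sT sr rT; have Cs := clock_restart CF s0.
have [u [su uT ur ru]] := clock_locate Cs sT sr rT.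
rewrite (interpE Cs _ _ su uT ur ru); move: su; rewrite le_eqVlt => /orP[/eqP us|su].
  subst u; move: ur; rewrite {1}/restart eqxx => ur.
  have -> : r = F s by apply/eqP; rewrite eq_le ru ur.
  rewrite (unfolded_at s0 sT) /restart !eqxx !subrr scaler0 addr0; reflexivity.
have u0 := le_lt_trans s0 su.
move: ur; rewrite {1}/restart (gt_eqF su) => ur.
rewrite /X /unfolded (interpE CF _ _ (ltW u0) uT ur ru).
by rewrite /restart (gt_eqF su) (gt_eqF u0).
Qed.

Section Parametrisation.
Variables (delta s : R).
Hypotheses (d0 : 0 < delta) (s0 : 0 <= s) (sT : s <= T).
Let tau_ := tau delta p s x.
Let tl := restart s tau_ (left_lim (tau_ : R -> R^o)).
Let Fs := restart s F Fl.
Let lam := retime s T tau_ tl F Fs.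

Let Ct : clock s T tau_ tl.
Proof. exact: (tau_clock p12 (drv_cadlag D) CF (drv_incr D)). Qed.
Let Cs : clock s T F Fs. Proof. exact: clock_restart. Qed.

Lemma tau_start : tau_ s = s.
Proof.
rewrite /tau_ /tau esum1 ?mulr0 ?addr0 //= => u [/andP[su us]].
by move: (lt_le_trans su us); rewrite ltxx.
Qed.

Lemma tau_gap u : s < u -> u <= T -> tau_ u - tl u = delta * enorm (jump x u) `^ p.
Proof.
move=> su uT; rewrite /tl /restart gt_eqF //.
rewrite (tau_left_lim p12 (drv_cadlag D) CF (drv_incr D)) //.
by rewrite opprB addrC subrK.
Qed.

Lemma tau_same_gaps u : s <= u -> u <= T -> (tau_ u == tl u) = (F u == Fs u).
Proof.
rewrite le_eqVlt => /orP[/eqP <- _|su uT]; first by rewrite /tl /Fs /restart !eqxx.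
rewrite -subr_eq0 tau_gap // /Fs /restart (gt_eqF su) (drv_gap D) ?(le_lt_trans s0) //.
by rewrite mulf_eq0 (gt_eqF d0) /= powR_eq0 enorm_eq0 (gt_eqF p0) andbT.
Qed.

Lemma unfolded_lam r : tau_ s <= r -> r <= tau_ T ->
  X (lam r) = interp_with s T tau_ tl x (restart s x (left_lim x)) r.
Proof.
move=> sr rT; have [u [su uT ur ru]] := clock_locate Ct sT sr rT.
have /andP[a1 a2] := retime_range Ct Cs su uT ur ru.
have h1 : F s <= lam r by exact: le_trans (clock_start_le Cs su uT) a1.
have h2 : lam r <= F T by apply: le_trans a2 _; exact: (clock_nd Cs su uT (lexx T)).
rewrite -(unfolded_restart s0 sT h1 h2).
apply: (interp_retime sT Ct Cs tau_same_gaps sr rT) => v sv vT e.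
by apply: no_gap_no_jump => //; apply/eqP; rewrite -tau_same_gaps // e.
Qed.

(** The gap of tau at u has length delta |jump x u|^p, so the prescribed segment is
    the interpolation of x across that gap. *)
Lemma parametrisation_exists : parametrisation delta p s T x (X \o lam).
Proof.
split=> [t /andP[st tT]|u r [/andP[su uT] j0] /andP[ur ru]] /=.
  have e : lam (tau_ t) = F t by exact: (retime_at Ct tau_same_gaps st tT).
  by rewrite -/tau_ e (unfolded_at (le_trans s0 st) tT).
have tlE : left_lim (tau_ : R -> R^o) u = tl u by rewrite /tl /restart (gt_eqF su).
rewrite -/tau_ tlE in ur ru *.
rewrite (unfolded_lam (le_trans (clock_start_le Ct (ltW su) uT) ur)
  (le_trans (ltW ru) (clock_nd Ct (ltW su) uT (lexx T)))).
rewrite (interpE Ct _ _ (ltW su) uT ur (ltW ru)) (tau_gap su uT).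
by rewrite /restart (gt_eqF su) invfM mulrA powRN.
Qed.

Lemma parametrisation_unique xd r : parametrisation delta p s T x xd ->
  tau_ s <= r -> r <= tau_ T -> xd r = X (lam r).
Proof.
move=> [h1 h2] sr rT; have [g1 g2] := parametrisation_exists.
have [u [su uT ur ru]] := clock_locate Ct sT sr rT.
move: ru; rewrite le_eqVlt => /orP[/eqP ->|ru].
  by rewrite h1 ?su // -[X _]/((X \o lam) _) g1 // su.
move: su; rewrite le_eqVlt => /orP[/eqP us|su].
  by move: ur ru; rewrite -us /tl /restart eqxx => ur; rewrite ltNge ur.
have j0 : jump x u != 0.
  rewrite -(drv_gap D) ?(le_lt_trans s0) //.
  have := tau_same_gaps (ltW su) uT; rewrite /Fs {1}/restart (gt_eqF su) => <-.
  by rewrite gt_eqF // (le_lt_trans ur).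
have tlE : left_lim (tau_ : R -> R^o) u = tl u by rewrite /tl /restart (gt_eqF su).
have hu : jump_times s T x u by split => //; rewrite su.
have hr : left_lim (tau_ : R -> R^o) u <= r < tau_ u by rewrite tlE ur.
by rewrite (h2 u r hu hr) -[X _]/((X \o lam) _) (g2 u r hu hr).
Qed.

End Parametrisation.
End Unfolded.

(** * Geometric solutions *)

Section GlobalHolder.
Variables (R : realType) (d : nat) (W : normedModType R).
Variables (phi : 'cV[R]_d -> W -> 'cV[R]_d) (K b g H h M : R).
Hypotheses (Hphi : c1beta phi K b) (g12 : 2^-1 < g <= 1) (H0 : 0 <= H)
  (h01 : 0 < h <= 1) (M0 : 0 <= M).

(** Davie's estimate controls windows of length h; a longer interval is a bounded
    number of windows and has length at least h. *)
Lemma davie_global_holder (X : R -> W) (al be : R) (Y : R -> 'cV[R]_d) :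
  (forall r r', al <= r -> r <= r' -> r' <= be -> `|X r' - X r| <= H * (r' - r) `^ g) ->
  davie_on phi g h M X `[al, be] Y ->
  exists2 C : R, 0 <= C & forall r r', al <= r -> r <= r' -> r' <= be ->
    `|Y r' - Y r| <= C * (r' - r) `^ g.
Proof.
move=> hX hY; case/andP: (h01) => h0 h1; have K0 := c1_ge0 Hphi.
have g0 : 0 < g by case/andP: g12 => h' _; apply: lt_trans h'; rewrite invr_gt0.
pose M1 := K * H + M; have M10 : 0 <= M1 by rewrite addr_ge0 // mulr_ge0.
have near r r' : al <= r -> r <= r' -> r' <= be -> r' - r <= h ->
    `|Y r' - Y r| <= M1 * (r' - r) `^ g.
  move=> a1 a2 a3 a4; apply: (davie_incr Hphi g12 h01 M0 hY) => //.
  - by rewrite /= in_itv /= a1 (le_trans a2).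
  - by rewrite /= in_itv /= a3 (le_trans a1).
  - exact: hX.
have steps n r r' : al <= r -> r <= r' -> r' <= be -> r' - r <= n.+1%:R * h ->
    `|Y r' - Y r| <= n.+1%:R * M1.
  elim: n r => [|n IH] r a1 a2 a3 a4.
    rewrite mul1r in a4; apply: le_trans (near _ _ a1 a2 a3 a4) _.
    rewrite [leRHS]mul1r -[leRHS]mulr1; apply: ler_wpM2l => //; apply: powR_le1; first exact: ltW.
    by rewrite subr_ge0 a2 (le_trans a4).
  have [small|big] := leP (r' - r) h.
    apply: le_trans (near _ _ a1 a2 a3 small) _; rewrite mulrC.
    apply: ler_wpM2r => //; apply: (@le_trans _ _ 1); last by rewrite ler1n.
    by apply: powR_le1; [exact: ltW|rewrite subr_ge0 a2 (le_trans small)].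
  have b1 : al <= r + h by lra.
  have b2 : r + h <= r' by lra.
  have b3 : r' - (r + h) <= n.+1%:R * h by rewrite -natr1 in a4; lra.
  have n1 := IH _ b1 b2 a3 b3.
  have c2 : r <= r + h by lra.
  have c4 : r + h - r <= h by lra.
  have n2 := near _ _ a1 c2 (le_trans b2 a3) c4.
  have : (r + h - r) `^ g <= 1 by apply: powR_le1; [exact: ltW|lra].
  move/(ler_wpM2l M10) => n3.
  have : `|Y r' - Y r| <= `|Y r' - Y (r + h)| + `|Y (r + h) - Y r| by exact: ler_distD.
  rewrite -[n.+2%:R]natr1; move: n1 n2 n3; clr; lra.
pose n := Num.truncn ((be - al) / h).
have hg0 : 0 < h `^ g by exact: powR_gt0.
have nM0 : 0 <= n.+1%:R * M1 / h `^ g by rewrite divr_ge0 ?mulr_ge0 // ltW.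
exists (M1 + n.+1%:R * M1 / h `^ g); first exact: addr_ge0.
move=> r r' a1 a2 a3; have p0 := powR_ge0 (r' - r) g.
have [small|big] := leP (r' - r) h.
  apply: le_trans (near _ _ a1 a2 a3 small) _; apply: ler_wpM2r => //; lra.
have lt := truncnS_gt ((be - al) / h); rewrite -/n ltr_pdivrMr // in lt.
apply: le_trans (steps n r r' a1 a2 a3 _) _; first by move: a1 a3 lt; clr; lra.
apply: (@le_trans _ _ (n.+1%:R * M1 / h `^ g * (r' - r) `^ g)); last first.
  by apply: ler_wpM2r => //; rewrite lerDr.
rewrite -mulrA ler_peMr ?mulr_ge0 // mulrC ler_pdivlMr // mul1r.
by apply: powR_le; [exact: ltW|exact: ltW|exact: ltW].
Qed.

End GlobalHolder.

Lemma double_gt1 (R : realType) (g : R) : 2^-1 < g -> 1 < 2 * g.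
Proof. by move=> g2; lra. Qed.

Section Geometric.
Variables (R : realType) (m d : nat) (p T : R) (x : R -> 'cV[R]_m) (F Fl : R -> R).
Variable (f : 'cV[R]_d -> 'M[R]_(d, m)).
Let phi (y : 'cV[R]_d) (v : 'cV[R]_m) : 'cV[R]_d := f y *m v.
Variables (K b h M : R).
Hypotheses (D : driver p T x F Fl) (Hphi : c1beta phi K b)
  (b01 : 0 < b <= 1) (bp : p - 1 < b) (h01 : 0 < h <= 1) (M0 : 0 <= M).
Let X := unfolded T x F Fl.
Let g := p^-1.

Let p0 : 0 < p. Proof. by case/andP: (drv_p D) => p1 _; exact: lt_le_trans p1. Qed.
Let g0 : 0 < g. Proof. by rewrite invr_gt0. Qed.

Lemma exponent_range : 2^-1 < g <= 1.
Proof.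
case/andP: (drv_p D) => p1 p2; rewrite /g invf_le1 // p1 andbT.
by rewrite ltf_pV2 ?posrE.
Qed.

Lemma exponent_sum : 1 < (1 + b) * g.
Proof. by rewrite /g ltr_pdivlMr // mul1r; have := bp; lra. Qed.

Let CF := drv_clock D.
Let K0 : 0 <= K := c1_ge0 Hphi.

Section FromS.
Variables (delta s : R) (b0 : 'cV[R]_d).
Hypotheses (d0 : 0 < delta) (s0 : 0 <= s) (sT : s <= T).
Let tau_ := tau delta p s x.
Let tl := restart s tau_ (left_lim (tau_ : R -> R^o)).
Let Fs := restart s F Fl.
Let lam := retime s T tau_ tl F Fs.
Variable Y : R -> 'cV[R]_d.
Hypotheses (Y0 : Y (F s) = b0) (hY : davie_on phi g h M X `[F s, F T] Y).

Let Ct : clock s T tau_ tl.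
Proof. exact: (tau_clock (drv_p D) (drv_cadlag D) CF (drv_incr D)). Qed.
Let Cs : clock s T F Fs. Proof. exact: clock_restart. Qed.
Let gaps u : s <= u -> u <= T -> (tau_ u == tl u) = (F u == Fs u).
Proof. exact: tau_same_gaps. Qed.
Let tau_s : tau_ s = s. Proof. exact: tau_start. Qed.

Let lam_at u : s <= u -> u <= T -> lam (tau_ u) = F u.
Proof. exact: retime_at. Qed.

Let lam_s : lam s = F s.
Proof. by rewrite -{1}tau_s lam_at. Qed.

Let lam_le r r' : s <= r -> r <= r' -> r' <= tau_ T -> lam r <= lam r'.
Proof. by rewrite -{1}tau_s; exact: retime_le. Qed.

Let lam_in r : s <= r -> r <= tau_ T -> F s <= lam r <= F T.
Proof.
move=> sr rT; rewrite -(lam_at (lexx s) sT) -(lam_at sT (lexx T)).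
by rewrite !lam_le ?tau_s // (le_trans sr).
Qed.

Let sTt : s <= tau_ T. Proof. by rewrite -{1}tau_s; exact: (clock_nd Ct). Qed.

Let Fs_ge : F 0 <= F s. Proof. exact: (clock_nd CF). Qed.

Let X_holder r r' : F s <= r -> r <= r' -> r' <= F T -> `|X r' - X r| <= 3 * (r' - r) `^ g.
Proof. by move=> a1 a2 a3; apply: (unfolded_holder D) => //; exact: le_trans a1. Qed.

Let lam_unif : unif_cont_on lam s (tau_ T).
Proof.
have hc := retime_continuous sT Ct Cs gaps; rewrite tau_s in hc.
exact: within_unif hc.
Qed.

Let Xlam_holder r r' : s <= r -> r <= r' -> r' <= tau_ T ->
  `|X (lam r') - X (lam r)| <= 3 * (lam r' - lam r) `^ g.
Proof.
move=> sr rr' rT; apply: X_holder; last 1 first.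
- by case/andP: (lam_in (le_trans sr rr') rT).
- by case/andP: (lam_in sr (le_trans rr' rT)).
- exact: lam_le.
Qed.

Let three0 : 0 <= 3 :> R. Proof. by []. Qed.

Lemma retimed_holder : exists2 C : R, 0 <= C & forall r r', s <= r -> r <= r' ->
  r' <= tau_ T -> `|Y (lam r') - Y (lam r)| <= C * (lam r' - lam r) `^ g.
Proof.
have [C C0 hC] := davie_global_holder Hphi exponent_range three0 h01 M0 X_holder hY.
exists C => // r r' sr rr' rT; apply: hC.
- by case/andP: (lam_in sr (le_trans rr' rT)).
- exact: lam_le.
- by case/andP: (lam_in (le_trans sr rr') rT).
Qed.

Lemma davie_retimed r r' : s <= r -> r <= r' -> r' <= tau_ T -> lam r' - lam r <= h ->
  `|Y (lam r') - Y (lam r) - phi (Y (lam r)) (X (lam r') - X (lam r))|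
    <= M * (lam r' - lam r) `^ (2 * g).
Proof.
move=> sr rr' rT; apply: hY; rewrite /= ?in_itv /=.
- exact: lam_in sr (le_trans rr' rT).
- exact: lam_in (le_trans sr rr') rT.
- exact: lam_le.
Qed.

(** In a Riemann sum, moving the tag to the left end point of its interval costs
    K C 3 D^(2 g), where D is the length of the interval in the clock F, and Davie's
    estimate turns the term into an increment of Y up to M D^(2 g).  For intervals
    with D <= e1 the total error is at most a multiple of e1^(2 g - 1). *)
Lemma davie_young r : s <= r -> r <= tau_ T ->
  is_young_integral (f \o (Y \o lam)) (X \o lam) s r (Y (lam r) - b0).
Proof.
move=> sr rT e e0; have [C C0 hC] := retimed_holder.
case/andP: exponent_range => g2 g1.
have g20 : 0 < 2 * g - 1 by move: g2; lra.
pose L := lam r - lam s; have L0 : 0 <= L by rewrite subr_ge0 lam_le.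
pose C1 := K * C * 3 + M; have C10 : 0 <= C1 by rewrite addr_ge0 // !mulr_ge0.
pose cE : R := (d * 1).+1%:R; have cE0 : 0 <= cE by [].
have [e1 /andP[e10 e1h] small] : exists2 e1 : R, 0 < e1 <= h &
    (cE * (C1 * L)) * e1 `^ (2 * g - 1) < e.
  by apply: powR_lt_small => //; rewrite !mulr_ge0.
have [eta eta0 he] := lam_unif e10.
exists eta => // l xi hl mesh tags.
set u := nth r (s :: l) in mesh tags *.
have uin i : s <= u i <= r by exact: partition_in.
have und i j : (i <= j)%N -> u i <= u j by move=> ij; exact: partition_nd.
have us i : s <= u i by case/andP: (uin i).
have uT i : u i <= tau_ T by case/andP: (uin i) => _ h'; exact: le_trans rT.
apply: le_lt_trans (enorm_le_norm _) _; rewrite -/cE.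
apply: le_lt_trans small; rewrite -!mulrA; apply: ler_wpM2l => //.
have -> : Y (lam r) - b0 = \sum_(0 <= i < size l) (Y (lam (u i.+1)) - Y (lam (u i))).
  rewrite (telescope_sumr (fun i => Y (lam (u i)))) //.
  have -> : u (size l) = r by exact: itv_partition_nth_size hl.
  by rewrite -Y0 -lam_s.
have LE : L = \sum_(0 <= i < size l) (lam (u i.+1) - lam (u i)).
  rewrite (telescope_sumr (fun i => lam (u i))) //.
  by have -> : u (size l) = r by exact: itv_partition_nth_size hl.
rewrite -sumrB; apply: le_trans (ler_norm_sum _ _ _) _.
rewrite LE mulr_suml mulr_sumr; apply: ler_sum_nat => i /andP[_ il] /=.
have ii := und _ _ (leqnSn i).
have dl0 : 0 <= lam (u i.+1) - lam (u i) by rewrite subr_ge0 lam_le.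
have dle : lam (u i.+1) - lam (u i) < e1.
  rewrite -[ltLHS]ger0_norm //; apply: he; rewrite ?us ?uT //.
  by rewrite ger0_norm ?subr_ge0 //; exact: mesh.
have /andP[t1 t2] := tags _ il.
set D1 := lam (u i.+1) - lam (u i) in dl0 dle *.
have dh : D1 <= h by exact: le_trans (ltW dle) e1h.
have r1 := davie_retimed (us i) ii (uT i.+1) dh; rewrite -/D1 in r1.
have r2 := hC _ _ (us i) t1 (le_trans t2 (uT _)).
have r3 := Xlam_holder (us i) ii (uT i.+1); rewrite -/D1 in r3.
have mono : (lam (xi i) - lam (u i)) `^ g <= D1 `^ g.
  apply: powR_le; first exact: ltW.
    by rewrite subr_ge0 lam_le // (le_trans t2).
  by rewrite lerD2r lam_le // (le_trans (us i)).
have {}r2 := le_trans r2 (ler_wpM2l C0 mono).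
have r4 := c1_lip Hphi (Y (lam (u i))) (Y (lam (xi i))) (X (lam (u i.+1)) - X (lam (u i))).
have r5 := ler_wpM2l K0 (ler_pM (normr_ge0 _) (normr_ge0 _) r2 r3).
have pw : D1 `^ (2 * g) <= e1 `^ (2 * g - 1) * D1.
  by apply: powR_superlinear (ltW dle); first exact: double_gt1.
have -> : f (Y (lam (xi i))) *m (X (lam (u i.+1)) - X (lam (u i))) -
    (Y (lam (u i.+1)) - Y (lam (u i))) =
  (phi (Y (lam (xi i))) (X (lam (u i.+1)) - X (lam (u i))) -
   phi (Y (lam (u i))) (X (lam (u i.+1)) - X (lam (u i)))) -
  (Y (lam (u i.+1)) - Y (lam (u i)) - phi (Y (lam (u i))) (X (lam (u i.+1)) - X (lam (u i)))).
  by rewrite -/(phi _ _); zmod.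
apply: le_trans (ler_normB _ _) _.
have C1pw := ler_wpM2l C10 pw.
have dbl := powR_double D1 g0.
move: r1 r4 r5 C1pw; rewrite dbl /C1 mulrA; clr; lra.
Qed.

Lemma davie_geometric : geometric_solution delta p s T x f b0 (Y \o F).
Proof.
have [C C0 hC] := retimed_holder.
have p1 : 1 <= p by case/andP: (drv_p D).
exists (X \o lam), (Y \o lam); split.
- exact: (parametrisation_exists D d0 s0 sT).
- apply: unif_within => e e0.
  have [e1 /andP[e10 _] small] : exists2 e1 : R, 0 < e1 <= h & C * e1 `^ g < e.
    exact: powR_lt_small.
  have [eta eta0 he] := lam_unif e10.
  exists eta => // r r' /andP[sr rT] /andP[sr' rT'] rr'.
  have := he r r'; rewrite sr rT sr' rT' => /(_ isT isT rr') close.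
  have key q q' : s <= q -> q <= q' -> q' <= tau_ T -> `|lam q' - lam q| < e1 ->
      `|Y (lam q') - Y (lam q)| < e.
    move=> sq qq' qT; have le := lam_le sq qq' qT.
    rewrite ger0_norm ?subr_ge0 // => lt.
    apply: le_lt_trans (hC _ _ sq qq' qT) _; apply: le_lt_trans small.
    apply: ler_wpM2l => //; apply: powR_le; [exact: ltW|by rewrite subr_ge0|exact: ltW].
  have [le|/ltW le] := leP r r'; last exact: key.
  by rewrite distrC; apply: key => //; rewrite distrC.
- apply: (@bound_pvariation _ _ _ p1 _ _ _ (C `^ p * (lam (tau_ T) - lam s))) => l hl.
  have key q l' : s <= q -> path <%R q l' -> last q l' <= tau_ T ->
      psum (fun u v => `|Y (lam v) - Y (lam u)| `^ p) q l' <= C `^ p * (lam (last q l') - lam q).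
    elim: l' q => [|v l' IH] q sq /=; first by rewrite subrr mulr0.
    move=> /andP[qv pl] lT; have sv := le_trans sq (ltW qv).
    have vT : v <= tau_ T by exact: le_trans (path_ge_start pl) lT.
    have i1 := IH _ sv pl lT; have i2 := hC _ _ sq (ltW qv) vT.
    have dl : 0 <= lam v - lam q by rewrite subr_ge0 lam_le // ltW.
    have i3 : `|Y (lam v) - Y (lam q)| `^ p <= C `^ p * (lam v - lam q).
      have e1 : (lam v - lam q) = ((lam v - lam q) `^ g) `^ p.
        by rewrite -powRrM mulVf ?gt_eqF // powRr1.
      have e2 : C `^ p * (lam v - lam q) = (C * (lam v - lam q) `^ g) `^ p.
        by rewrite {1}e1 powRM // powR_ge0.
      by rewrite e2; apply: powR_le => //; exact: ltW.
    lra.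
  have [pl /eqP lE] := hl.
  by have := key s l (lexx s) pl; rewrite lE => /(_ (lexx _)).
- move=> r /andP[sr rT]; exists (Y (lam r) - b0); first exact: davie_young.
  by rewrite /= addrC subrK.
- by move=> t /andP[st tT]; rewrite /= lam_at.
Qed.

Section Uniqueness.
Variables (xd : R -> 'cV[R]_m) (yd : R -> 'cV[R]_d).
Hypotheses (hpar : parametrisation delta p s T x xd)
  (hcont : {within `[s, tau_ T], continuous yd})
  (hpv : (pvariation p s (tau_ T) yd < +oo)%E)
  (hint : forall r, s <= r <= tau_ T ->
     exists2 I, is_young_integral (f \o yd) xd s r I & yd r = b0 + I).

Let xdE r : s <= r -> r <= tau_ T -> xd r = X (lam r).
Proof.
move=> sr rT; apply: (parametrisation_unique D d0 s0 sT hpar _ rT).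
by rewrite -/tau_ tau_s.
Qed.

Let W r := ctrl p yd s r.
(* A Young solution is only known to have finite p-variation.  Adding this variation
   to the clock makes the solution and the driving path Hoelder at once. *)
Let c r := lam r + W r.

Let p12' : 1 <= p <= 2. Proof. by case/andP: (drv_p D) => p1 p2; rewrite p1 ltW. Qed.
Let p1 : 1 <= p. Proof. by case/andP: (drv_p D). Qed.

Let W_bound : exists B : R, forall l, itv_partition s (tau_ T) l ->
  psum (fun u v => `|yd v - yd u| `^ p) s l <= B.
Proof. exact: (pvariation_bound p1 hpv). Qed.

Let W_super r r' : s <= r -> r <= r' -> r' <= tau_ T -> W r + ctrl p yd r r' <= W r'.
Proof. by move=> a1 a2 a3; have [B hB] := W_bound; apply: (ctrl_super hB). Qed.

Let W_incr r r' : s <= r -> r <= r' -> r' <= tau_ T ->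
  `|yd r' - yd r| `^ p <= W r' - W r.
Proof.
move=> a1 a2 a3; have [B hB] := W_bound.
apply: le_trans (ctrl_inc p12' hB a1 a2 a3) _; rewrite lerBrDl; exact: W_super.
Qed.

Let c_incr r r' : s <= r -> r <= r' -> r' <= tau_ T ->
  [/\ 0 <= lam r' - lam r, 0 <= W r' - W r & 0 <= c r' - c r].
Proof.
move=> a1 a2 a3; have l1 : 0 <= lam r' - lam r by rewrite subr_ge0 lam_le.
have l2 : 0 <= W r' - W r by apply: le_trans (W_incr a1 a2 a3); exact: powR_ge0.
split => //; have -> : c r' - c r = (lam r' - lam r) + (W r' - W r) by rewrite /c; ring.
exact: addr_ge0.
Qed.

Let c_le r r' : s <= r -> r <= r' -> r' <= tau_ T -> c r <= c r'.
Proof. by move=> a1 a2 a3; have [_ _] := c_incr a1 a2 a3; rewrite subr_ge0. Qed.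

Let c_unif : unif_cont_on (c : R -> R^o) s (tau_ T).
Proof.
have ydu := within_unif hcont; have [B hB] := W_bound.
have Wu : unif_cont_on (W : R -> R^o) s (tau_ T).
  apply: within_unif; apply: onesided_within => r sr rT.
  - by apply: (ctrl_right p12' hB) => //; apply: unif_right_cont ydu _ _ => //; exact: ltW.
  - by apply: (ctrl_left p12' hB) => //; apply: unif_left_limit ydu _ _ => //; exact: ltW.
move=> e e0; have e20 : 0 < e / 2 by rewrite divr_gt0.
have [eta1 h1 k1] := lam_unif e20; have [eta2 h2 k2] := Wu _ e20.
exists (Num.min eta1 eta2); first by rewrite lt_min h1.
move=> r r' hr hr'; rewrite lt_min => /andP[a1 a2].
have := k1 r r' hr hr' a1; have := k2 r r' hr hr' a2 => n1 n2.
have -> : c r - c r' = (lam r - lam r') + (W r - W r') by rewrite /c; ring.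
apply: le_lt_trans (ler_normD _ _) _; rewrite [e]splitr; exact: ltrD.
Qed.

Let pow_c (a : R) r r' : s <= r -> r <= r' -> r' <= tau_ T -> 0 < a ->
  (lam r' - lam r) `^ a <= (c r' - c r) `^ a /\ (W r' - W r) `^ a <= (c r' - c r) `^ a.
Proof.
move=> a1 a2 a3 a0; have [l1 l2 l3] := c_incr a1 a2 a3.
have cE : c r' - c r = (lam r' - lam r) + (W r' - W r) by rewrite /c; ring.
by split; apply: powR_le => //; rewrite ?(ltW a0) // cE ?lerDl ?lerDr.
Qed.

Let yd_holder r r' : s <= r -> r <= r' -> r' <= tau_ T ->
  `|yd r' - yd r| <= 1 * (c r' - c r) `^ g.
Proof.
move=> a1 a2 a3; rewrite mul1r.
apply: le_trans (root_le (drv_p D) (normr_ge0 _) (W_incr a1 a2 a3)) _.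
by have [] := pow_c a1 a2 a3 g0.
Qed.

Let xd_holder r r' : s <= r -> r <= r' -> r' <= tau_ T ->
  `|xd r' - xd r| <= 3 * (c r' - c r) `^ g.
Proof.
move=> a1 a2 a3; rewrite (xdE (le_trans a1 a2) a3) (xdE a1 (le_trans a2 a3)).
apply: le_trans (Xlam_holder a1 a2 a3) _; apply: ler_wpM2l => //.
by have [] := pow_c a1 a2 a3 g0.
Qed.

Let Cy : R := sew_const (2 * g) * (K * 1 * 3).

(** The integral over [r, r'] is a difference of two integrals, and its Riemann
    sums obey Young's estimate. *)
Let young_defect r r' : s <= r -> r <= r' -> r' <= tau_ T ->
  `|yd r' - yd r - phi (yd r) (xd r' - xd r)| <= Cy * (c r' - c r) `^ (2 * g).
Proof.
move=> sr rr' rT; apply/ler_addgt0Pr => e e0; have e20 : 0 < e / 2 by rewrite divr_gt0.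
have g2 : 2^-1 < g by case/andP: exponent_range.
have rT' := le_trans rr' rT; have sr' := le_trans sr rr'.
have [I hI yr] := hint (introT andP (conj sr rT')).
have [I' hI' yr'] := hint (introT andP (conj sr' rT)).
have [eta1 eta10 k1] := hI _ e20; have [eta2 eta20 k2] := hI' _ e20.
pose eta := Num.min eta1 eta2; have eta0 : 0 < eta by rewrite lt_min eta10.
have [l1 [hl1 m1]] := fine_partition eta0 sr.
have [l2 [hl2 m2]] := fine_partition eta0 rr'.
have hl := itv_partition_cat hl1 hl2.
have l1E : last s l1 = r by case: hl1 => _ /eqP.
have m12 : path (fun u v => v - u < eta) s (l1 ++ l2) by rewrite cat_path m1 l1E.
have step b' l a' : path (fun u v => v - u < eta) a' l -> forall i, (i < size l)%N ->
   nth b' (a' :: l) i.+1 - nth b' (a' :: l) i < eta.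
  by move=> /(pathP b') hp i il; exact: hp.
pose G u v := phi (yd u) (xd v - xd u).
have q1 : `|psum G s l1 - I| <= e / 2.
  apply: le_trans (norm_le_enorm _) _; apply: ltW; rewrite -(psumE G r).
  apply: (k1 l1 (nth r (s :: l1)) hl1).
    move=> i il; apply: lt_le_trans (step r _ _ m1 i il) _.
    by rewrite /eta ge_min lexx.
  by move=> i il; rewrite lexx (partition_nd hl1 (leqnSn i)).
have q2 : `|psum G s (l1 ++ l2) - I'| <= e / 2.
  apply: le_trans (norm_le_enorm _) _; apply: ltW; rewrite -(psumE G r').
  apply: (k2 (l1 ++ l2) (nth r' (s :: (l1 ++ l2))) hl).
    move=> i il; apply: lt_le_trans (step r' _ _ m12 i il) _.
    by rewrite /eta ge_min lexx orbT.
  by move=> i il; rewrite lexx (partition_nd hl (leqnSn i)).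
rewrite psum_cat l1E in q2.
have q3 : `|psum G r l2 - phi (yd r) (xd r' - xd r)| <= Cy * (c r' - c r) `^ (2 * g).
  apply: (young_local (H := 3) (H' := 1) Hphi g2 three0 ler01 _ _ _ hl2).
  - by move=> u v u1 u2 u3; apply: c_le => //; [exact: le_trans u1|exact: le_trans rT].
  - by move=> u v u1 u2 u3; apply: xd_holder => //; [exact: le_trans u1|exact: le_trans rT].
  - by move=> u v u1 u2 u3; apply: yd_holder => //; [exact: le_trans u1|exact: le_trans rT].
set P1 := psum G s l1 in q1 q2; set P2 := psum G r l2 in q2 q3.
set ph := phi (yd r) _ in q3 *.
have -> : yd r' - yd r - ph = (P2 - ph) + ((P1 - I) - (P1 + P2 - I')).
  by rewrite yr yr'; zmod.
apply: le_trans (ler_normD _ _) _; apply: lerD => //.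
by apply: le_trans (ler_normB _ _) _; rewrite [e]splitr; exact: lerD.
Qed.

Let yd_start : yd s = b0.
Proof.
have [I hI ->] := hint (introT andP (conj (lexx s) sTt)).
suff -> : I = 0 by rewrite addr0.
apply/eqP; rewrite -normr_le0; apply/ler_addgt0Pr => e e0; rewrite add0r.
have [eta _ k] := hI e e0.
have hl : itv_partition s s [::] by split => //=.
have := k [::] (fun=> s) hl (fun i => ltac:(by [])) (fun i => ltac:(by [])).
rewrite big_nil sub0r => lt; apply: le_trans (ltW lt).
by rewrite -normrN; exact: norm_le_enorm.
Qed.

(** Along a partition that is fine for the clock c, both yd and Y o lam are Euler
    schemes up to errors (Cy + M) w^(2 g); refine the partition and apply
    [stability]. *)
Lemma young_solution_unique r : s <= r -> r <= tau_ T -> yd r = Y (lam r).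
Proof.
move=> sr rT; have [C C0 hC] := retimed_holder.
case/andP: exponent_range => g2 g1.
have g20 : 0 < 2 * g - 1 by rewrite subr_gt0 double_gt1.
have L0 : 0 <= c r - c s by rewrite subr_ge0 c_le.
have C10 : 0 <= 1 + C by rewrite addr_ge0.
have Cy0 : 0 <= Cy.
  apply: mulr_ge0; first by apply: ltW; apply: sew_const_gt0; exact: double_gt1.
  by rewrite !mulr_ge0.
have h0 : 0 < h by case/andP: h01.
have [Q Q0 stab] := stability Hphi b01 exponent_range exponent_sum h0 three0 C10 L0.
apply/eqP; rewrite -subr_eq0 -normr_le0 distrC; apply/ler_addgt0Pr => e e0; rewrite add0r.
have CM0 : 0 <= Cy + M by exact: addr_ge0.
have [eps /andP[eps0 epsh] small] : exists2 eps : R, 0 < eps <= h &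
    Q * (Cy + M) * eps `^ (2 * g - 1) < e by apply: powR_lt_small => //; exact: mulr_ge0.
have [eta eta0 he] := c_unif eps0.
have [l [hl ml]] := fine_partition eta0 sr.
pose u := nth r (s :: l).
have uin i : s <= u i <= r by exact: partition_in.
have und i j : (i <= j)%N -> u i <= u j by move=> ij; exact: partition_nd.
have us i : s <= u i by case/andP: (uin i).
have uT i : u i <= tau_ T by case/andP: (uin i) => _ h'; exact: le_trans rT.
have uN : u (size l) = r by exact: itv_partition_nth_size hl.
have cu i : 0 <= c (u i.+1) - c (u i) <= eps.
  rewrite subr_ge0 c_le ?us ?uT ?und //=.
  have [il|li] := ltnP i (size l).
    have := pathP r ml i il; rewrite -[nth _ (s :: l) i]/(u i) -[nth _ l i]/(u i.+1) => st.
    apply: ltW; apply: le_lt_trans (ler_norm _) _; apply: he; rewrite ?us ?uT //.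
    by rewrite ger0_norm // subr_ge0 und.
  have uE j : (size l <= j)%N -> u j = r.
    by move=> lj; apply/eqP; rewrite eq_le; case/andP: (uin j) => _ ->; rewrite -{1}uN und.
  rewrite (uE _ li) (uE _ (leqW li)).
  by rewrite subrr ltW.
have E0 : 0 <= (Cy + M) * eps `^ (2 * g - 1) by rewrite mulr_ge0 // powR_ge0.
have := stab (yd \o u) (Y \o lam \o u) (xd \o u) (c \o u) _ E0 _ _ _ _ _ _ (size l).
rewrite /= uN.
have -> : u 0%N = s by [].
rewrite yd_start lam_s Y0 subrr normr0 add0r mulrA => key.
apply: le_trans (ltW small); apply: key.
- by move=> i j ij /=; apply: c_le => //; exact: und.
- by move=> i; rewrite lerD2r c_le //; case/andP: (uin i).
- by move=> i j ij; apply: xd_holder => //; exact: und.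
- move=> i j ij _; have nn := powR_ge0 (c (u j) - c (u i)) g.
  apply: le_trans (yd_holder (us i) (und _ _ ij) (uT j)) _.
  by apply: ler_wpM2r => //; rewrite lerDl.
- move=> i j ij _; have nn := powR_ge0 (c (u j) - c (u i)) g.
  apply: le_trans (hC _ _ (us i) (und _ _ ij) (uT j)) _.
  apply: (@le_trans _ _ (C * (c (u j) - c (u i)) `^ g)).
    by apply: ler_wpM2l => //; have [] := pow_c (us i) (und _ _ ij) (uT j) g0.
  by apply: ler_wpM2r => //; rewrite lerDr.
move=> i; have ii := und _ _ (leqnSn i); have /andP[dc0 dce] := cu i.
have y1 := young_defect (us i) ii (uT i.+1).
have [l1 l2 l3] := c_incr (us i) ii (uT i.+1).
have lh : lam (u i.+1) - lam (u i) <= h.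
  apply: le_trans epsh; apply: le_trans dce.
  have -> : c (u i.+1) - c (u i) = (lam (u i.+1) - lam (u i)) + (W (u i.+1) - W (u i)).
    by rewrite /c; ring.
  by rewrite lerDl.
have y2 := davie_retimed (us i) ii (uT i.+1) lh.
rewrite -!xdE ?us ?uT // in y2.
have g2pos : 0 < 2 * g by rewrite mulr_gt0.
have [pc _] := pow_c (us i) ii (uT i.+1) g2pos.
have {}y2 := le_trans y2 (ler_wpM2l M0 pc).
set Dc := c (u i.+1) - c (u i) in dc0 dce y1 y2 *.
have pw : Dc `^ (2 * g) <= eps `^ (2 * g - 1) * Dc.
  by apply: powR_superlinear dce; first exact: double_gt1.
have -> : Y (lam (u i.+1)) - yd (u i.+1) - (Y (lam (u i)) - yd (u i)) -
   (phi (Y (lam (u i))) (xd (u i.+1) - xd (u i)) - phi (yd (u i)) (xd (u i.+1) - xd (u i))) =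
   (Y (lam (u i.+1)) - Y (lam (u i)) - phi (Y (lam (u i))) (xd (u i.+1) - xd (u i))) -
   (yd (u i.+1) - yd (u i) - phi (yd (u i)) (xd (u i.+1) - xd (u i))) by zmod.
apply: le_trans (ler_normB _ _) _.
apply: le_trans (lerD y2 y1) _; rewrite -mulrDl [M + _]addrC -mulrA.
exact: ler_wpM2l.
Qed.

End Uniqueness.

Lemma geometric_davie y : geometric_solution delta p s T x f b0 y ->
  forall t, s <= t -> t <= T -> y t = Y (F t).
Proof.
move=> [xd [yd [h1 h2 h3 h4 h5]]] t st tT.
rewrite h5 ?st // (young_solution_unique h1 h2 h3 h4) //.
- by rewrite lam_at.
- by rewrite -{1}tau_s; apply: le_trans (clock_nd Ct _ st tT).
- exact: (clock_nd Ct).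
Qed.

End FromS.
End Geometric.

(** * Ranking the jumps *)

Section Gaps.
Variables (R : realType) (s T : R) (F Fl : R -> R).
Hypothesis C : clock s T F Fl.

Lemma sum_gaps l t : s <= t -> path <%R t l -> last t l <= T ->
  \sum_(u <- l) (F u - Fl u) <= F (last t l) - F t.
Proof.
elim: l t => [|u l IH] t st /=; first by rewrite big_nil subrr.
move=> /andP[tu pl] lT; have su := le_trans st (ltW tu).
have uT := le_trans (path_ge_start pl) lT.
rewrite big_cons; have := IH u su pl lT.
by have := clock_le_left C st tu uT; lra.
Qed.

(** The gaps are disjoint and lie in [F s, F T]. *)
Lemma large_gaps_finite (e : R) : s <= T -> 0 < e ->
  finite_set [set u | s < u <= T /\ e <= F u - Fl u].
Proof.
move=> sT e0; set S := [set u | _]; apply: contrapT => /infiniteP.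
move=> /pcard_leP[i].
pose k := (Num.truncn ((F T - F s) / e)).+1.
pose L := [seq i n | n <- iota 0 k].
have Lu : uniq L.
  rewrite map_inj_in_uniq ?iota_uniq // => a b _ _ ab.
  by have := @inj _ _ _ i a b; apply; rewrite ?inE.
have LS u : u \in L -> S u.
  by move=> /mapP[n _ ->]; apply: (@funS _ _ _ _ i).
have srt : path <%R s (sort <=%R L).
  have : sorted <%R (sort <=%R L) by rewrite sort_lt_sorted.
  have : {in sort <=%R L, forall u, s < u}.
    by move=> u; rewrite mem_sort => /LS[/andP[]].
  case: (sort _ _) => //= u l h ->; rewrite andbT.
  by apply: h; rewrite mem_head.
have lT : last s (sort <=%R L) <= T.
  have : {in sort <=%R L, forall u, u <= T}.
    by move=> u; rewrite mem_sort => /LS[/andP[]].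
  by case: (sort _ _) => //= u l h; apply: h; exact: mem_last.
have := sum_gaps (lexx s) srt lT.
have ls := path_ge_start srt.
have := clock_nd C ls lT (lexx T).
rewrite (perm_big L) ?perm_sort // => b1 b2.
have : k%:R * e <= \sum_(u <- L) (F u - Fl u).
  apply: (@le_trans _ _ (\sum_(u <- L) e)).
    by rewrite big_const_seq count_predT size_map size_iota iter_addr_0 mulr_natl.
  by rewrite !big_seq; apply: ler_sum => u /LS[].
have := truncnS_gt ((F T - F s) / e); rewrite -/k ltr_pdivrMr //; lra.
Qed.

End Gaps.

Section Ranking.
Variables (R : realType) (J : set R) (w : R -> R).
Hypothesis fin : forall u, J u -> finite_set [set v | J v /\ w u <= w v].

(* o is an admissible choice after the elements of l have been chosen *)
Let spec (l : seq R) (o : option R) :=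
  (forall u, o = Some u -> [/\ J u, u \notin l & forall v, J v -> v \notin l -> w v <= w u]) /\
  (o = None -> forall v, J v -> v \in l).

Lemma seq_max (l : seq R) (u : R) : u \in l ->
  exists2 v, v \in l & forall z, z \in l -> w z <= w v.
Proof.
elim: l u => // a l IH u _; case: (l =P [::]) => [->|].
  by exists a; [rewrite mem_head|move=> z; rewrite inE => /eqP ->].
case: l IH => // b l IH _; have [v vl vm] := IH b (mem_head _ _).
have [av|va] := leP (w a) (w v).
  by exists v; [rewrite inE vl orbT|move=> z; rewrite inE => /orP[/eqP ->|/vm]].
exists a; first by rewrite mem_head.
move=> z; rewrite inE => /orP[/eqP -> //|/vm h]; exact: le_trans (ltW va).
Qed.

Let spec_ex l : exists o, spec l o.
Proof.
have [[u0 [J0 n0]]|none] := pselect (exists u, J u /\ u \notin l); last first.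
  exists None; split => // _ v Jv; apply: contrapT => /negP nv; apply: none.
  by exists v.
have /finite_seqP[s sE] := fin J0.
pose s' := [seq v <- s | v \notin l].
have u0s : u0 \in s'.
  rewrite mem_filter n0; have : [set v | J v /\ w u0 <= w v] u0 by split.
  by rewrite sE.
have [v vs vm] := seq_max u0s.
have inS z : z \in s -> J z /\ w u0 <= w z.
  move=> zs; have : [set` s] z by [].
  by rewrite -sE.
move: vs; rewrite mem_filter => /andP[vl vs].
exists (Some v); split => // u [<-]; split => //; first by case: (inS v vs).
move=> z Jz zl; have [le|lt] := leP (w u0) (w z); last first.
  by apply: le_trans (ltW lt) _; case: (inS v vs).
apply: vm; rewrite mem_filter zl /=; have : [set v | J v /\ w u0 <= w v] z by split.
by rewrite sE.
Qed.

(** Greedy choice: each new element has the largest weight among those not chosen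
    yet.  It exists because only finitely many elements weigh at least as much as a
    given one, and for the same reason every element is chosen in the end. *)
Lemma ranking_exists : exists t : nat -> option R,
  [/\ forall u, (exists n, t n = Some u) <-> J u,
      forall n k u, t n = Some u -> t k = Some u -> n = k,
      forall n k, (n <= k)%N -> t n = None -> t k = None &
      forall n k u v, (n <= k)%N -> t n = Some u -> t k = Some v -> w v <= w u].
Proof.
have /choice [pick pickP] := spec_ex.
pose next l := if pick l is Some u then u :: l else l.
pose L n := iter n next [::].
pose t n := pick (L n).
have LS n u : t n = Some u -> L n.+1 = u :: L n.
  by move=> tn; rewrite /L iterS /next -/(L n); move: tn; rewrite /t => ->.
have LN n : t n = None -> L n.+1 = L n.
  by move=> tn; rewrite /L iterS /next -/(L n); move: tn; rewrite /t => ->.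
have Lsub n k v : (n <= k)%N -> v \in L n -> v \in L k.
  move=> nk vn; elim: k nk => [|k IH]; first by rewrite leqn0 => /eqP <-.
  rewrite leq_eqVlt => /orP[/eqP <- //|nk].
  case tk : (t k) => [u|]; [rewrite (LS _ _ tk) inE IH ?orbT // | rewrite (LN _ tk) IH //].
have inj n k u : (n < k)%N -> t n = Some u -> t k = Some u -> False.
  move=> nk tn tk; have [_ /negP nu _] := (pickP (L k)).1 _ tk; apply: nu.
  by apply: (@Lsub n.+1) => //; rewrite (LS _ _ tn) mem_head.
have None_mono n k : (n <= k)%N -> t n = None -> t k = None.
  move=> nk tn; elim: k nk => [|k IH]; first by rewrite leqn0 => /eqP <-.
  rewrite leq_eqVlt => /orP[/eqP <- //|nk].
  by rewrite /t (LN _ (IH nk)); exact: IH.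
have injE n k u : t n = Some u -> t k = Some u -> n = k.
  move=> tn tk; have [nk|kn|//] := ltngtP n k; first by case: (inj _ _ _ nk tn tk).
  by case: (inj _ _ _ kn tk tn).
exists t; split => //.
- move=> u; split=> [[n tn]|Ju]; first by have [] := (pickP (L n)).1 _ tn.
  apply: contrapT => no.
  have nL n : u \notin L n.
    elim: n => [|n IH] //; case tn : (t n) => [v|]; last by rewrite (LN _ tn).
    rewrite (LS _ _ tn) inE negb_or IH andbT; apply/eqP => uv.
    by apply: no; exists n; rewrite uv.
  have tS n : exists v, t n = Some v.
    case tn : (t n) => [v|]; first by exists v.
    by have := (pickP (L n)).2 tn u Ju; rewrite (negbTE (nL n)).
  have /choice [v vE] := tS.
  have /finite_seqP[s sE] := fin Ju.
  have vs n : v n \in s.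
    have : [set z | J z /\ w u <= w z] (v n); last by rewrite sE.
    by have [Jv _ vm] := (pickP (L n)).1 _ (vE n); split => //; exact: vm.
  have un : uniq [seq v n | n <- iota 0 (size s).+1].
    rewrite map_inj_in_uniq ?iota_uniq // => a b _ _ ab.
    by apply: (injE a b (v a)); rewrite vE // ab.
  have : ((size s).+1 <= size s)%N; last by rewrite ltnn.
  rewrite -{1}(size_iota 0 (size s).+1) -(size_map v).
  by apply: uniq_leq_size un _ => z /mapP[n _ ->].
- move=> n k u z nk tn tk; have [Jz /negP nz _] := (pickP (L k)).1 _ tk.
  have [_ _ um] := (pickP (L n)).1 _ tn; apply: um => //.
  by apply/negP => h; apply: nz; exact: Lsub h.
Qed.

End Ranking.

Section JumpRanking.
Variables (R : realType) (m : nat) (p T : R) (x : R -> 'cV[R]_m) (F Fl : R -> R).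
Hypothesis D : driver p T x F Fl.

Lemma jump_ranking_exists : exists t, jump_ranking T x t.
Proof.
have p0 : 0 < p by case/andP: (drv_p D) => p1 _; exact: lt_le_trans p1.
have [|t [t1 t2 t3 t4]] := @ranking_exists R (jump_times 0 T x) (fun u => enorm (jump x u)).
  move=> u [hu ju].
  pose C1 : R := (m * 1).+1%:R `^ p.
  have C10 : 0 < C1 by apply: powR_gt0.
  have q0 : 0 < enorm (jump x u) `^ p / C1 by rewrite divr_gt0 // powR_gt0 // enorm_gt0.
  apply: sub_finite_set (large_gaps_finite (drv_clock D) (drv_T D) q0) => v [[hv jv] uv] /=.
  split => //; case/andP: hv => v0 vT; rewrite ler_pdivrMr //.
  rewrite mulrC.
  apply: le_trans (jump_weight (drv_p D) (drv_cadlag D) (drv_clock D) (drv_incr D) v0 vT).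
  by apply: powR_le; [exact: ltW|exact: enorm_ge0|].
by exists t; split.
Qed.

End JumpRanking.

(** * Forward solutions *)

Section UniformConvergence.
Variables (R : realType) (V : normedModType R) (A : set R).
Implicit Types (zs : nat -> R -> V) (z : R -> V).

Lemma uniform_cvgE zs z : {uniform A, zs n @[n --> \oo] --> z} <->
  forall e : R, 0 < e -> exists N, forall n, (N <= n)%N -> forall t, A t -> `|z t - zs n t| < e.
Proof.
split=> [h e e0|h P /uniform_nbhs[E [entE sub]]].
  have /h : nbhs (z : {uniform` A -> V}) [set y : R -> V | forall t, A t -> `|z t - y t| < e].
    apply/uniform_nbhs; exists [set xy | ball xy.1 e xy.2]; split.
      exact: entourage_ball (PosNum e0).
    by move=> y hy t At; have := hy t At; rewrite /= -ball_normE.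
  by move=> [N _ hN]; exists N => n Nn t At; exact: (hN n Nn).
move: entE; rewrite -entourage_ballE => -[e /= e0 eE].
have [N hN] := h e e0; exists N => // n Nn; apply: sub => t At; apply: eE.
by rewrite /= -ball_normE /=; exact: hN.
Qed.

End UniformConvergence.

Lemma count_ltn (T : eqType) (v : T) (a1 a2 : pred T) (s : seq T) :
  (forall q, a1 q -> a2 q) -> v \in s -> a2 v -> ~~ a1 v -> (count a1 s < count a2 s)%N.
Proof.
move=> sub; elim: s => // q s IH; rewrite inE => /orP[/eqP <-|vs] b2 b1 /=.
  by rewrite b2 (negbTE b1) add0n add1n ltnS; exact: sub_count.
rewrite -addnS; apply: leq_add; last exact: IH.
by case h : (a1 q) => //; rewrite sub.
Qed.

Section Forward.
Variables (R : realType) (m d : nat) (p T : R) (x : R -> 'cV[R]_m) (F Fl : R -> R).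
Variable (f : 'cV[R]_d -> 'M[R]_(d, m)).
Let phi (y : 'cV[R]_d) (v : 'cV[R]_m) : 'cV[R]_d := f y *m v.
Variables (K b : R).
Hypotheses (D : driver p T x F Fl) (Hphi : c1beta phi K b)
  (b01 : 0 < b <= 1) (bp : p - 1 < b).
Let X := unfolded T x F Fl.
Let g := p^-1.
Let CF := drv_clock D.
Let T0 := drv_T D.
Let three0 : 0 <= 3 :> R. Proof. by []. Qed.
Let g12 : 2^-1 < g <= 1. Proof. exact: (exponent_range D). Qed.
Let bg : 1 < (1 + b) * g. Proof. exact: (exponent_sum D bp). Qed.
Let g0 : 0 < g. Proof. by case/andP: g12 => h _; apply: lt_trans h; rewrite invr_gt0. Qed.

(** Solving the equation on this set of times skips the segments that fill the gaps
    at the jump times in P. *)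
Definition allowed (P : set R) : set R :=
  `[F 0, F T] `&` \bigcap_(u in P `&` `]0, T]) ~` `]Fl u, F u[.

Lemma allowed_closed P : closed (allowed P).
Proof.
apply: closedI; first exact: interval_closed.
by apply: closed_bigI => u _; apply: open_closedC; exact: interval_open.
Qed.

Lemma allowed_in P r : allowed P r -> F 0 <= r <= F T.
Proof. by case; rewrite /= in_itv. Qed.

Lemma allowedP P r : F 0 <= r -> r <= F T ->
  (forall u, P u -> 0 < u -> u <= T -> ~~ (Fl u < r < F u)) -> allowed P r.
Proof.
move=> r1 r2 h; split; first by rewrite /= in_itv /= r1.
move=> u [Pu]; rewrite /= !in_itv /= => /andP[u0 uT].
by apply/negP; exact: h.
Qed.

Lemma allowed_not_in P r u : allowed P r -> P u -> 0 < u -> u <= T -> ~~ (Fl u < r < F u).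
Proof.
move=> [_ h] Pu u0 uT; apply/negP; have := h u; rewrite /= !in_itv /=; apply.
by split => //; rewrite u0.
Qed.

Lemma F_allowed P t : 0 <= t -> t <= T -> allowed P (F t).
Proof.
move=> t0 tT; apply: allowedP; [exact: (clock_nd CF)|exact: (clock_nd CF)|].
move=> u _ u0 uT; apply/negP => /andP[h1 h2]; have [tu|ut] := ltP t u.
  by have := clock_le_left CF t0 tu uT; rewrite leNgt h1.
by have := clock_nd CF (ltW u0) ut tT; rewrite leNgt h2.
Qed.

Lemma Fl_allowed P v : 0 < v -> v <= T -> allowed P (Fl v).
Proof.
move=> v0 vT; apply: allowedP.
- exact: (clock_start_le CF (ltW v0)).
- apply: le_trans (clock_left_le CF (ltW v0) vT) _; exact: (clock_nd CF (ltW v0)).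
move=> u _ u0 uT; apply/negP => /andP[h1 h2]; have [uv|vu|uv] := ltgtP u v.
- by have := clock_le_left CF (ltW u0) uv vT; rewrite leNgt h2.
- have := clock_lt_left CF (ltW v0) vu uT => lt.
  have := le_lt_trans (clock_left_le CF (ltW v0) vT) lt; rewrite ltNge.
  by rewrite (ltW h1).
- by move: h1; rewrite uv ltxx.
Qed.

Lemma allowed_gap P u : P u -> 0 < u -> u <= T -> is_gap (allowed P) (Fl u) (F u).
Proof. by move=> Pu u0 uT q Aq; exact: (allowed_not_in Aq). Qed.

(** Every point of ]r, r'[ was removed with some gap, and the end points of the gaps
    themselves remain. *)
Lemma allowed_gapP P r r' : allowed P r -> allowed P r' -> r < r' ->
  is_gap (allowed P) r r' -> exists u, [/\ P u, 0 < u, u <= T, r = Fl u & r' = F u].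
Proof.
move=> Ar Ar' rr' gap; pose q := (r + r') / 2.
have [rq qr'] : r < q /\ q < r' by rewrite /q; split; lra.
have /andP[r1 r2] := allowed_in Ar; have /andP[r1' r2'] := allowed_in Ar'.
have [u [Pu [u0 uT] hq]] : exists u, [/\ P u, (0 < u /\ u <= T) & Fl u < q < F u].
  apply: contrapT => no; have Aq : allowed P q.
    apply: allowedP; [by apply: le_trans r1 (ltW rq)|by apply: le_trans r2'; exact: ltW|].
    by move=> u Pu u0 uT; apply/negP => h; apply: no; exists u.
  by have := gap q Aq; rewrite rq qr'.
case/andP: hq => q1 q2; exists u; split => //.
- have a1 := gap _ (Fl_allowed P u0 uT); have a2 := allowed_not_in Ar Pu u0 uT.
  apply/eqP; rewrite eq_le; apply/andP; split; rewrite leNgt; apply/negP => h.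
    by move: a2; rewrite h (lt_trans rq).
  by move: a1; rewrite h (lt_trans q1).
- have a1 := gap _ (F_allowed P (ltW u0) uT); have a2 := allowed_not_in Ar' Pu u0 uT.
  apply/eqP; rewrite eq_le; apply/andP; split; rewrite leNgt; apply/negP => h.
    by move: a1; rewrite h (lt_trans rq).
  by move: a2; rewrite h (lt_trans q1).
Qed.

Lemma unfolded_holder_FT r r' : F 0 <= r -> r <= r' -> r' <= F T -> `|X r' - X r| <= 3 * (r' - r) `^ g.
Proof. exact: (unfolded_holder D). Qed.

Lemma davie_on_sub h M (A B : set R) Y : B `<=` A -> davie_on phi g h M X A Y ->
  davie_on phi g h M X B Y.
Proof. by move=> BA hY r r' /BA Br /BA Br'; exact: hY. Qed.

Lemma interval_no_gaps a c Y : exact_gaps phi X `[a, c] Y.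
Proof.
move=> r r'; rewrite /= !in_itv /= => /andP[ar rc] /andP[ar' rc'] rr' gap.
have : ~~ (r < (r + r') / 2 < r').
  by apply: gap; rewrite /= in_itv /=; apply/andP; split; lra.
by case/negP; apply/andP; split; lra.
Qed.

Section Solutions.
Variables (h M : R).
Hypotheses (h01 : 0 < h <= 1) (M0 : 0 <= M).
Hypothesis ex : forall (A : set R) (r0 L : R) (y0 : 'cV[R]_d),
  A r0 -> (forall r, A r -> r0 <= r <= L) ->
  (forall r r', A r -> A r' -> r <= r' -> `|X r' - X r| <= 3 * (r' - r) `^ g) ->
  exists Y : R -> 'cV[R]_d,
    [/\ Y r0 = y0, davie_on phi g h M X A Y & exact_gaps phi X A Y].

(** One Davie solution serves for every delta, since the F-clock does not involve
    delta. *)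
Lemma restarted_solution s y0 : 0 <= s -> s <= T -> exists Y : R -> 'cV[R]_d,
  [/\ Y (F s) = y0, davie_on phi g h M X `[F s, F T] Y &
      forall delta, 0 < delta -> geometric_solution delta p s T x f y0 (Y \o F)].
Proof.
move=> s0 sT; have F0s := clock_nd CF (lexx 0) s0 sT.
have FsT := clock_nd CF s0 sT (lexx T).
have [|||Y [Y1 Y2 _]] := @ex `[F s, F T] (F s) (F T) y0.
- by rewrite /= in_itv /= lexx.
- by move=> r; rewrite /= in_itv.
- move=> r r'; rewrite /= !in_itv /= => /andP[a1 a2] /andP[a3 a4] rr'.
  by apply: unfolded_holder_FT => //; exact: le_trans a1.
exists Y; split => // delta d0.
exact: (davie_geometric D Hphi h01 M0 d0 s0 sT Y1 Y2).
Qed.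

Lemma geometric_unique s y0 delta y delta' y' t : 0 <= s -> 0 < delta -> 0 < delta' ->
  geometric_solution delta p s T x f y0 y -> geometric_solution delta' p s T x f y0 y' ->
  s <= t -> t <= T -> y t = y' t.
Proof.
move=> s0 d0 d0' hy hy' st tT; have sT := le_trans st tT.
have [Y [Y1 Y2 _]] := restarted_solution y0 s0 sT.
rewrite (geometric_davie D Hphi b01 bp h01 M0 d0 s0 sT Y1 Y2 hy) //.
by rewrite (geometric_davie D Hphi b01 bp h01 M0 d0' s0 sT Y1 Y2 hy').
Qed.

Lemma allowed_solution (P : set R) (a : 'cV[R]_d) : exists Y : R -> 'cV[R]_d,
  [/\ Y (F 0) = a, davie_on phi g h M X (allowed P) Y & exact_gaps phi X (allowed P) Y].
Proof.
apply: (@ex _ _ (F T)); first exact: F_allowed.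
  by move=> r; exact: allowed_in.
move=> r r' /allowed_in/andP[a1 _] /allowed_in/andP[_ a2] rr'.
exact: unfolded_holder_FT.
Qed.

Lemma allowed_left_limit (P : set R) Y u : davie_on phi g h M X (allowed P) Y ->
  0 < u -> u <= T -> left_limit_at (Y \o F) 0 u (Y (Fl u)).
Proof.
move=> hY u0 uT e e0; have K0 := c1_ge0 Hphi.
have KM : 0 <= K * 3 + M by rewrite addr_ge0 // mulr_ge0.
have [e1 /andP[e10 e1h] small] : exists2 e1 : R, 0 < e1 <= h & (K * 3 + M) * e1 `^ g < e.
  by apply: powR_lt_small.
have [eta eta0 he] := clock_ll CF u0 uT e10.
exists eta => // r hr r0; have ru : r < u by case/andP: hr.
have := he r hr r0; have le := clock_le_left CF r0 ru uT.
rewrite distrC ger0_norm ?subr_ge0 // => lt.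
have Ar : allowed P (F r) by apply: F_allowed => //; exact: ltW (lt_le_trans ru uT).
have Au : allowed P (Fl u) by exact: Fl_allowed.
have /andP[a1 a2] := allowed_in Ar; have /andP[a3 a4] := allowed_in Au.
have := davie_incr Hphi g12 h01 M0 hY Ar Au le (le_trans (ltW lt) e1h) (unfolded_holder_FT a1 le a4).
rewrite distrC => /le_lt_trans; apply; apply: le_lt_trans small.
by apply: ler_wpM2l => //; apply: powR_le; [exact: ltW|rewrite subr_ge0|exact: ltW].
Qed.

Section Ranked.
Variables (a : 'cV[R]_d) (t : nat -> option R).
Hypothesis rk : jump_ranking T x t.

Definition first_jumps (n : nat) : set R := [set u | exists2 i, (i < n)%N & t i = Some u].

Lemma ranked_jump i u : t i = Some u -> [/\ 0 < u, u <= T & jump x u != 0].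
Proof.
move=> ti; have [/(_ u)[h1 _] _ _ _] := rk.
by have [/andP[u0 uT] j0] := h1 (ex_intro _ i ti).
Qed.

(** At a ranked jump the Euler step across the removed gap is the forward jump rule.
    Between such jumps nothing has been removed, so the solution coincides there
    with the one on an interval, which is geometric. *)
Lemma corrected_of_davie n Y delta : 0 < delta -> Y (F 0) = a ->
  davie_on phi g h M X (allowed (first_jumps n)) Y ->
  exact_gaps phi X (allowed (first_jumps n)) Y ->
  jump_corrected delta p T x f a t n (Y \o F).
Proof.
move=> d0 Y0 hY gY; split => //.
- move=> i u ilt ti; have [u0 uT j0] := ranked_jump ti.
  have [cv lE] := left_limit_lim u0 (allowed_left_limit hY u0 uT); split => //.
  have Pu : first_jumps n u by exists i.
  have Fgap : Fl u < F u.
    rewrite lt_neqAle (clock_left_le CF (ltW u0) uT) andbT eq_sym.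
    by rewrite (drv_gap D) // j0.
  have := gY _ _ (Fl_allowed _ u0 uT) (F_allowed _ (ltW u0) uT) Fgap (allowed_gap Pu u0 uT).
  rewrite lE /= => ->; rewrite addrAC subrr add0r /phi.
  by rewrite /X (unfolded_at D (ltW u0) uT) (unfolded_left D u0 uT).
move=> s u s0 su uT none; have sT := ltW (lt_le_trans su uT).
have [Y' [Y1 Y2 Y3]] := restarted_solution (Y (F s)) s0 sT.
exists (Y' \o F); first exact: Y3.
have Fsu := clock_inc CF s0 su uT; have FuT := clock_nd CF (ltW (le_lt_trans s0 su)) uT (lexx T).
have F0s := clock_nd CF (lexx 0) s0 sT.
apply: (davie_unique Hphi g12 three0 b01 bg h01 M0 (A := `[F s, F u])
  (r0 := F s) (r1 := F u) (X := X) (Y := Y) (Y' := Y')).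
- exact: interval_closed.
- by rewrite /= in_itv /= ?lexx (ltW Fsu).
- by rewrite /= in_itv /= ?lexx (ltW Fsu).
- exact: ltW.
- move=> r r'; rewrite /= !in_itv /= => /andP[a1 a2] /andP[a3 a4] rr'.
  by apply: unfolded_holder_FT => //; [exact: le_trans a1|exact: le_trans FuT].
- apply: davie_on_sub hY => r; rewrite /= in_itv /= => /andP[a1 a2].
  apply: allowedP; [exact: le_trans a1|exact: le_trans FuT|].
  move=> v [i ilt ti] v0 vT; apply/negP => /andP[b1 b2].
  apply: (none i v ilt ti); rewrite !ltNge; apply/andP; split.
    apply/negP => vs; have := clock_nd CF (ltW v0) vs sT => le.
    by move: (lt_le_trans b2 (le_trans le a1)); rewrite ltxx.
  rewrite leNgt; apply/negP => uv.
  have le := clock_le_left CF (ltW (le_lt_trans s0 su)) uv vT.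
  by move: (lt_le_trans b1 (le_trans a2 le)); rewrite ltxx.
- apply: davie_on_sub Y2 => r; rewrite /= !in_itv /= => /andP[-> a2].
  exact: le_trans FuT.
- exact: interval_no_gaps.
- exact: interval_no_gaps.
- by [].
Qed.

(** Induction on the number of ranked jumps in [0, u].  Up to the last one, at v, the
    two paths agree by induction; so they have the same left limit at v, the same
    jump there, and they follow the same geometric solution from v to u. *)
Lemma corrected_unique n delta z delta' z' : 0 < delta -> 0 < delta' ->
  jump_corrected delta p T x f a t n z -> jump_corrected delta' p T x f a t n z' ->
  forall u, 0 <= u -> u <= T -> z u = z' u.
Proof.
move=> d0 d0' [z0 zj zg] [z0' zj' zg'].
pose s := pmap t (iota 0 n).
have mem_s v : v \in s <-> first_jumps n v.
  rewrite mem_pmap; split=> [/mapP[i]|[i ilt ti]].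
    by rewrite mem_iota /= => ilt ti; exists i.
  by rewrite -ti; apply: map_f; rewrite mem_iota.
pose before u := [seq v <- s | v <= u].
suff H k u : (size (before u) <= k)%N -> 0 <= u -> u <= T -> z u = z' u.
  by move=> u; apply: (H (size (before u))).
elim: k u => [|k IH] u sz u0 uT.
all: have [->|un0] := eqVneq u 0; [by rewrite z0 z0'|].
all: have {un0} ugt0 : 0 < u by rewrite lt_neqAle eq_sym un0.
- have none i v : (i < n)%N -> t i = Some v -> ~ (0 < v <= u).
    move=> ilt ti /andP[_ vu]; have : v \in before u.
      by rewrite mem_filter vu; apply/mem_s; exists i.
    by move: sz; rewrite leqn0 size_eq0 => /eqP ->.
  have [y gy ->] := zg 0 u (lexx 0) ugt0 uT none.
  have [y' gy' ->] := zg' 0 u (lexx 0) ugt0 uT none.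
  rewrite z0 in gy; rewrite z0' in gy'.
  exact: (geometric_unique (lexx 0) d0 d0' gy gy').
have [e|ne] := eqVneq (before u) [::]; first by apply: IH => //; rewrite e.
have [v0 v0in] : exists v0, v0 \in before u.
  by move: ne; case: (before u) => // v0 ? _; exists v0; rewrite mem_head.
have [v vin vmax] := @seq_max R id _ _ v0in.
move: (vin); rewrite mem_filter => /andP[vu /mem_s[i ilt ti]].
have [vgt0 vT jv] := ranked_jump ti.
have agree w : 0 <= w -> w < v -> z w = z' w.
  move=> w0 wv; apply: IH => //; last exact: ltW (lt_le_trans wv vT).
  rewrite -ltnS; apply: leq_trans sz; rewrite !size_filter.
  apply: (@count_ltn _ v) => //; last by rewrite -ltNge.
    by move=> q qw; exact: le_trans qw (le_trans (ltW wv) vu).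
  by apply/mem_s; exists i.
have [cv jz] := zj i v ilt ti; have [cv' jz'] := zj' i v ilt ti.
have lE : left_lim z v = left_lim z' v.
  apply: (left_limit_uniq vgt0 _ (@cvg_left_limit _ _ z' 0 _ cv')) => e e0.
  have [eta eta0 he] := @cvg_left_limit _ _ z 0 _ cv e e0.
  exists eta => // r hr r0; have /andP[_ rv] := hr.
  by rewrite -(agree r r0 rv); exact: he.
have zv : z v = z' v.
  by rewrite -(subrK (left_lim z v) (z v)) jz lE -jz' subrK.
move: vu; rewrite le_eqVlt => /orP[/eqP <- //|vu].
have none i' v' : (i' < n)%N -> t i' = Some v' -> ~ (v < v' <= u).
  move=> i'lt ti' /andP[vv' v'u]; have : v' \in before u.
    by rewrite mem_filter v'u; apply/mem_s; exists i'.
  by move/vmax; rewrite leNgt vv'.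
have [y gy ->] := zg v u (ltW vgt0) vu uT none.
have [y' gy' ->] := zg' v u (ltW vgt0) vu uT none.
rewrite -zv in gy'.
exact: (geometric_unique (ltW vgt0) d0 d0' gy gy' (ltW vu) uT).
Qed.

Lemma large_gaps_ranked (e : R) : 0 < e -> exists N, forall u, jump_times 0 T x u ->
  e <= F u - Fl u -> first_jumps N u.
Proof.
move=> e0; have [rk1 _ _ _] := rk.
have /finite_seqP[s sE] := large_gaps_finite CF T0 e0.
have [N hN] : exists N, forall u, u \in s -> jump_times 0 T x u -> first_jumps N u.
  elim: s {sE} => [|v s [N hN]]; first by exists 0%N.
  have [Jv|nJ] := pselect (jump_times 0 T x v); last first.
    by exists N => u; rewrite inE => /orP[/eqP -> //|]; exact: hN.
  have [i ti] := (rk1 v).2 Jv; exists (maxn N i.+1) => u.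
  rewrite inE => /orP[/eqP -> _|us Ju]; first by exists i => //; rewrite leq_max ltnSn orbT.
  have [j jN tj] := hN u us Ju; exists j => //; by rewrite leq_max jN.
exists N => u Ju hu; apply: hN => //; have [hu1 _] := Ju.
have : [set u | 0 < u <= T /\ e <= F u - Fl u] u by split.
by rewrite sE.
Qed.

(** Walk along a chain in the complement of all the gaps.  Its steps are shorter than
    eps or cross a gap longer than eps; for n large that gap is removed for Yn n as
    well, and both solutions make the exact step. *)
Lemma corrected_converge (Yn : nat -> R -> 'cV[R]_d) (Y : R -> 'cV[R]_d) :
  (forall n, [/\ Yn n (F 0) = a, davie_on phi g h M X (allowed (first_jumps n)) (Yn n) &
     exact_gaps phi X (allowed (first_jumps n)) (Yn n)]) ->
  Y (F 0) = a -> davie_on phi g h M X (allowed (jump_times 0 T x)) Y ->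
  exact_gaps phi X (allowed (jump_times 0 T x)) Y ->
  {uniform `[0, T], (fun n => Yn n \o F) n @[n --> \oo] --> Y \o F}.
Proof.
move=> hn Y0 hY gY; apply/uniform_cvgE => e e0.
have F0T : F 0 <= F T by exact: (clock_nd CF).
have L0 : 0 <= F T - F 0 by rewrite subr_ge0.
have [Q Q0 cmp] := davie_compare Hphi g12 three0 b01 bg h01 M0 L0.
have g20 : 0 < 2 * g - 1 by rewrite subr_gt0 double_gt1 //; case/andP: g12.
have [eps /andP[eps0 epsh] small] := powR_lt_small h01 Q0 g20 e0.
have [N hN] := large_gaps_ranked eps0.
exists N => n Nn t'; rewrite /= in_itv /= => /andP[t0 tT].
have [n0 n1 n2] := hn n.
set A := allowed (jump_times 0 T x) in hY gY.
have sub : A `<=` allowed (first_jumps n).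
  move=> r Ar; have /andP[r1 r2] := allowed_in Ar; apply: allowedP => // u [i ilt ti] u0 uT.
  have [_ _ j0] := ranked_jump ti.
  by apply: (allowed_not_in Ar) => //; split => //; rewrite u0.
have A0 : A (F 0) by exact: F_allowed.
have At : A (F t') by exact: F_allowed.
have [u [u0 [k uk] und uA ust]] :=
  chain_exists (@allowed_closed (jump_times 0 T x)) eps0 A0 At (clock_nd CF (lexx 0) t0 tT).
rewrite /= -uk; apply: le_lt_trans small.
apply: (cmp X A (Yn n) Y u eps) => //.
- move=> r r' /allowed_in/andP[a1 _] /allowed_in/andP[_ a2] rr'; exact: unfolded_holder_FT.
- exact: davie_on_sub n1.
- by move=> i; case: (uA i).
- move=> i; rewrite u0 lerD2r; case: (uA i) => _ ui; apply: (le_trans ui).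
  exact: (clock_nd CF).
- move=> i; have [sh|[lt gap]] := ust i; first by left.
  have [Ai _] := uA i; have [Ai1 _] := uA i.+1.
  have [v [Jv v0 vT r1 r2]] := allowed_gapP Ai Ai1 lt gap.
  have [le|gt] := leP (u i.+1 - u i) eps; [by left|right].
  split; last exact: gY.
  have Pv : first_jumps n v.
    have big : eps <= F v - Fl v by rewrite -r1 -r2 ltW.
    have [j jN tj] := hN v Jv big; exists j => //; exact: leq_trans Nn.
  apply: n2 => //; [exact: sub|exact: sub|].
  by rewrite r1 r2; exact: allowed_gap.
- by rewrite u0 n0.
Qed.

End Ranked.
End Solutions.
End Forward.

(** * Existence and uniqueness of both solutions *)

Theorem theorem1p1 (R : realType) (m d : nat) (p alpha T : R)
    (x : R -> 'cV[R]_m) (f : 'cV[R]_d -> 'M[R]_(d, m)) (a : 'cV[R]_d)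
    (hp : 1 <= p < 2) (hT : 0 <= T)
    (hx : cadlag 0 T x) (hxp : (pvariation p 0 T x < +oo)%E)
    (halpha : p < alpha) (hf : Lip alpha f) :
  (exists y : R -> 'cV[R]_d,
     (forall delta : R, 0 < delta ->
        geometric_solution delta p 0 T x f a y) /\
     (forall (delta : R) (y' : R -> 'cV[R]_d), 0 < delta ->
        geometric_solution delta p 0 T x f a y' ->
        forall t, 0 <= t <= T -> y' t = y t)) /\
  (exists z : R -> 'cV[R]_d,
     (forall delta : R, 0 < delta ->
        forward_solution delta p T x f a z) /\
     (forall (delta : R) (z' : R -> 'cV[R]_d), 0 < delta ->
        forward_solution delta p T x f a z' ->
        forall t, 0 <= t <= T -> z' t = z t)).
Proof.
have [K [b [b0 b1 bp Hphi]]] := Lip_field hp halpha hf.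
have b01 : 0 < b <= 1 by rewrite b0.
have [F [Fl [CF incr gaps]]] := variation_clock hp hx hxp.
have D : driver p T x F Fl by split.
(* 3 is the Hoelder constant of the unfolded path *)
have [h [M [h0 h1 M0 ex]]] := davie_exists (H := 3) Hphi (exponent_range D) (ler0n _ _).
have h01 : 0 < h <= 1 by rewrite h0.
have {}ex := ex (unfolded T x F Fl).
split.
  have [Y [_ _ geo]] := restarted_solution D Hphi h01 M0 ex a (lexx 0) hT.
  exists (Y \o F); split => // delta y' d0 hy' t /andP[t0 tT].
  exact: (geometric_unique D Hphi b01 bp h01 M0 ex (lexx 0) d0 ltr01 hy' (geo 1 ltr01)).
have [Y [Y0 hY gY]] := allowed_solution D ex (jump_times 0 T x) a.
have corr t : jump_ranking T x t -> exists zs : nat -> R -> 'cV[R]_d,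
    (forall delta n, 0 < delta -> jump_corrected delta p T x f a t n (zs n)) /\
    {uniform `[0, T], zs n @[n --> \oo] --> Y \o F}.
  move=> rk; have [Yn hYn] := choice (fun n => allowed_solution D ex (first_jumps t n) a).
  exists (fun n => Yn n \o F); split.
    move=> delta n d0; have [n0 n1 n2] := hYn n.
    exact: (corrected_of_davie D Hphi b01 bp h01 M0 ex rk d0 n0 n1 n2).
  exact: (corrected_converge D Hphi b01 bp h01 M0 rk hYn Y0 hY gY).
exists (Y \o F); split=> [delta d0|delta z' d0 [[t rk] hz'] s /andP[s0 sT]].
  split; first exact: (jump_ranking_exists D).
  by move=> t /corr[zs [zs1 zs2]]; exists zs; split => // n; exact: zs1.
have [zs [zs1 /uniform_cvgE zs2]] := corr t rk.
have [zs' [zs1' /uniform_cvgE zs2']] := hz' t rk.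
apply/eqP; rewrite -subr_eq0 -normr_le0; apply/ler_addgt0Pr => e e0; rewrite add0r.
have e20 : 0 < e / 2 by rewrite divr_gt0.
have [N1 h1'] := zs2 _ e20; have [N2 h2'] := zs2' _ e20.
have As : s \in `[0, T] by rewrite in_itv /= s0.
pose n := maxn N1 N2.
have c1 := h1' n (leq_maxl _ _) s As; have c2 := h2' n (leq_maxr _ _) s As.
have eq := corrected_unique D Hphi b01 bp h01 M0 ex rk d0 d0 (zs1' n) (zs1 delta n d0) s0 sT.
rewrite -(subrK (zs' n s) (z' s)) -addrA; apply: le_trans (ler_normD _ _) _.
rewrite [e]splitr; apply: ltW; apply: ltrD => //.
by rewrite eq distrC.
Qed.
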